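(* Consider the controlled branching process of the context and assume conditions (AD0) and (AD-S) stated there, with common auxiliary rate $\theta\in(0,1)$ and $a=m\tau>1$. Define $$b_n^{\mathrm{sc}}(r):=\begin{cases}\theta^n,&\theta a^r>1,\\ n\theta^n,&\theta a^r=1,\\ a^{-rn},&\theta a^r<1.\end{cases}$$ Then for $Y_n=X_n$ and for $Y_n=N_n$, and every $r>0$, $$0<\liminf_{n\to\infty}\frac{\mathbf E[Y_n^{-r};Y_n>0]}{b_n^{\mathrm{sc}}(r)}\le\limsup_{n\to\infty}\frac{\mathbf E[Y_n^{-r};Y_n>0]}{b_n^{\mathrm{sc}}(r)}<\infty .$$ If, for some $p\ge2$ and $q:=p/2$, $\mathbf E|\xi-m|^p<\infty$ and $\sup_{k\ge1}k^{-p/2}\mathbf E|\phi(k)-\tau k|^p<\infty$, then for every $\varepsilon>0$ and $j=1,2,3$ $$\limsup_{n\to\infty}\frac{J_{n,j}(\varepsilon)}{b_n^{\mathrm{sc}}(q)}<\infty .$$ If condition (AD-E) of the context holds, then $\limsup_{n\to\infty}\theta^{-n}J_{n,j}(\varepsilon)<\infty$ for every $\varepsilon>0$ and $j=1,2,3$.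
   Context: Notation: $\mathbf E[Y;B]=\mathbf E[Y\mathbf 1_B]$; p.g.f. = probability generating function. Model. $\xi_{n,j}$ are i.i.d. copies of a nonnegative integer-valued $\xi$ with mean $m\in(0,\infty)$ and p.g.f. $f$. The random control functions $\phi_n:\{0,1,2,\dots\}\to\{0,1,2,\dots\}$ are i.i.d. copies of $\phi$, independent of the offspring array and of $X_0$. $N_n:=\phi_n(X_n)$, $X_{n+1}:=\sum_{j=1}^{N_n}\xi_{n,j}$. $F_0$ is the p.g.f. of $X_0$, and $h_k(s):=\mathbf E[s^{\phi(k)}]$. (AD0): there are p.g.f.s $l_L,l_U,d_L,d_U$ with $d_e(1)=l_e(1)=1$ ($e\in\{L,U\}$) such that $d_L(s)l_L(s)^k\le h_k(s)\le d_U(s)l_U(s)^k$ for all $k\in\{0,1,2,\dots\}$, $0\le s\le1$; $l_L'(1)=l_U'(1)=:\tau\in(0,\infty)$; and $l_L''(1)+l_U''(1)<\infty$ (the last is required whenever harmonic moments of $N_n$ are asserted). Put $u_e:=l_e\circ f$, $R_e:=d_e\circ f$, $a:=m\tau$. (AD-S): $a>1$. For each $e\in\{L,U\}$, $q_e\in[0,1)$ is the attracting fixed point of $u_e$, with $0<u_e'(q_e)<1$, and $\eta_e$ denotes a random variable with p.g.f. $R_e$. Define $\theta_e:=R_e(0)u_e'(0)$ if $q_e=0$; $\theta_e:=R_e(q_e)$ if $q_e>0$ and $R_e(q_e)<1$; $\theta_e:=u_e'(q_e)$ if $q_e>0$ and $R_e\equiv1$. Assume $\theta_L=\theta_U=:\theta\in(0,1)$.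 With $u_e(s)=\sum_{k\ge0}u_{e,k}s^k$, assume $\sum_{k\ge1}k\log^+k\,u_{e,k}<\infty$ and $\mathbf E\log(1+\eta_e)<\infty$ for both $e$. Initial-support condition for each $e$: if $q_e=0$, then $F_0(s)=\mu_1s+O(s^2)$ as $s\downarrow0$ for some $\mu_1>0$; if $q_e>0$ and $R_e\equiv1$, then $F_0'(q_e)>0$. If one envelope is in the branch $q_e>0$, $R_e\equiv1$, then both are in that branch and $q_L=q_U$. (AD-E): $\xi$ has a moment generating function finite in a neighborhood of zero; $\Lambda_\phi(\eta):=\lim_{k\to\infty}k^{-1}\log\mathbf E[e^{\eta\phi(k)}]$ exists on an open interval containing $0$, is differentiable there, and $\Lambda_\phi'(0)=\tau$; and $\inf_{|x-\tau|\ge\varepsilon}\Lambda_\phi^*(x)>0$ for every $\varepsilon>0$, where $\Lambda_\phi^*(x):=\sup_\eta\{\eta x-\Lambda_\phi(\eta)\}$. Ratio-deviation probabilities: $J_{n,1}(\varepsilon):=\mathbf P(N_n>0,\ |X_{n+1}/N_n-m|>\varepsilon)$; $J_{n,2}(\varepsilon):=\mathbf P(X_n>0,\ |N_n/X_n-\tau|>\varepsilon)$; $J_{n,3}(\varepsilon):=\mathbf P(X_n>0,\ |X_{n+1}/X_n-a|>\varepsilon)$. *)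

(* Defs.v *)
From HB Require Import structures.
From mathcomp Require Import all_boot all_order all_algebra.
From mathcomp Require Import finmap.
From mathcomp Require Import all_classical all_reals all_analysis.

Set Implicit Arguments.
Unset Strict Implicit.
Unset Printing Implicit Defensive.

Import Order.TTheory GRing.Theory Num.Def Num.Theory.
Import numFieldNormedType.Exports.

Local Open Scope classical_set_scope.
Local Open Scope ring_scope.

(* Random control functions are random elements of [nat -> nat] with the
   product sigma-algebra; by this choice the law of a control function is the
   joint law of all its values. *)
Definition cylinder : set_system (nat -> nat) :=
  [set A | exists (k : nat) (B : set nat), A = (fun g => g k) @^-1` B].

Definition control := g_sigma_algebraType cylinder.

Section probability.
Context (R : realType) (d : measure_display) (T : measurableType d)
  (P : probability T R).

(* The p.g.f. of Y. For [P] a law on [nat] itself, [pgf P id] is the p.g.f. of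
   that law. The function is a convergent power series on [-1, 1], hence its
   two-sided derivative at 0 is the usual one. *)
Definition pgf (Y : T -> nat) (s : R) : R := Rintegral P setT (fun t => s ^+ Y t).

Definition sigma_of (d' : measure_display) (S : measurableType d') (Y : T -> S) :
    set_system T :=
  preimage_set_system setT Y measurable.

Definition mutually_independent (I : choiceType) (F : I -> set_system T) : Prop :=
  forall (K : {fset I}) (A : I -> set T), (forall i, i \in K -> F i (A i)) ->
    P (\bigcap_(i in [set` K]) A i) = (\prod_(i <- K) P (A i))%E.

Definition same_law (d' : measure_display) (S : measurableType d')
    (Y Z : T -> S) : Prop :=
  forall A : set S, measurable A -> P (Y @^-1` A) = P (Z @^-1` A).

(* E[Y^{-r}; Y > 0] *)
Definition harmonic_moment (Y : T -> nat) (r : R) : \bar R :=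
  \int[P]_(t in [set t | (0 < Y t)%N]) (((Y t)%:R `^ (- r))%:E).

(* P(D > 0, |V / D - c| > eps) *)
Definition ratio_deviation (V D : T -> nat) (c eps : R) : \bar R :=
  P [set t | (0 < D t)%N /\ eps < `|(V t)%:R / (D t)%:R - c|].

End probability.

Section process.
Context (R : realType) (d : measure_display) (T : measurableType d)
  (P : probability T R).
Variables (X0 : {RV P >-> nat}) (xis : nat -> nat -> {RV P >-> nat})
  (phis : nat -> {RV P >-> control}).

(* The offspring variables xi_{n,1}, xi_{n,2}, ... are [xis n 0], [xis n 1], ... *)
Fixpoint popX (n : nat) (t : T) : nat :=
  if n is n'.+1 then (\sum_(j < phis n' t (popX n' t)) xis n' j t)%N else X0 t.

Definition popN (n : nat) (t : T) : nat := phis n t (popX n t).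

Definition source_sigma (i : unit + nat + nat * nat) : set_system T :=
  match i with
  | inl (inl _) => sigma_of X0
  | inl (inr n) => sigma_of (phis n)
  | inr (n, j) => sigma_of (xis n j)
  end.

(* [xi] and [phi] only serve as representatives of the common laws; nothing is
   assumed about their joint law with the other variables, so that taking them
   on the same probability space is no restriction. *)
Record cbp_model (xi : {RV P >-> nat}) (phi : {RV P >-> control}) (m : R) : Prop := {
  cbp_mean_gt0 : 0 < m;
  cbp_mean : (\int[P]_t ((xi t)%:R)%:E = m%:E)%E;
  cbp_xi_law : forall n j, same_law P (xis n j) xi;
  cbp_phi_law : forall n, same_law P (phis n) phi;
  cbp_indep : mutually_independent P source_sigma
}.

Definition J (m tau : R) (j : nat) (eps : R) (n : nat) : \bar R :=
  match j with
  | 1%N => ratio_deviation P (popX n.+1) (popN n) m eps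
  | 2%N => ratio_deviation P (popN n) (popX n) tau eps
  | _ => ratio_deviation P (popX n.+1) (popX n) (m * tau) eps
  end.

End process.

Section conditions.
Context (R : realType).

(* l'(1) and l''(1) are the usual left limits at 1. *)
Record AD0 (h : nat -> R -> R) (tau : R) (lL lU dL dU : probability nat R) : Prop := {
  AD0_lower : forall (k : nat) (s : R), 0 <= s <= 1 ->
    pgf dL id s * pgf lL id s ^+ k <= h k s;
  AD0_upper : forall (k : nat) (s : R), 0 <= s <= 1 ->
    h k s <= pgf dU id s * pgf lU id s ^+ k;
  AD0_tau_gt0 : 0 < tau;
  AD0_lL1 : derive1 (pgf lL id) s @[s --> 1^'-] --> tau;
  AD0_lU1 : derive1 (pgf lU id) s @[s --> 1^'-] --> tau;
  AD0_lL2 : cvg (derive1n 2 (pgf lL id) s @[s --> 1^'-]);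
  AD0_lU2 : cvg (derive1n 2 (pgf lU id) s @[s --> 1^'-])
}.

Definition constant_one (r : R -> R) : Prop := forall s : R, 0 <= s <= 1 -> r s = 1.

(* Per-envelope part of (AD-S), for u = l o f and r = d o f. *)
Record AD_S_envelope (F0 u r : R -> R) (q theta : R) : Prop := {
  env_q : 0 <= q < 1;
  env_fixpoint : u q = q;
  env_attracting : 0 < derive1 u q < 1;
  env_theta0 : q = 0 -> theta = r 0 * derive1 u 0;
  env_theta1 : 0 < q -> r q < 1 -> theta = r q;
  env_theta2 : 0 < q -> constant_one r -> theta = derive1 u q;
  env_XlogX : exists mu : probability nat R,
    (forall s : R, 0 <= s <= 1 -> pgf mu id s = u s) /\
    (\sum_(1 <= k <oo) (k%:R * maxr 0 (ln k%:R))%:E * mu [set k] < +oo)%E;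
  env_log : exists eta : probability nat R,
    (forall s : R, 0 <= s <= 1 -> pgf eta id s = r s) /\
    (\int[eta]_k (ln (1 + k%:R))%:E < +oo)%E;
  env_init0 : q = 0 -> exists mu1 : R, 0 < mu1 /\
    (fun s : R => F0 s - mu1 * s) =O_ (0^'+) (fun s : R => s ^+ 2);
  env_init2 : 0 < q -> constant_one r -> 0 < derive1 F0 q
}.

Definition neutral_branch (r : R -> R) (q : R) : Prop := 0 < q /\ constant_one r.

Record AD_S (f F0 : R -> R) (a : R) (lL lU dL dU : probability nat R)
    (qL qU theta : R) : Prop := {
  AD_S_a : 1 < a;
  AD_S_theta : 0 < theta < 1;
  AD_S_L : AD_S_envelope F0 (pgf lL id \o f) (pgf dL id \o f) qL theta;
  AD_S_U : AD_S_envelope F0 (pgf lU id \o f) (pgf dU id \o f) qU theta;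
  AD_S_neutral :
    neutral_branch (pgf dL id \o f) qL \/ neutral_branch (pgf dU id \o f) qU ->
    [/\ neutral_branch (pgf dL id \o f) qL,
        neutral_branch (pgf dU id \o f) qU & qL = qU]
}.

Definition bsc (theta a r : R) (n : nat) : R :=
  if 1 < theta * a `^ r then theta ^+ n
  else if theta * a `^ r == 1 then n%:R * theta ^+ n
  else a `^ (- r * n%:R).

End conditions.

Section exponential.
Context (R : realType) (d : measure_display) (T : measurableType d)
  (P : probability T R) (phi : {RV P >-> control}).

Definition scaled_cumulant (eta : R) (k : nat) : \bar R :=
  ((k%:R^-1)%:E * lne (\int[P]_t (expR (eta * (phi t k)%:R))%:E))%E.

Definition Lambda (eta : R) : \bar R := limn (scaled_cumulant eta).

(* The supremum ranges over all eta at which the limit defining Lambda exists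
   in the extended reals. *)
Definition Lambda_star (x : R) : \bar R :=
  ereal_sup [set ((eta * x)%:E - Lambda eta)%E |
             eta in [set eta | cvgn (scaled_cumulant eta)]].

Record AD_E (xi : {RV P >-> nat}) (tau : R) : Prop := {
  AD_E_mgf : \forall eta \near (0 : R),
    (\int[P]_t (expR (eta * (xi t)%:R))%:E < +oo)%E;
  AD_E_Lambda : exists al be : R, [/\ al < 0, 0 < be &
    forall eta : R, al < eta < be ->
      [/\ cvgn (scaled_cumulant eta), Lambda eta \is a fin_num &
          derivable (fine \o Lambda) eta 1]];
  AD_E_tau : derive1 (fine \o Lambda) 0 = tau;
  AD_E_rate : forall eps : R, 0 < eps ->
    (0 < ereal_inf [set Lambda_star x | x in [set x : R | (eps <= `|x - tau|)%R]])%E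
}.

End exponential.

(* Main.v *)
Require Import Defs.
From mathcomp Require Import all_boot all_order all_algebra.
From mathcomp Require Import finmap.
From mathcomp Require Import all_classical all_reals all_analysis.
From mathcomp Require Import measurable_realfun.
From mathcomp Require Import ring lra zify.

Set Implicit Arguments.
Unset Strict Implicit.
Unset Printing Implicit Defensive.

Import Order.TTheory GRing.Theory Num.Def Num.Theory.
Import numFieldNormedType.Exports.

Local Open Scope classical_set_scope.
Local Open Scope ring_scope.

(* Write F_n for the p.g.f. of X_n and u = l o f, r = d o f for an envelope. Conditioning on
   generation n turns (AD0) into r_L (F_n o u_L) <= F_(n+1) <= r_U (F_n o u_U), so that F_n lies
   between the functions obtained by iterating the two envelopes from F_0. By convexity,
   u^n(s) - q decays like u'(q)^n, hence F_n(s) - B is of exact order theta^n on [0, 1), where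
   B = F_0(q) in the neutral branch and B = 0 otherwise. The X log X and logarithmic conditions
   make the products of the chord slopes of u and of the values of r along a geometric sequence
   1 - c a^(-k) converge, so F_n(1 - c a^(-k)) - B is of order theta^(n-k) uniformly in k <= n.
   Comparing x^(-r) with the sum over k of a^(-kr) (1 - c a^(-k))^x gives the harmonic moments:
   the sum of a^(-kr) theta^(n-k) over k <= n is of the order of bsc. The ratio deviations
   follow by conditioning on the denominator k: its conditional probability is O(k^(-p/2)) by a
   Marcinkiewicz-Zygmund bound, or exponentially small in k by Chernoff's bound, and
   E[b^Y; Y > 0] = O(theta^n) for b < 1. *)

(** * Elementary inequalities *)

Section power_inequalities.
Context {R : realFieldType}.
Implicit Types (s t x y rho : R) (k n : nat).

Lemma expn_remainderS t s k :
  t ^+ k.+1 - s ^+ k.+1 - k.+1%:R * s ^+ k * (t - s) =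
  t * (t ^+ k - s ^+ k - k%:R * s ^+ k.-1 * (t - s))
  + k%:R * s ^+ k.-1 * (t - s) ^+ 2.
Proof. by case: k => [|k] /=; rewrite ?exprS -?natr1; ring. Qed.

Lemma expn_tangent t s k : 0 <= s -> 0 <= t ->
  s ^+ k + k%:R * s ^+ k.-1 * (t - s) <= t ^+ k.
Proof.
move=> s0 t0; rewrite -subr_ge0 opprD addrA.
elim: k => [|k ih]; first by rewrite !expr0 mul0r; lra.
rewrite expn_remainderS addr_ge0//; first by rewrite mulr_ge0.
by rewrite mulr_ge0 ?sqr_ge0// mulr_ge0 ?exprn_ge0 ?ler0n.
Qed.

Lemma sum_expn_le_inv rho n : 0 <= rho < 1 ->
  \sum_(i < n) rho ^+ i <= (1 - rho)^-1.
Proof.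
move=> /andP[r0 r1]; have d : 0 < 1 - rho by rewrite subr_gt0.
rewrite -[leRHS]mul1r ler_pdivlMr// mulrC.
have := subrX1 rho n; have := exprn_ge0 n r0; lra.
Qed.

Lemma mul_expn_le_inv rho k : 0 <= rho < 1 -> k%:R * rho ^+ k.-1 <= (1 - rho)^-1.
Proof.
move=> rr; apply: le_trans (sum_expn_le_inv k rr).
have -> : k%:R * rho ^+ k.-1 = \sum_(i < k) rho ^+ k.-1.
  by rewrite sumr_const card_ord mulr_natl.
case: k => [|k]; first by rewrite !big_ord0.
apply: ler_sum => i _; case/andP: rr => r0 r1.
by apply: ler_wiXn2l => //; [exact: ltW | rewrite -ltnS].
Qed.

Lemma expn_quadratic_remainder rho t s k : 0 <= rho < 1 -> `|s| <= rho -> `|t| <= rho ->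
  `|t ^+ k - s ^+ k - k%:R * s ^+ k.-1 * (t - s)| <= (1 - rho) ^- 2 * (t - s) ^+ 2.
Proof.
move=> rr sr tr; have [r0 r1] := andP rr.
have d : 0 < 1 - rho by rewrite subr_gt0.
elim: k => [|k ih].
  by rewrite !expr0 subrr !mul0r subrr normr0 mulr_ge0 ?sqr_ge0 ?invr_ge0 ?exprn_ge0 ?ltW.
rewrite expn_remainderS (le_trans (ler_normD _ _))// normrM.
have h1 : `|k%:R * s ^+ k.-1 * (t - s) ^+ 2| <= (1 - rho)^-1 * (t - s) ^+ 2.
  rewrite normrM [X in _ * X]ger0_norm ?sqr_ge0//.
  rewrite ler_wpM2r ?sqr_ge0// normrM normr_nat normrX.
  apply: le_trans (mul_expn_le_inv k rr).
  by rewrite ler_wpM2l ?ler0n// lerXn2r ?nnegrE.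
apply: (le_trans (lerD (ler_pM (normr_ge0 _) (normr_ge0 _) tr ih) h1)).
rewrite le_eqVlt; apply/orP; left; apply/eqP.
by field; rewrite lt0r_neq0.
Qed.

Lemma geom_sum_le s k : 0 <= s <= 1 -> \sum_(i < k) s ^+ i <= k%:R.
Proof.
move=> /andP[s0 s1]; rewrite -[k in leRHS]card_ord -sum1_card natr_sum.
by apply: ler_sum => i _; exact: exprn_ile1.
Qed.

Lemma geom_sum_deficit s k : 0 <= s <= 1 ->
  k%:R - \sum_(i < k) s ^+ i <= k%:R * minr 1 (k%:R * (1 - s)).
Proof.
move=> /andP[s0 s1].
have hb i : 1 - s ^+ i <= i%:R * (1 - s).
  by have := expn_tangent i (ler01 : 0 <= 1 :> R) s0; rewrite !expr1n; lra.
rewrite minr_pMr ?ler0n// mulr1 le_min; apply/andP; split.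
  by rewrite lerBlDr lerDl sumr_ge0// => i _; rewrite exprn_ge0.
have {1}-> : k%:R = \sum_(i < k) 1 :> R by rewrite -[k in LHS]card_ord -sum1_card natr_sum.
rewrite -sumrB; apply: (@le_trans _ _ (\sum_(i < k) k%:R * (1 - s))).
  apply: ler_sum => i _; apply: le_trans (hb _) _.
  by rewrite ler_wpM2r ?subr_ge0// ler_nat ltnW.
by rewrite sumr_const card_ord -[leLHS]mulr_natl.
Qed.

End power_inequalities.

Section log_sums.
Context {R : realType}.
Implicit Types (a x y : R) (k n : nat).

Lemma ln_ge_sub1 x : 0 < x -> 1 - x^-1 <= ln x.
Proof.
move=> x0; have : ln (1 + (x^-1 - 1)) <= x^-1 - 1.
  by apply: le_ln1Dx; have : 0 < x^-1 by [rewrite invr_gt0]; lra.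
by rewrite addrC subrK lnV ?posrE//; lra.
Qed.

Lemma min1_le_ln_diff a x : 1 < a -> 0 <= x ->
  (1 - a^-1) / 2 * minr 1 x <= ln (1 + x) - ln (1 + x / a).
Proof.
move=> a1 x0; have a0 : 0 < a by lra.
have ai : 0 < a^-1 < 1 by rewrite invr_gt0 a0 invf_lt1.
have xa0 : 0 <= x / a by rewrite mulr_ge0// ltW//; lra.
have p1 : 0 < 1 + x by lra.
have p2 : 0 < 1 + x / a by lra.
rewrite -ln_div ?posrE//; apply: le_trans (ln_ge_sub1 _); last by rewrite divr_gt0.
rewrite invf_div.
have -> : 1 - (1 + x / a) / (1 + x) = (1 - a^-1) * (x / (1 + x)).
  by field; rewrite !lt0r_neq0.
rewrite -mulrA ler_wpM2l; first lra; first by lra.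
rewrite ler_pdivlMr//; case: (leP 1 x) => h; nra.
Qed.

Lemma sum_min1_le_ln a : 1 < a -> exists2 C, 0 < C & forall x n, 0 <= x ->
  \sum_(i < n) minr 1 (x / a ^+ i) <= C * ln (1 + x).
Proof.
move=> a1; have a0 : 0 < a by lra.
have ai : 0 < a^-1 < 1 by rewrite invr_gt0 a0 invf_lt1.
pose c := (1 - a^-1) / 2; have c0 : 0 < c by rewrite /c; lra.
exists c^-1 => [|x n x0]; first by rewrite invr_gt0.
rewrite -ler_pdivrMl ?invr_gt0// invrK.
suff : c * \sum_(i < n) minr 1 (x / a ^+ i) <= ln (1 + x) - ln (1 + x / a ^+ n).
  by have : 0 <= ln (1 + x / a ^+ n);
    [rewrite ln_ge0// lerDl divr_ge0// exprn_ge0// ltW | lra].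
elim: n => [|n ih]; first by rewrite big_ord0 expr0 divr1; lra.
rewrite big_ord_recr /= mulrDr.
have xn : 0 <= x / a ^+ n by rewrite divr_ge0 ?exprn_ge0// ltW.
have := min1_le_ln_diff a1 xn.
have -> : x / a ^+ n / a = x / a ^+ n.+1 by rewrite exprS invfM mulrA mulrAC.
rewrite -/c; lra.
Qed.

Lemma prod_onem_ge (e : nat -> R) S kap : 0 < kap ->
  (forall i, 0 <= e i) -> (forall i, kap <= 1 - e i) ->
  (forall n, \sum_(i < n) e i <= S) ->
  forall n, expR (- (S / kap)) <= \prod_(i < n) (1 - e i).
Proof.
move=> k0 e0 ek eS n; apply: (@le_trans _ _ (\prod_(i < n) expR (- (e i / kap)))).
  rewrite -expR_sum ler_expR sumrN lerN2// -mulr_suml ler_wpM2r// invr_ge0 ltW//.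
apply: ler_prod => i _; rewrite expR_ge0 /=.
have ep : 0 < 1 - e i by apply: lt_le_trans (ek i).
rewrite -[leRHS]lnK ?posrE// ler_expR.
apply: le_trans (ln_ge_sub1 ep).
have -> : 1 - (1 - e i)^-1 = - (e i / (1 - e i)) by field; rewrite lt0r_neq0.
by rewrite lerN2 ler_wpM2l// lef_pV2 ?posrE.
Qed.

Lemma prod_1D_le (e : nat -> R) S : (forall i, 0 <= e i) ->
  (forall n, \sum_(i < n) e i <= S) -> forall n, \prod_(i < n) (1 + e i) <= expR S.
Proof.
move=> e0 eS n; apply: (@le_trans _ _ (\prod_(i < n) expR (e i))).
  by apply: ler_prod => i _; rewrite expR_ge1Dx andbT addr_ge0.
by rewrite -expR_sum ler_expR.
Qed.

End log_sums.

Section powR_inequalities.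
Context {R : realType}.
Implicit Types (a b p q r x y z T : R) (n k : nat).

Lemma powR_bernoulli p x : 1 <= p -> 0 <= x -> 1 + p * (x - 1) <= x `^ p.
Proof.
rewrite le_eqVlt => /predU1P[<- x0|p1 x0]; first by rewrite powRr1//; lra.
have p0 : 0 < p by lra.
have pi1 : 0 < p^-1 < 1 by rewrite invr_gt0 p0 invf_lt1.
have q0 : 0 < (1 - p^-1)^-1 by rewrite invr_gt0; lra.
have := @conjugate_powR R x 1 p (1 - p^-1)^-1 x0 ler01 p0 q0.
rewrite invrK addrCA subrr addr0 => /(_ erefl).
rewrite powR1 mul1r mulr1 -(ler_pM2l p0) mulrDr mulrCA divff ?lt0r_neq0// mulr1.
rewrite mulrBr mulr1 divff ?lt0r_neq0//; lra.
Qed.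

Lemma powRBn a p n : 0 < a -> a `^ (p - n%:R) = a `^ p / a ^+ n.
Proof.
by move=> a0; rewrite powRB ?lt0r_neq0 ?implybT// powR_mulrn// ltW.
Qed.

Lemma powR_tangent a b p : 1 <= p -> 0 < a -> 0 <= b ->
  a `^ p + p * a `^ (p - 1) * (b - a) <= b `^ p.
Proof.
move=> p1 a0 b0; rewrite (powRBn _ 1)// expr1.
have := @powR_bernoulli p (b / a) p1 (divr_ge0 b0 (ltW a0)).
have ap : 0 < a `^ p by rewrite powR_gt0.
have e : a `^ p * (b / a) `^ p = b `^ p.
  by rewrite -powRM ?divr_ge0 ?(ltW a0)// mulrCA divff ?lt0r_neq0// mulr1.
rewrite -(ler_pM2l ap) e.
apply: le_trans; rewrite le_eqVlt; apply/orP; left; apply/eqP.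
by field; rewrite lt0r_neq0.
Qed.

Let powR_taylor1 p : 2 <= p -> exists2 C, 0 <= C & forall z,
  `|1 + z| `^ p <= 1 + p * z + C * (z ^+ 2 + `|z| `^ p).
Proof.
move=> p2; pose K := (p - 1) * 2 `^ (p - 2).
have K1 : p - 1 <= K.
  rewrite /K ler_peMr//; first lra.
  have h1 : 1 <= 2 :> R by lra.
  have h2 : 0 <= p - 2 by lra.
  by have := ler_powR h1 h2; rewrite powRr0.
have K0 : 0 <= K by lra.
exists (p * K + 2 * p + 3 `^ p) => [|z].
  by rewrite !addr_ge0 ?mulr_ge0 ?powR_ge0//; lra.
have zp := powR_ge0 `|z| p; have z2 := sqr_ge0 z.
have t0 := powR_ge0 (3 : R) p.
have [zh|zh] := leP `|z| (1 / 2).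
  have /andP[z1 z1'] : - (1/2) <= z <= 1 / 2 by rewrite -ler_norml.
  have w0 : 0 < 1 + z by lra.
  rewrite (ger0_norm (ltW w0)).
  have h1 : (1 + z) `^ p <= 1 + p * (1 + z) `^ (p - 1) * z.
    have := @powR_tangent (1 + z) 1 p ltac:(lra) w0 ler01.
    rewrite powR1; lra.
  have h2 : (1 + z) `^ (p - 1) * z <= z + K * z ^+ 2.
    have [z0|z0] := leP 0 z.
      have := @powR_tangent (1 + z) 1 (p - 1) ltac:(lra) w0 ler01.
      rewrite powR1 -addrA -opprD => h.
      have h3 : (1 + z) `^ (p - (1 + 1)) <= 2 `^ (p - 2).
        by apply: ge0_ler_powR; rewrite ?nnegrE; lra.
      have : (p - 1) * (1 + z) `^ (p - (1 + 1)) * z <= K * z.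
        by rewrite ler_wpM2r// ler_wpM2l//; lra.
      rewrite expr2; nra.
    have := @powR_bernoulli (p - 1) (1 + z) ltac:(lra) (ltW w0).
    rewrite expr2; nra.
  have p0 : 0 <= p by lra.
  have := ler_wpM2l p0 h2.
  rewrite mulrA mulrDr => h3.
  have := mulr_ge0 t0 (addr_ge0 z2 zp); have := mulr_ge0 p0 z2.
  have := mulr_ge0 (mulr_ge0 p0 K0) zp; have := mulr_ge0 p0 zp.
  rewrite expr2 in h3 z2 *; lra.
have h3 : `|1 + z| `^ p <= 3 `^ p * `|z| `^ p.
  rewrite -powRM// ge0_ler_powR ?nnegrE//; first lra.
  by have := ler_normD 1 z; rewrite normr1; lra.
have h4 : 0 <= 1 + p * z + 2 * p * z ^+ 2.
  rewrite -real_normK ?num_real//; have zz := ler_norm (- z); rewrite normrN in zz.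
  have p0 : 0 <= p by lra.
  have := ler_wpM2l p0 zz.
  have : 0 <= p * (`|z| * (`|z| - 1 / 2)) by rewrite !mulr_ge0//; lra.
  rewrite expr2; lra.
have p0 : 0 <= p by lra.
have := mulr_ge0 p0 K0 => pK0.
have := mulr_ge0 (mulr_ge0 p0 K0) (addr_ge0 z2 zp); have := mulr_ge0 p0 zp.
have := mulr_ge0 t0 z2.
lra.
Qed.

Lemma powR_taylor p : 2 <= p -> exists2 C, 0 <= C & forall x, exists L, forall y,
  `|x + y| `^ p <= `|x| `^ p + L * y + C * (`|x| `^ (p - 2) * y ^+ 2 + `|y| `^ p).
Proof.
move=> p2; have [C C0 h] := powR_taylor1 p2; exists (C + 1) => [|x]; first lra.
have [->|x0] := eqVneq x 0.
  exists 0 => y; rewrite add0r normr0 powR0 ?lt0r_neq0//; last by lra.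
  have := powR_ge0 `|y| p; have := powR_ge0 (0 : R) (p - 2); have := sqr_ge0 y.
  move=> h1 h2 h3; have := mulr_ge0 C0 (addr_ge0 (mulr_ge0 h2 h1) h3).
  by have := mulr_ge0 h2 h1; lra.
exists (`|x| `^ p * p / x) => y.
have nx : 0 < `|x| by rewrite normr_gt0.
have -> : x + y = x * (1 + y / x) by field.
rewrite normrM powRM//.
have := h (y / x); rewrite -(ler_pM2l (powR_gt0 p nx)).
move=> /le_trans; apply.
have e1 : `|x| `^ p * (y / x) ^+ 2 = `|x| `^ (p - 2) * y ^+ 2.
  by rewrite (powRBn _ 2)// real_normK ?num_real//; field.
have e2 : `|x| `^ p * `|y / x| `^ p = `|y| `^ p.
  by rewrite -powRM// -normrM mulrCA divff// mulr1.
rewrite (_ : _ * (_ + _) = `|x| `^ p + `|x| `^ p * p / x * y +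
  C * (`|x| `^ p * (y / x) ^+ 2 + `|x| `^ p * `|y / x| `^ p)); last by field.
rewrite e1 e2 lerD2l mulrDl mul1r lerDl addr_ge0 ?powR_ge0//.
by rewrite mulr_ge0 ?sqr_ge0 ?powR_ge0.
Qed.

Lemma powR_interpolate p y T : 2 <= p -> 0 <= y -> 0 < T ->
  y `^ (p - 2) <= y `^ p / T + T `^ (p / 2 - 1).
Proof.
move=> p2 y0 T0; have [yT|yT] := leP (y ^+ 2) T.
  have -> : p - 2 = 2 * (p / 2 - 1) by field.
  rewrite powRrM powR_mulrn//.
  apply: le_trans (_ : T `^ (p / 2 - 1) <= _); last by rewrite lerDr divr_ge0 ?powR_ge0 ?ltW.
  by apply: ge0_ler_powR; rewrite ?nnegrE ?sqr_ge0//; lra.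
have yp : 0 < y by rewrite lt_neqAle y0 andbT; apply: contraTneq yT => <-;
  rewrite -leNgt expr0n ltW.
apply: le_trans (_ : y `^ p / T <= _); last by rewrite lerDl powR_ge0.
rewrite (powRBn _ 2)// ler_wpM2l ?powR_ge0// lef_pV2 ?posrE ?exprn_gt0//.
exact: ltW.
Qed.

Lemma moment_growth_step q C K T : 1 <= q -> 0 <= C -> 3 * C <= K -> 1 <= T ->
  (1 + C / T) * T `^ q + C * T `^ (q - 1) + C <= (T + K) `^ q.
Proof.
move=> q1 C0 CK T1; have T0 : 0 < T by lra.
have K0 : 0 <= K by lra.
apply: le_trans (@powR_tangent T (T + K) q q1 T0 _); last by lra.
rewrite (powRBn _ 1)// expr1.
set u := T `^ q; have u0 : 0 < u by rewrite powR_gt0.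
have v1 : 1 <= u / T by rewrite ler_pdivlMr// mul1r le1r_powR.
have -> : (1 + C / T) * u = u + C * (u / T) by field; rewrite lt0r_neq0.
set v := u / T in v1 *; have -> : T + K - T = K by lra.
have v0 : 0 <= v by lra.
have : 3 * C * v <= q * v * K.
  have q0 : 0 <= q - 1 by lra.
  have d0 : 0 <= K - 3 * C by lra.
  by have := mulr_ge0 q0 (mulr_ge0 v0 K0); have := mulr_ge0 v0 d0; lra.
have : C <= C * v by nra.
lra.
Qed.

End powR_inequalities.

(** * Sums over geometric scales *)

Section geometric_scales.
Context {R : realType}.
Implicit Types (a c r x y theta : R) (n k X : nat).

Lemma powRN_exp a r n : 0 <= a -> (a ^+ n) `^ (- r) = (a `^ r) ^- n.
Proof.
by move=> a0; rewrite powRN -powR_mulrn// -powRrM mulrC powRrM powR_mulrn ?powR_ge0.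
Qed.

Lemma expRN_le_onem y : 0 <= y <= 1 -> expR (- y) <= 1 - y / 2.
Proof.
move=> /andP[y0 y1]; rewrite expRN; apply: le_trans (_ : (1 + y)^-1 <= _).
  by rewrite lef_pV2 ?posrE ?expR_gt0// ?expR_ge1Dx//; lra.
rewrite -[leLHS]mul1r ler_pdivrMr; last by lra.
nra.
Qed.

Lemma powRN_le_scale_sum a r n X : 1 < a -> 0 < r -> (0 < X)%N -> X%:R < a ^+ n ->
  X%:R `^ (- r) <=
  expR a * \sum_(k < n) (a `^ r) ^- k * (1 - a ^- k / 2) ^+ X.
Proof.
move=> a1 r0 X0; have a0 : 0 < a by lra.
have X1 : 1 <= X%:R :> R by rewrite ler1n.
have p1 k : 0 < a ^- k <= 1.
  by rewrite invr_gt0 exprn_gt0//= invf_le1 ?exprn_gt0// exprn_ege1// ltW.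
have t0 k : 0 <= (a `^ r) ^- k * (1 - a ^- k / 2) ^+ X.
  by rewrite mulr_ge0 ?invr_ge0 ?exprn_ge0 ?powR_ge0//; have := p1 k; lra.
elim: n => [|n ih]; first by rewrite expr0; lra.
move=> Xn; have [lt|ge] := ltP X%:R (a ^+ n).
  apply: le_trans (ih lt) _; rewrite ler_pM2l ?expR_gt0// big_ord_recr /=.
  by rewrite lerDl.
apply: (@le_trans _ _ (expR a * ((a `^ r) ^- n * (1 - a ^- n / 2) ^+ X))); last first.
  by rewrite ler_pM2l ?expR_gt0// big_ord_recr /= lerDr sumr_ge0.
apply: (@le_trans _ _ ((a `^ r) ^- n)).
  rewrite -powRN_exp ?(ltW a0)// !powRN lef_pV2 ?posrE ?powR_gt0 ?exprn_gt0//; last by lra.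
  by apply: ge0_ler_powR; rewrite ?nnegrE ?exprn_ge0 ?(ltW a0)//; lra.
rewrite mulrCA ler_peMr ?invr_ge0 ?exprn_ge0 ?powR_ge0//.
apply: le_trans (_ : expR a * expR (- a ^- n) ^+ X <= _); last first.
  rewrite ler_pM2l ?expR_gt0// lerXn2r ?nnegrE ?expR_ge0//.
  - by have := p1 n; lra.
  - by apply: expRN_le_onem; have := p1 n; lra.
rewrite -expRM_natr -expRD -[leLHS]expR0 ler_expR mulNr subr_ge0.
rewrite mulrC ler_pdivrMr ?exprn_gt0// -exprS ltW//.
Qed.

Lemma powR_expRN_bounded c r : 0 < c -> 0 <= r -> exists2 K, 0 < K &
  forall y, 0 <= y -> y `^ r * expR (- (c * y)) <= K.
Proof.
move=> c0 r0; pose N := (Num.truncn r).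
have rN : r <= N.+1%:R by rewrite ltW// truncnS_gt.
have f0 : 0 < (N.+1)`!%:R :> R by rewrite ltr0n fact_gt0.
exists (1 + (N.+1)`!%:R / c ^+ N.+1) => [|y y0].
  by rewrite addr_gt0// divr_gt0// exprn_gt0.
have K0 : 0 <= (N.+1)`!%:R / c ^+ N.+1 by rewrite divr_ge0 ?exprn_ge0 ?ltW.
have [y1|y1] := leP y 1.
  have : y `^ r <= 1 `^ r by rewrite ge0_ler_powR ?nnegrE//; lra.
  rewrite powR1.
  have : expR (- (c * y)) <= 1 by rewrite expR_le1 oppr_le0 mulr_ge0// ltW.
  have := powR_ge0 y r; have := expR_ge0 (- (c * y)); nra.
have h : y `^ r <= y ^+ N.+1.
  by rewrite -powR_mulrn//; apply: ler_powR => //; exact: ltW.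
apply: le_trans (_ : y ^+ N.+1 * expR (- (c * y)) <= _).
  by rewrite ler_wpM2r ?expR_ge0.
apply: le_trans (_ : (N.+1)`!%:R / c ^+ N.+1 <= _); last by lra.
rewrite expRN ler_pdivrMr ?expR_gt0// mulrAC ler_pdivlMr ?exprn_gt0//.
rewrite -ler_pdivrMl// mulrC -exprMn [y * c]mulrC.
have := @expR_ge1Dxn _ (c * y) N (mulr_ge0 (ltW c0) y0); lra.
Qed.

(* The sum telescopes against [z / (1 + z)] with [z = (X / a ^ k) ^ r]. *)
Lemma scale_sum_le_powRN a r c : 1 < a -> 0 < r -> 0 < c <= 1 ->
  exists2 C, 0 < C & forall n X, (0 < X)%N ->
  \sum_(k < n) (a `^ r) ^- k * (1 - c * a ^- k) ^+ X <= C * X%:R `^ (- r).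
Proof.
move=> a1 r0 /andP[c0 c1]; have a0 : 0 < a by lra.
set b := a `^ r; have b1 : 1 < b.
  by rewrite /b; have : 1 `^ r < a `^ r; [apply: gt0_ltr_powR; rewrite ?nnegrE//; lra |
    rewrite powR1].
have [K K0 hK] := @powR_expRN_bounded c (r * 2) c0 ltac:(lra).
pose C := (K + 1) * (2 * b + 1) / (b - 1).
have C0 : 0 < C by rewrite divr_gt0 ?mulr_gt0//; lra.
pose psi z : R := z / (1 + z).
have step y : 0 <= y -> y `^ r * expR (- (c * y)) <= C * (psi (y `^ r) - psi (y `^ r / b)).
  move=> y0; have z0 := powR_ge0 y r; have := hK _ y0; rewrite powRrM powR_mulrn//.
  set z := y `^ r in z0 *; set e := expR _ => he.
  have e1 : e <= 1 by rewrite /e expR_le1 oppr_le0 mulr_ge0// ltW.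
  have e0 : 0 <= e by exact: expR_ge0.
  have zb : psi z - psi (z / b) = z * (b - 1) / ((1 + z) * (b + z)).
    by rewrite /psi; field; rewrite !lt0r_neq0//; lra.
  rewrite zb /C ![_ * (_ / _)]mulrA ler_pdivlMr; last by rewrite mulr_gt0; lra.
  have -> : (K + 1) * (2 * b + 1) / (b - 1) * (z * (b - 1)) = (K + 1) * (2 * b + 1) * z.
    by field; rewrite lt0r_neq0//; lra.
  rewrite -[leLHS]mulrA [leRHS]mulrC; apply: ler_wpM2l => //.
  have zz : (1 + z) * (b + z) <= (2 * b + 1) * (z ^+ 2 + 1).
    have := sqr_ge0 (z - 1); have := mulr_ge0 z0 z0; rewrite !expr2; nra.
  apply: le_trans (ler_wpM2l e0 zz) _.
  rewrite mulrCA [leRHS]mulrC ler_wpM2l//; first lra.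
  by rewrite mulrDr mulrC; lra.
exists C => // n X X0; have X1 : 0 < X%:R :> R by rewrite ltr0n.
have p1 k : 0 < a ^- k <= 1.
  by rewrite invr_gt0 exprn_gt0//= invf_le1 ?exprn_gt0// exprn_ege1// ltW.
have powk k : (X%:R / a ^+ k) `^ r = X%:R `^ r / b ^+ k.
  by rewrite powRM ?invr_ge0 ?exprn_ge0 ?(ltW X1) ?(ltW a0)// -powR_inv1 ?exprn_ge0 ?(ltW a0)//
    -powRrM mulN1r powRN_exp ?(ltW a0).
rewrite powRN ler_pdivlMr ?powR_gt0//.
apply: (@le_trans _ _ (C * (psi (X%:R `^ r) - psi (X%:R `^ r / b ^+ n)))); last first.
  have z0 : 0 <= X%:R `^ r / b ^+ n by rewrite divr_ge0 ?powR_ge0 ?exprn_ge0//; lra.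
  have : 0 <= psi (X%:R `^ r / b ^+ n) by rewrite /psi divr_ge0//; lra.
  have : psi (X%:R `^ r) <= 1.
    by rewrite /psi ler_pdivrMr; have := powR_ge0 (X%:R : R) r; lra.
  by move=> h1 h2; rewrite ger_pMr//; lra.
elim: n => [|n ih]; first by rewrite big_ord0 mul0r expr0 divr1 subrr mulr0.
rewrite big_ord_recr /= mulrDl.
have := step (X%:R / a ^+ n); rewrite divr_ge0 ?ler0n ?exprn_ge0 ?(ltW a0)// => /(_ erefl).
rewrite powk => hs.
have : b ^- n * (1 - c * a ^- n) ^+ X * X%:R `^ r <=
   X%:R `^ r / b ^+ n * expR (- (c * (X%:R / a ^+ n))).
  rewrite mulrAC mulrC [b ^- n * _]mulrC [leRHS]mulrC.
  have w0 : 0 <= X%:R `^ r / b ^+ n.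
    by rewrite divr_ge0 ?powR_ge0// exprn_ge0// ltW// (lt_trans _ b1).
  apply: ler_wpM2r => //.
  have -> : - (c * (X%:R / a ^+ n)) = - (c * a ^- n) * X%:R by ring.
  rewrite expRM_natr lerXn2r ?nnegrE ?expR_ge0//.
    by have /andP[h1 h2] := p1 n; have := ler_pM (ltW c0) (ltW h1) c1 h2; lra.
  by have := expR_ge1Dx (- (c * a ^- n)).
have -> : X%:R `^ r / b ^+ n.+1 = X%:R `^ r / b ^+ n / b.
  by rewrite exprS invfM mulrA mulrAC.
lra.
Qed.

End geometric_scales.

Section rate.
Context {R : realType}.
Implicit Types (a b r theta be : R) (n k : nat).

Lemma scaleE b theta k n : 0 < b -> 0 < theta -> (k <= n)%N ->
  b ^- k * theta ^+ (n - k) = theta ^+ n * (theta * b) ^- k.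
Proof.
move=> b0 t0 kn; rewrite exprMn -{2}(subnK kn) exprD.
by field; rewrite !expf_neq0 ?lt0r_neq0.
Qed.

Lemma bscE theta a r n : 0 <= a ->
  bsc theta a r n = if 1 < theta * a `^ r then theta ^+ n
    else if theta * a `^ r == 1 then n%:R * theta ^+ n else (a `^ r) ^- n.
Proof. by move=> a0; rewrite /bsc [- r * _]mulrC powRrM powR_mulrn// powRN_exp. Qed.

Lemma bsc_gt0 theta a r n : 0 < a -> 0 < theta -> (0 < n)%N -> 0 < bsc theta a r n.
Proof.
move=> a0 t0 n0; rewrite bscE ?ltW//.
case: ifP => _; first by rewrite exprn_gt0.
by case: ifP => _; rewrite ?mulr_gt0 ?ltr0n ?exprn_gt0// invr_gt0 exprn_gt0// powR_gt0.
Qed.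

Lemma scale_sum_le_bsc theta a r : 0 < a -> 0 < theta ->
  exists2 C, 0 < C & forall n, (0 < n)%N ->
  (a `^ r) ^- n + \sum_(k < n) (a `^ r) ^- k * theta ^+ (n - k) <= C * bsc theta a r n.
Proof.
move=> a0 t0; set b := a `^ r; have b0 : 0 < b by rewrite powR_gt0.
pose be := theta * b; have be0 : 0 < be by rewrite mulr_gt0.
have sE n : \sum_(k < n) b ^- k * theta ^+ (n - k) = theta ^+ n * \sum_(k < n) be^-1 ^+ k.
  by rewrite mulr_sumr; apply: eq_bigr => k _; rewrite scaleE// 1?ltnW// exprVn.
have bE n : b ^- n = theta ^+ n * be^-1 ^+ n.
  by rewrite exprVn exprMn; field; rewrite !expf_neq0 ?lt0r_neq0.
have [be1|be1|be1] := ltgtP 1 be.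
- have i1 : 0 <= be^-1 < 1 by rewrite invr_ge0 ltW//= invf_lt1.
  exists (1 + (1 - be^-1)^-1) => [|n n0].
    by rewrite addr_gt0// invr_gt0 subr_gt0; lra.
  rewrite sE bE bscE ?(ltW a0)// -/b -/be be1 -mulrDr mulrC ler_wpM2r ?exprn_ge0 ?(ltW t0)//.
  rewrite lerD ?sum_expn_le_inv// exprn_ile1//; lra.
- have d0 : 0 < be^-1 - 1 by rewrite subr_gt0 invf_gt1.
  exists (1 + (be^-1 - 1)^-1) => [|n n0]; first by rewrite addr_gt0// invr_gt0.
  rewrite bscE ?(ltW a0)// -/b -/be (lt_gtF be1) (lt_eqF be1) sE mulrDl mul1r lerD2l.
  rewrite bE mulrCA ler_wpM2l ?exprn_ge0 ?(ltW t0)//.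
  by rewrite mulrC ler_pdivlMr// mulrC -subrX1 gerBl.
- exists 2 => // n n0; rewrite bscE ?(ltW a0)// -/b -/be -be1 ltxx eqxx sE bE -be1 invr1.
  rewrite expr1n mulr1; under eq_bigr do rewrite expr1n.
  rewrite sumr_const card_ord; have : theta ^+ n <= n%:R * theta ^+ n.
    by rewrite ler_peMl ?exprn_ge0 ?(ltW t0)// ler1n.
  by rewrite [n%:R * _]mulrC; lra.
Qed.

Lemma bsc_le_scale_sum theta a r k0 : 0 < a -> 0 < theta ->
  exists2 c, 0 < c & forall n, (k0.*2 < n)%N ->
  c * bsc theta a r n <= \sum_(k < n.+1 | (k0 <= k)%N) (a `^ r) ^- k * theta ^+ (n - k).
Proof.
move=> a0 t0; set b := a `^ r; have b0 : 0 < b by rewrite powR_gt0.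
pose be := theta * b; have be0 : 0 < be by rewrite mulr_gt0.
have s0 n (k : 'I_n.+1) : 0 <= b ^- k * theta ^+ (n - k).
  by rewrite mulr_ge0 ?invr_ge0 ?exprn_ge0 ?ltW.
have [be1|be1|be1] := ltgtP 1 be.
- exists (be ^- k0) => [|n kn]; first by rewrite invr_gt0 exprn_gt0.
  have kn' : (k0 < n.+1)%N by lia.
  rewrite (bigD1 (Ordinal kn'))//= scaleE//.
  rewrite bscE ?(ltW a0)// -/b -/be be1 mulrC lerDl sumr_ge0//.
- exists 1 => // n kn; rewrite mul1r bscE ?(ltW a0)// -/b -/be (lt_gtF be1) (lt_eqF be1).
  rewrite (bigD1 ord_max)/=; last by lia.
  by rewrite subnn expr0 mulr1 lerDl sumr_ge0.
- exists (1/2) => [|n kn]; first by lra.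
  rewrite bscE ?(ltW a0)// -/b -/be -be1 ltxx eqxx.
  rewrite (eq_bigr (fun=> theta ^+ n)); last first.
    by move=> k _; rewrite scaleE//; [rewrite -/be -be1 expr1n invr1 mulr1 | rewrite -ltnS].
  rewrite -(big_geq_mkord k0 n.+1 xpredT (fun=> theta ^+ n)) sumr_const_nat -[leRHS]mulr_natl mulrA.
  rewrite ler_wpM2r ?exprn_ge0 ?(ltW t0)//.
  have : n%:R <= 2 * (n.+1 - k0)%:R :> R by rewrite -natrM ler_nat; lia.
  by lra.
Qed.

End rate.

(** * Generating functions *)

Lemma is_derive1_quadratic {R : realType} (f : R -> R) (x D C e : R) : 0 < e ->
  (forall t, `|t - x| < e -> `|f t - f x - D * (t - x)| <= C * (t - x) ^+ 2) ->
  is_derive x 1 f D.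
Proof.
move=> e0 h; apply/is_derive1_caratheodory.
pose g z := if z == x then D else (f z - f x) / (z - x).
exists g; split; last by rewrite /g eqxx.
  move=> z; rewrite /g; case: eqVneq => [->|zx]; first by rewrite !subrr mulr0.
  by rewrite mulfVK// subr_eq0.
have C0 : 0 <= C.
  have := h (x + e / 2); rewrite addrAC subrr add0r ger0_norm; last by lra.
  have -> : e / 2 < e by lra.
  move=> /(_ isT)/(le_trans (normr_ge0 _)); rewrite pmulr_lge0//.
  by rewrite exprn_gt0//; lra.
apply/cvgrPdist_lt => eps eps0; near=> z.
have zx : `|z - x| < e by near: z; apply: cvgr_distC_lt.
rewrite /g eqxx; case: eqVneq => [_|zx0]; first by rewrite subrr normr0.
have d0 : z - x != 0 by rewrite subr_eq0.
have -> : D - (f z - f x) / (z - x) = - ((f z - f x - D * (z - x)) / (z - x)) by field.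
rewrite normrN normrM normfV ltr_pdivrMr ?normr_gt0//.
apply: le_lt_trans (h _ zx) _.
rewrite -real_normK ?num_real// expr2 mulrA ltr_pM2r ?normr_gt0//.
have : `|z - x| < eps / (C + 1).
  by near: z; apply: cvgr_distC_lt => //; rewrite divr_gt0//; lra.
rewrite ltr_pdivlMr; last by lra.
by have := normr_ge0 (z - x); lra.
Unshelve. all: by end_near. Qed.

Section nat_expectation.
Context {R : realType} {d : measure_display} {T : measurableType d}
  (P : probability T R).
Variable Y : T -> nat.
Hypothesis mY : measurable_fun setT Y.

Definition nexp (g : nat -> R) : R := Rintegral P setT (fun t => g (Y t)).
Definition nbounded (g : nat -> R) := exists C, forall k, `|g k| <= C.

Lemma measurable_nat_comp (g : nat -> \bar R) : measurable_fun setT (fun t => g (Y t)).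
Proof. exact: (@measurableT_comp _ _ _ _ _ _ g). Qed.

Lemma nbounded_integrable g : nbounded g -> P.-integrable setT (EFin \o (fun t => g (Y t))).
Proof.
move=> [C gC]; apply: (le_integrable measurableT (g := EFin \o cst C)) => /=.
- exact: (measurable_nat_comp (fun k => (g k)%:E)).
- by move=> t _; rewrite lee_fin; apply: le_trans (gC _) (ler_norm _).
- exact: finite_measure_integrable_cst.
Qed.

Lemma EFin_nexp g : nbounded g -> (nexp g)%:E = (\int[P]_t (g (Y t))%:E)%E.
Proof.
move=> bg; rewrite /nexp /Rintegral fineK//.
by apply: integrable_fin_num => //; exact: nbounded_integrable.
Qed.

Lemma nexp_le g h : nbounded g -> nbounded h -> (forall k, g k <= h k) -> nexp g <= nexp h.
Proof. by move=> bg bh gh; apply: le_Rintegral => //; apply: nbounded_integrable. Qed.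

Lemma nexp_cst c : nexp (fun=> c) = c.
Proof. by rewrite /nexp Rintegral_cst//= probability_setT mulr1. Qed.

Lemma nexpD g h : nbounded g -> nbounded h ->
  nexp (fun k => g k + h k) = nexp g + nexp h.
Proof. by move=> bg bh; apply: RintegralD => //; apply: nbounded_integrable. Qed.

Lemma nexpB g h : nbounded g -> nbounded h ->
  nexp (fun k => g k - h k) = nexp g - nexp h.
Proof. by move=> bg bh; apply: RintegralB => //; apply: nbounded_integrable. Qed.

Lemma nexpZ c g : nbounded g -> nexp (fun k => c * g k) = c * nexp g.
Proof. by move=> bg; apply: RintegralZl => //; apply: nbounded_integrable. Qed.

Lemma nexp_ge0 g : (forall k, 0 <= g k) -> 0 <= nexp g.
Proof. by move=> g0; apply: fine_ge0; apply: integral_ge0 => t _; rewrite lee_fin. Qed.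

Lemma nboundedD g h : nbounded g -> nbounded h -> nbounded (fun k => g k + h k).
Proof.
move=> [C gC] [D hD]; exists (C + D) => k.
by apply: le_trans (ler_normD _ _) _; rewrite lerD.
Qed.

Lemma nboundedZ c g : nbounded g -> nbounded (fun k => c * g k).
Proof. by move=> [C gC]; exists (`|c| * C) => k; rewrite normrM ler_wpM2l. Qed.

Lemma nboundedB g h : nbounded g -> nbounded h -> nbounded (fun k => g k - h k).
Proof.
move=> [C gC] [D hD]; exists (C + D) => k.
by apply: le_trans (ler_normB _ _) _; rewrite lerD.
Qed.

Lemma nbounded_cst c : nbounded (fun=> c).
Proof. by exists `|c|. Qed.

Lemma nbounded_exp s : `|s| <= 1 -> nbounded (fun k => s ^+ k).
Proof. by move=> s1; exists 1 => k; rewrite normrX exprn_ile1. Qed.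

Lemma nbounded_dexp s : `|s| < 1 -> nbounded (fun k => k%:R * s ^+ k.-1).
Proof.
move=> s1; exists (1 - `|s|)^-1 => k; rewrite normrM normr_nat normrX.
by apply: mul_expn_le_inv; rewrite normr_ge0.
Qed.

Lemma nbounded_geom s : 0 <= s < 1 -> nbounded (fun k => \sum_(i < k) s ^+ i).
Proof.
move=> s1; exists (1 - s)^-1 => k; rewrite ger0_norm ?sum_expn_le_inv//.
by apply: sumr_ge0 => i _; rewrite exprn_ge0//; case/andP: s1.
Qed.

Lemma nexp_norm_le g h : nbounded g -> nbounded h -> (forall k, `|g k| <= h k) ->
  `|nexp g| <= nexp h.
Proof.
move=> bg bh gh; rewrite ler_norml; apply/andP; split.
  rewrite -mulN1r -nexpZ//; apply: nexp_le => //; first exact: nboundedZ.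
  by move=> k; rewrite mulN1r lerNl; apply: le_trans (gh k); rewrite -normrN ler_norm.
by apply: nexp_le => // k; apply: le_trans (gh k); exact: ler_norm.
Qed.

Lemma mean_le_of_approx (g : nat -> nat -> R) (M : R) :
  (forall n, nbounded (g n)) -> (forall n k, 0 <= g n k) ->
  (forall k, {homo g^~ k : n n' / (n <= n')%N >-> n <= n'}) ->
  (forall k, g n k @[n --> \oo] --> (k%:R : R)) ->
  (forall n, nexp (g n) <= M) -> (\int[P]_t (Y t)%:R%:E <= M%:E)%E.
Proof.
move=> bg g0 gnd gk gM.
have h : (\int[P]_t (g n (Y t))%:E)%E @[n --> \oo] -->
    (\int[P]_t limn (fun n => (g n (Y t))%:E))%E.
  apply: (@cvg_monotone_convergence _ _ _ P setT measurableT
    (fun n t => (g n (Y t))%:E)).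
  - by move=> n; exact: (measurable_nat_comp (fun k => (g n k)%:E)).
  - by move=> n t _; rewrite lee_fin.
  - by move=> t _ n n' nn; rewrite lee_fin; exact: gnd.
rewrite (eq_integral (fun t => limn (fun n => (g n (Y t))%:E))); last first.
  move=> t _; apply/esym/cvg_lim => //; apply: cvg_EFin; last exact: gk.
  by apply: nearW.
rewrite -(cvg_lim _ h)//; apply: lime_le; first by apply/cvg_ex; eexists; exact: h.
by apply: nearW => n /=; rewrite -EFin_nexp// lee_fin.
Qed.

End nat_expectation.

Section generating_function.
Context {R : realType} {d : measure_display} {T : measurableType d}
  (P : probability T R) (Y : T -> nat).
Hypothesis mY : measurable_fun setT Y.
Implicit Types s t rho M c : R.

Local Notation phi := (pgf P Y).

Definition dpgf s : R := nexp P Y (fun k => k%:R * s ^+ k.-1).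

(* The slope [(1 - phi s) / (1 - s)] of the chord to [1], see [pgf_chord]. *)
Definition gpgf s : R := nexp P Y (fun k => \sum_(i < k) s ^+ i).

Let bexp s : 0 <= s <= 1 -> nbounded (fun k => s ^+ k).
Proof. by move=> /andP[s0 s1]; apply: nbounded_exp; rewrite ger0_norm. Qed.

Lemma pgf_ge0 s : 0 <= s -> 0 <= phi s.
Proof. by move=> s0; apply: nexp_ge0 => k; rewrite exprn_ge0. Qed.

Lemma pgf1 : phi 1 = 1.
Proof.
rewrite /pgf -[RHS](nexp_cst P Y); congr Rintegral; apply/funext => t; exact: expr1n.
Qed.

Lemma pgf_homo s t : 0 <= s -> s <= t -> t <= 1 -> phi s <= phi t.
Proof.
move=> s0 st t1; have t0 := le_trans s0 st; apply: nexp_le => //.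
- by apply: bexp; rewrite s0 (le_trans st).
- by apply: bexp; rewrite t0.
- by move=> k; rewrite lerXn2r.
Qed.

Lemma pgf_le1 s : 0 <= s <= 1 -> phi s <= 1.
Proof. by move=> /andP[s0 s1]; rewrite -[leRHS]pgf1 pgf_homo. Qed.

Lemma pgf_chord s : 0 <= s < 1 -> 1 - phi s = (1 - s) * gpgf s.
Proof.
move=> /andP[s0 s1]; rewrite /gpgf -nexpZ//; last by apply: nbounded_geom; rewrite s0.
rewrite -[X in X - _](nexp_cst P Y) -nexpB//; last by apply: bexp; rewrite s0 ltW.
  congr Rintegral; apply/funext => t.
  by have := subrX1 s (Y t); lra.
exact: nbounded_cst.
Qed.

Lemma gpgf_ge0 s : 0 <= s -> 0 <= gpgf s.
Proof. by move=> s0; apply: nexp_ge0 => k; apply: sumr_ge0 => i _; rewrite exprn_ge0. Qed.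

Lemma gpgf_homo s t : 0 <= s -> s <= t -> t < 1 -> gpgf s <= gpgf t.
Proof.
move=> s0 st t1; have t0 := le_trans s0 st; apply: nexp_le => //.
- by apply: nbounded_geom; rewrite s0 (le_lt_trans st).
- by apply: nbounded_geom; rewrite t0.
- by move=> k; apply: ler_sum => i _; rewrite lerXn2r.
Qed.

Lemma dpgf_ge0 s : 0 <= s -> 0 <= dpgf s.
Proof. by move=> s0; apply: nexp_ge0 => k; rewrite mulr_ge0 ?exprn_ge0. Qed.

Lemma dpgf_homo s t : 0 <= s -> s <= t -> t < 1 -> dpgf s <= dpgf t.
Proof.
move=> s0 st t1; have t0 := le_trans s0 st; apply: nexp_le => //.
- by apply: nbounded_dexp; rewrite ger0_norm// (le_lt_trans st).
- by apply: nbounded_dexp; rewrite ger0_norm.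
- by move=> k; rewrite ler_wpM2l// lerXn2r.
Qed.

Lemma dpgf_le_gpgf s : 0 <= s < 1 -> dpgf s <= gpgf s.
Proof.
move=> /andP[s0 s1]; apply: nexp_le => //.
- by apply: nbounded_dexp; rewrite ger0_norm.
- by apply: nbounded_geom; rewrite s0.
- move=> [|k]; first by rewrite big_ord0 mul0r.
  have -> : k.+1%:R * s ^+ k = \sum_(i < k.+1) s ^+ k.
    by rewrite sumr_const card_ord [LHS]mulr_natl.
  apply: ler_sum => i _; apply: ler_wiXn2l => //; first exact: ltW.
  by rewrite -ltnS.
Qed.

Lemma pgf_tangent s t : 0 <= s < 1 -> 0 <= t <= 1 -> phi s + dpgf s * (t - s) <= phi t.
Proof.
move=> /andP[s0 s1] t01; have [t0 t1] := andP t01.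
have bs : nbounded (fun k => s ^+ k) by apply: bexp; rewrite s0 ltW.
have bd : nbounded (fun k => (t - s) * (k%:R * s ^+ k.-1)).
  by apply: nboundedZ; apply: nbounded_dexp; rewrite ger0_norm.
rewrite mulrC /dpgf -nexpZ//; last by apply: nbounded_dexp; rewrite ger0_norm.
rewrite -[phi s]/(nexp P Y _) -nexpD//; apply: nexp_le => //.
- exact: nboundedD.
- exact: bexp.
- by move=> k; rewrite mulrC expn_tangent.
Qed.

Lemma pgf_quadratic rho s t : 0 <= rho < 1 -> `|s| <= rho -> `|t| <= rho ->
  `|phi t - phi s - dpgf s * (t - s)| <= (1 - rho) ^- 2 * (t - s) ^+ 2.
Proof.
move=> rr sr tr; have [r0 r1] := andP rr.
have bs : nbounded (fun k => s ^+ k).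
  by apply: nbounded_exp; rewrite (le_trans sr)// ltW.
have bt : nbounded (fun k => t ^+ k).
  by apply: nbounded_exp; rewrite (le_trans tr)// ltW.
have bd : nbounded (fun k => k%:R * s ^+ k.-1).
  by apply: nbounded_dexp; rewrite (le_lt_trans sr).
rewrite mulrC /dpgf -nexpZ// -[phi s]/(nexp P Y _) -[phi t]/(nexp P Y _) -!nexpB//; last 2 first.
- exact: nboundedB.
- exact: nboundedZ.
rewrite -[leRHS](nexp_cst P Y); apply: nexp_norm_le => //.
- by apply: nboundedB; [exact: nboundedB | exact: nboundedZ].
- exact: nbounded_cst.
- by move=> k; rewrite [(t - s) * _]mulrC; apply: expn_quadratic_remainder.
Qed.

Lemma is_derive_pgf s : `|s| < 1 -> is_derive s 1 phi (dpgf s).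
Proof.
move=> s1; pose rho := (1 + `|s|) / 2; have n0 := normr_ge0 s.
have rr : 0 <= rho < 1 by rewrite /rho; lra.
apply: (@is_derive1_quadratic _ _ _ _ ((1 - rho) ^- 2) (rho - `|s|)).
  by rewrite /rho; lra.
move=> t ts; apply: pgf_quadratic => //; first by rewrite /rho; lra.
have -> : t = (t - s) + s by ring.
by apply: le_trans (ler_normD _ _) _; lra.
Qed.

Lemma derive1_pgf s : `|s| < 1 -> derive1 phi s = dpgf s.
Proof. by move=> /is_derive_pgf h; rewrite derive1E; exact: derive_val. Qed.

Lemma gpgf_le_mean M s : (\int[P]_t (Y t)%:R%:E <= M%:E)%E -> 0 <= s < 1 -> gpgf s <= M.
Proof.
move=> hM s1; rewrite -lee_fin; apply: le_trans hM.
rewrite EFin_nexp//; last exact: nbounded_geom.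
apply: ge0_le_integral => //.
- by move=> t _; rewrite lee_fin; apply: sumr_ge0 => i _; case/andP: s1 => s0 _; rewrite exprn_ge0.
- exact: (measurable_nat_comp mY (fun k => (\sum_(i < k) s ^+ i)%:E)).
- exact: (measurable_nat_comp mY (fun k => (k%:R)%:E)).
- move=> t _; rewrite lee_fin; apply: geom_sum_le; case/andP: s1 => -> /ltW; exact.
Qed.

Lemma mean_le_dpgf M : (forall s, 0 <= s < 1 -> dpgf s <= M) ->
  (\int[P]_t (Y t)%:R%:E <= M%:E)%E.
Proof.
move=> hM; pose s n : R := 1 - harmonic n.
have s01 n : 0 <= s n < 1.
  have h0 : 0 < (harmonic n : R) by rewrite /= invr_gt0.
  have h1 : (harmonic n : R) <= 1 by rewrite /= invf_le1// ler1n.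
  by rewrite /s; lra.
have snd n n' : (n <= n')%N -> s n <= s n'.
  by move=> nn; rewrite /s lerD2l lerN2 /= lef_pV2 ?posrE// ler_nat.
have s1 : s n @[n --> \oo] --> (1 : R).
  by rewrite -[X in _ --> X]subr0; apply: cvgB; [exact: cvg_cst | exact: cvg_harmonic].
apply: (@mean_le_of_approx _ _ _ P Y mY (fun n k => k%:R * s n ^+ k.-1)).
- by move=> n; apply: nbounded_dexp; have /andP[s0 ?] := s01 n; rewrite ger0_norm.
- by move=> n k; rewrite mulr_ge0// exprn_ge0//; case/andP: (s01 n).
- move=> k n n' nn; rewrite ler_wpM2l// lerXn2r ?nnegrE//; last exact: snd.
    by case/andP: (s01 n).
  by case/andP: (s01 n').
- move=> k; rewrite -[X in _ --> X]mulr1; apply: cvgM; first exact: cvg_cst.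
  rewrite -[X in _ --> X](expr1n R k.-1).
  apply: (@cvg_comp _ _ _ s (fun x : R => x ^+ k.-1) _ (nbhs (1 : R))) => //.
  exact: exprn_continuous.
- by move=> n; exact: hM.
Qed.

Lemma mean_le_gpgf M : (forall s, 0 <= s < 1 -> gpgf s <= M) ->
  (\int[P]_t (Y t)%:R%:E <= M%:E)%E.
Proof.
move=> hM; apply: mean_le_dpgf => s s1; exact: le_trans (dpgf_le_gpgf s1) (hM _ s1).
Qed.

Lemma gpgf_near_mean m e : (\int[P]_t (Y t)%:R%:E = m%:E)%E -> 0 < e ->
  exists2 s0, 0 <= s0 < 1 & forall s, s0 <= s -> s < 1 -> m - e <= gpgf s.
Proof.
move=> hm e0; have [//|h] := pselect (exists2 s0, 0 <= s0 < 1 & m - e < gpgf s0).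
  move=> [s0 /andP[s00 s01] hs]; exists s0; first by rewrite s00.
  by move=> s ss s1; apply: le_trans (ltW hs) _; exact: gpgf_homo.
have : (\int[P]_t (Y t)%:R%:E <= (m - e)%:E)%E.
  by apply: mean_le_gpgf => s s1; rewrite leNgt; apply/negP => hs; apply: h; exists s.
by rewrite hm lee_fin; lra.
Qed.

Lemma pgf_constant1 s : 0 <= s < 1 -> phi s = 1 -> forall t, 0 <= t <= 1 -> phi t = 1.
Proof.
move=> /andP[s0 s1] ps t /andP[t0 t1]; apply/eqP; rewrite eq_le pgf_le1 ?t0//=.
apply: (@le_trans _ _ (phi 0)); last by rewrite pgf_homo.
have g0 : gpgf s = 0.
  have := pgf_chord (_ : 0 <= s < 1); rewrite ps subrr s0 s1 => /(_ isT)/esym/eqP.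
  by rewrite mulf_eq0 subr_eq0 gt_eqF//= => /eqP.
have h01 : 0 <= (0 : R) < 1 by rewrite lexx ltr01.
by have := gpgf_homo (lexx 0) s0 s1; have := pgf_chord h01; rewrite g0; lra.
Qed.

Lemma pgf_lt1 m s : (\int[P]_t (Y t)%:R%:E = m%:E)%E -> 0 < m -> 0 <= s < 1 -> phi s < 1.
Proof.
move=> hm m0 s01; have /andP[s0 s1] := s01.
rewrite lt_neqAle pgf_le1 ?s0 ?ltW// andbT; apply/eqP => ps.
have : (\int[P]_t (Y t)%:R%:E <= 0%:E)%E.
  apply: mean_le_gpgf => t t01; have /andP[t0 t1] := t01; have := pgf_chord t01.
  have t01' : 0 <= t <= 1 by rewrite t0 ltW.
  rewrite (pgf_constant1 s01 ps t01') subrr => /esym/eqP.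
  by rewrite mulf_eq0 subr_eq0 gt_eqF//= => /eqP->.
by rewrite hm lee_fin leNgt m0.
Qed.

Lemma pgf_gt0 s : 0 < s <= 1 -> 0 < phi s.
Proof.
move=> /andP[s0 s1]; rewrite lt_neqAle pgf_ge0 ?ltW// andbT; apply/eqP => /esym p0.
have : (\int[P]_t `|(s ^+ Y t)%:E| = 0)%E.
  have := EFin_nexp P mY (bexp (_ : 0 <= s <= 1)).
  rewrite -[nexp _ _ _]/(phi s) p0 s1 ltW// => /(_ isT) h; rewrite [RHS]h.
  by apply: eq_integral => t _; rewrite gee0_abs// lee_fin exprn_ge0// ltW.
move/(ae_eq_integral_abs P measurableT (measurable_nat_comp mY (fun k => (s ^+ k)%:E)))=> -[A [mA A0 sA]].
have : (P setT <= P A)%E.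
  apply: le_measure; rewrite ?inE// => t _; apply: sA => /= h.
  by have /eqP := h I; rewrite eqe expf_eq0 gt_eqF// andbF.
by rewrite A0 probability_setT lee_fin leNgt ltr01.
Qed.

End generating_function.

(** * Envelope iteration *)

Section envelope.
Context {R : realType} {d : measure_display} {T : measurableType d}
  (P : probability T R) (X0 : T -> nat).
Hypothesis mX0 : measurable_fun setT X0.
Variables mu eta : probability nat R.
Implicit Types s t x y c C : R.

Local Notation u := (pgf mu id).
Local Notation r := (pgf eta id).
Local Notation F0 := (pgf P X0).
Local Notation du := (dpgf mu id).
Local Notation gu := (gpgf mu id).

Let mid : measurable_fun setT (id : nat -> nat). Proof. by []. Qed.

Fixpoint env (n : nat) s : R := if n is n'.+1 then r s * env n' (u s) else F0 s.

Let u01 s : 0 <= s <= 1 -> 0 <= u s <= 1.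
Proof. by move=> s01; rewrite pgf_ge0 ?pgf_le1//; case/andP: s01. Qed.

Let r01 s : 0 <= s <= 1 -> 0 <= r s <= 1.
Proof. by move=> s01; rewrite pgf_ge0 ?pgf_le1//; case/andP: s01. Qed.

Let iter01 k s : 0 <= s <= 1 -> 0 <= iter k u s <= 1.
Proof. by move=> s01; elim: k => [//|k ih]; rewrite iterS u01. Qed.

Lemma env_ge0 n s : 0 <= s <= 1 -> 0 <= env n s.
Proof.
elim: n s => [|n ih] s s01 /=; first by rewrite pgf_ge0//; case/andP: s01.
by rewrite mulr_ge0 ?ih ?u01//; case/andP: (r01 s01).
Qed.

Lemma env_homo n s t : 0 <= s -> s <= t -> t <= 1 -> env n s <= env n t.
Proof.
elim: n s t => [|n ih] s t s0 st t1 /=; first exact: pgf_homo.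
have s01 : 0 <= s <= 1 by rewrite s0 (le_trans st).
have t01 : 0 <= t <= 1 by rewrite (le_trans s0).
have us := u01 s01; have ut := u01 t01.
apply: ler_pM; [by case/andP: (r01 s01) | exact: env_ge0 | exact: pgf_homo | ].
by apply: ih; [case/andP: us | exact: pgf_homo | case/andP: ut].
Qed.

Lemma env_iter_le k n s : 0 <= s <= 1 -> env (k + n) s <= env n (iter k u s).
Proof.
elim: k s => [//|k ih] s s01; rewrite addSn /= -iterS iterSr.
apply: le_trans (ih _ (u01 s01)).
by rewrite ler_piMl ?env_ge0 ?u01//; case/andP: (r01 s01).
Qed.

Variables (q theta B a : R).
Hypothesis q01 : 0 <= q < 1.
Hypothesis uq : u q = q.
Hypothesis duq : 0 < du q < 1.
Hypothesis theta0 : 0 < theta.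
Hypothesis base : B = 0 \/ forall s, 0 <= s <= 1 -> r s = 1.
Hypothesis branch : [/\ theta = r q * du q, F0 q = B & 0 < dpgf P X0 q] \/
  [/\ theta = r q, B = 0 & 0 < q].

Let q01' : 0 <= q <= 1. Proof. by case/andP: q01 => -> /ltW. Qed.
Let q0 : 0 <= q. Proof. by case/andP: q01. Qed.

Let base_cancel s : 0 <= s <= 1 -> B * (r s - 1) = 0.
Proof. by move=> s01; case: base => [->|->//]; rewrite ?mul0r// subrr mulr0. Qed.

Let envB n s : 0 <= s <= 1 ->
  env n s - B = (\prod_(i < n) r (iter i u s)) * (F0 (iter n u s) - B).
Proof.
elim: n s => [|n ih] s s01 /=; first by rewrite big_ord0 mul1r.
rewrite big_ord_recl -[u (iter n u s)]iterS iterSr.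
rewrite (eq_bigr (fun i : 'I_n => r (iter i u (u s)))); last first.
  by move=> i _; rewrite lift0 iterSr.
rewrite -mulrA -ih ?u01//; have := base_cancel s01; lra.
Qed.

Let rq_gt0 : 0 < r q.
Proof.
have rq0 : 0 <= r q by case/andP: (r01 q01').
rewrite lt_neqAle rq0 andbT; apply/eqP => /esym rq; move: theta0.
by case: branch => -[->]; rewrite rq ?mul0r ltxx.
Qed.

Let iter_ge_q k s : q <= s -> s <= 1 -> q <= iter k u s.
Proof.
move=> qs s1; elim: k => [//|k ih]; rewrite iterS -[leLHS]uq pgf_homo//.
by have /andP[] : 0 <= iter k u s <= 1 by rewrite iter01// s1 (le_trans q0).
Qed.

Let iter_dist_ge k s : q <= s < 1 -> du q ^+ k * (s - q) <= iter k u s - q.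
Proof.
move=> /andP[qs s1]; elim: k => [|k ih]; first by rewrite expr0 mul1r.
have it : 0 <= iter k u s <= 1 by rewrite iter01// (le_trans q0)//= ltW.
have := pgf_tangent mu mid q01 it; rewrite uq iterS exprS -mulrA => h.
have : du q * (du q ^+ k * (s - q)) <= du q * (iter k u s - q).
  by rewrite ler_wpM2l//; case/andP: duq => /ltW.
lra.
Qed.

Lemma env_ge_theta s0 : q < s0 < 1 -> exists2 c, 0 < c & forall n,
  c * theta ^+ n <= env n s0 - B.
Proof.
move=> /andP[qs s1]; have s01 : 0 <= s0 <= 1 by rewrite (le_trans q0) ltW.
suff [c c0 h] : exists2 c, 0 < c & forall n,
    c * theta ^+ n <= r q ^+ n * (F0 (iter n u s0) - B).
  exists c => // n; rewrite envB//; apply: le_trans (h n) _.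
  have : 0 <= r q ^+ n * (F0 (iter n u s0) - B).
    by apply: le_trans (h n); rewrite mulr_ge0 ?exprn_ge0// ltW.
  rewrite pmulr_rge0 ?exprn_gt0// => F; rewrite ler_wpM2r//.
  rewrite -[n in leLHS]card_ord -prodr_const; apply: ler_prod => i _.
  rewrite ltW//= pgf_homo ?iter_ge_q// ?(ltW qs) ?(ltW s1)//.
  by case/andP: (iter01 i s01).
case: branch => [[thE FB dF]|[thE -> qp]].
  exists (dpgf P X0 q * (s0 - q)) => [|n]; first by rewrite mulr_gt0// subr_gt0.
  rewrite thE exprMn mulrCA ler_wpM2l ?exprn_ge0 ?(ltW rq_gt0)//.
  have := pgf_tangent P mX0 q01 (iter01 n s01); rewrite FB => h.
  have : dpgf P X0 q * (du q ^+ n * (s0 - q)) <= dpgf P X0 q * (iter n u s0 - q).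
    by rewrite ler_wpM2l ?(ltW dF)// iter_dist_ge// ltW.
  lra.
exists (F0 q) => [|n]; first by rewrite pgf_gt0// qp ltW//; case/andP: q01.
rewrite thE mulrC ler_wpM2l ?exprn_ge0 ?(ltW rq_gt0)// subr0 pgf_homo//.
  by rewrite iter_ge_q// ltW.
by case/andP: (iter01 n s01).
Qed.

Lemma env0_deficit : exists2 C, 0 <= C & forall n, B - env n 0 <= C * theta ^+ n.
Proof.
have h01 : 0 <= (0 : R) <= 1 by rewrite lexx ler01.
case: base => [->|r1].
  by exists 0 => // n; rewrite mul0r subr_le0 env_ge0.
case: branch => [[thE FB dF]|[_ -> _]]; last first.
  by exists 0 => // n; rewrite mul0r subr_le0 env_ge0.
exists (dpgf P X0 q * q) => [|n]; first by rewrite mulr_ge0// ltW.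
have -> : B - env n 0 = B - F0 (iter n u 0).
  by have := envB n h01; rewrite big1 => [|i _]; [lra | rewrite r1// iter01].
rewrite thE r1// mul1r -FB.
have it k : q - iter k u 0 <= du q ^+ k * q.
  elim: k => [|k ih]; first by rewrite subr0 expr0 mul1r.
  have := pgf_tangent mu mid q01 (iter01 k h01); rewrite uq iterS exprS -mulrA => h.
  have : du q * (q - iter k u 0) <= du q * (du q ^+ k * q).
    by rewrite ler_wpM2l//; case/andP: duq => /ltW.
  lra.
have := pgf_tangent P mX0 q01 (iter01 n h01) => h.
have : dpgf P X0 q * (q - iter n u 0) <= dpgf P X0 q * (du q ^+ n * q).
  by rewrite ler_wpM2l// ltW.
lra.
Qed.

Let contraction s : q < s < 1 -> u s < s.
Proof.
move=> /andP[qs s1]; have [_ dq1] := andP duq.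
have s00 : 0 <= s by apply: le_trans q0 (ltW qs).
pose K := (1 - s) ^- 2; have K0 : 0 < K by rewrite invr_gt0 exprn_gt0// subr_gt0.
pose e := Num.min (s - q) ((1 - du q) / (2 * K)).
have e0 : 0 < e by rewrite lt_min subr_gt0 qs divr_gt0// ?mulr_gt0// subr_gt0.
have es : e <= s - q by rewrite /e ge_min lexx.
have eK : e * (2 * K) <= 1 - du q.
  by rewrite -ler_pdivlMr ?mulr_gt0// /e ge_min lexx orbT.
have st : q + e <= s by lra.
have ut : u (q + e) < q + e.
  have srr : 0 <= s < 1 by rewrite s00.
  have qn : `|q| <= s by rewrite ger0_norm// ltW.
  have tn : `|q + e| <= s by rewrite ger0_norm// addr_ge0// ltW.
  have := pgf_quadratic mu mid srr qn tn; rewrite uq -/K => /(le_trans (ler_norm _)).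
  have -> : q + e - q = e by ring.
  have : e * (K * e) < e * (1 - du q) by rewrite ltr_pM2l//; nra.
  rewrite expr2; lra.
have t01 : 0 <= q + e < 1 by rewrite addr_ge0 ?(ltW e0)//=; lra.
have ct := pgf_chord mu mid t01.
have s01 : 0 <= s < 1 by rewrite s00.
have cs := pgf_chord mu mid s01.
have g1 : 1 < gu (q + e).
  have : 0 < 1 - (q + e) by lra.
  by move=> h; rewrite -(ltr_pM2l h) -ct mulr1; lra.
have qe0 : 0 <= q + e by case/andP: t01.
have : 1 < gu s.
  apply: lt_le_trans g1 _; exact: (gpgf_homo mu mid qe0 st s1).
move=> g2; have : 0 < (1 - s) * (gu s - 1) by rewrite mulr_gt0 ?subr_gt0.
lra.
Qed.

Let chord_from_q s x : q <= x <= s -> s < 1 -> (u x - q) * (s - q) <= (u s - q) * (x - q).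
Proof.
move=> /andP[qx xs] s1; have x0 := le_trans q0 qx.
have x01 : 0 <= x < 1 by rewrite x0 (le_lt_trans xs).
have s01 : 0 <= s <= 1 by rewrite (le_trans x0 xs) ltW.
have h1 := pgf_tangent mu mid x01 q01'; have h2 := pgf_tangent mu mid x01 s01.
rewrite uq in h1.
have : (u x - q) * (s - x) <= du x * (x - q) * (s - x) by rewrite ler_wpM2r ?subr_ge0//; lra.
have : du x * (s - x) * (x - q) <= (u s - u x) * (x - q).
  by rewrite ler_wpM2r ?subr_ge0//; lra.
lra.
Qed.

Let env_le_theta_above s1 : q < s1 < 1 -> exists2 C, 0 <= C & forall n,
  env n s1 - B <= C * theta ^+ n.
Proof.
move=> qs1; have /andP[qs s1l] := qs1.
have s00 : 0 <= s1 by apply: le_trans q0 (ltW qs).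
have s01 : 0 <= s1 <= 1 by rewrite s00 ltW.
have s01' : 0 <= s1 < 1 by rewrite s00.
have [dq0 dq1] := andP duq.
pose x i := iter i u s1; pose dl i := x i - q.
pose lam := (u s1 - q) / (s1 - q).
have sq0 : 0 < s1 - q by rewrite subr_gt0.
have xq i : q <= x i by apply: iter_ge_q; rewrite // ltW.
have us1 : q <= u s1 by have := xq 1%N.
have lam01 : 0 <= lam < 1.
  by rewrite /lam divr_ge0 ?ltr_pdivrMr ?subr_ge0 ?(ltW qs)// mul1r; have := contraction qs1; lra.
have dl0 i : 0 <= dl i by rewrite subr_ge0.
have lip i : x i <= s1 -> dl i.+1 <= lam * dl i.
  move=> xs; rewrite /dl /x iterS -/(x i) /lam mulrAC ler_pdivlMr//.
  by apply: chord_from_q => //; rewrite xq.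
have xs i : x i <= s1.
  elim: i => [//|i ih]; have := lip _ ih; rewrite /dl.
  by have := dl0 i; rewrite /dl; case/andP: lam01 => l0 l1; nra.
have dle i : dl i <= lam ^+ i * (s1 - q).
  elim: i => [|i ih]; first by rewrite expr0 mul1r.
  apply: le_trans (lip _ (xs i)) _; rewrite exprS -mulrA ler_wpM2l//.
  by case/andP: lam01.
have sdl K n : 0 <= K -> \sum_(i < n) K * dl i <= K * ((1 - lam)^-1 * (s1 - q)).
  move=> K0; rewrite -mulr_sumr ler_wpM2l//.
  apply: le_trans (_ : \sum_(i < n) lam ^+ i * (s1 - q) <= _); first exact: ler_sum.
  by rewrite -mulr_suml ler_wpM2r ?(ltW sq0)// sum_expn_le_inv.
pose Q := (1 - s1) ^- 2 / du q.
have Q0 : 0 <= Q by rewrite divr_ge0 ?(ltW dq0)// invr_ge0 sqr_ge0.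
have stepd i : dl i.+1 <= du q * dl i * (1 + Q * dl i).
  have qn : `|q| <= s1 by rewrite ger0_norm// ltW.
  have tn : `|x i| <= s1 by rewrite ger0_norm// (le_trans q0).
  have := pgf_quadratic mu mid s01' qn tn; rewrite uq => /(le_trans (ler_norm _)).
  rewrite -[u (x i)]/(x i.+1) -/(dl i) -/(dl i.+1).
  have -> : du q * dl i * (1 + Q * dl i) = du q * dl i + (1 - s1) ^- 2 * dl i ^+ 2.
    by rewrite /Q; field; rewrite ?lt0r_neq0 ?subr_gt0.
  by rewrite /dl; lra.
have dln n : dl n <= du q ^+ n * (s1 - q) * \prod_(i < n) (1 + Q * dl i).
  elim: n => [|n ih]; first by rewrite big_ord0 expr0 mul1r mulr1.
  apply: le_trans (stepd n) _; rewrite big_ord_recr /= mulrA.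
  have p1 : 0 <= 1 + Q * dl n by rewrite addr_ge0// mulr_ge0.
  apply: ler_wpM2r => //; rewrite exprS.
  have := ler_wpM2l (ltW dq0) ih; lra.
pose D := dpgf eta id s1 / r q.
have D0 : 0 <= D by rewrite divr_ge0 ?(ltW rq_gt0)// dpgf_ge0.
have lipx d' (S : measurableType d') (p : probability S R) (Y : S -> nat) : measurable_fun setT Y ->
    forall i, pgf p Y (x i) <= pgf p Y q + dpgf p Y s1 * dl i.
  move=> mY i; have x0 : 0 <= x i by apply: le_trans q0 _.
  have xi01 : 0 <= x i < 1 by rewrite x0 (le_lt_trans (xs i)).
  have := pgf_tangent p mY xi01 q01'.
  have := ler_wpM2r (dl0 i) (dpgf_homo p mY x0 (xs i) s1l).
  rewrite /dl; lra.
have rstep i : r (x i) <= r q * (1 + D * dl i).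
  apply: le_trans (lipx _ _ eta id mid i) _.
  rewrite le_eqVlt; apply/orP; left; apply/eqP; rewrite /D.
  by field; rewrite lt0r_neq0.
have prodr n : \prod_(i < n) r (x i) <= r q ^+ n * \prod_(i < n) (1 + D * dl i).
  rewrite -[n in _ ^+ n]card_ord -prodr_const -big_split /=.
  by apply: ler_prod => i _; rewrite rstep andbT; case/andP: (r01 (iter01 i s01)).
pose KD := expR (D * ((1 - lam)^-1 * (s1 - q))).
pose KQ := expR (Q * ((1 - lam)^-1 * (s1 - q))).
have prodr' n : \prod_(i < n) r (x i) <= r q ^+ n * KD.
  apply: le_trans (prodr n) _; rewrite ler_wpM2l ?exprn_ge0 ?(ltW rq_gt0)//.
  by apply: (prod_1D_le (e := fun i => D * dl i)) => [i|m]; [rewrite mulr_ge0 | exact: sdl].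
have prod0 n : 0 <= \prod_(i < n) r (x i).
  by apply: prodr_ge0 => i _; case/andP: (r01 (iter01 i s01)).
have dln' n : dl n <= du q ^+ n * ((s1 - q) * KQ).
  apply: le_trans (dln n) _; rewrite -mulrA ler_wpM2l ?exprn_ge0 ?(ltW dq0)//.
  rewrite ler_wpM2l ?(ltW sq0)//.
  by apply: (prod_1D_le (e := fun i => Q * dl i)) => [i|m]; [rewrite mulr_ge0 | exact: sdl].
have KD0 : 0 <= KD by exact: expR_ge0.
have KQ0 : 0 <= KQ by exact: expR_ge0.
case: branch => [[thE FB dF]|[thE B0 qp]].
  exists (KD * (dpgf P X0 s1 * ((s1 - q) * KQ))) => [|n].
    by rewrite !mulr_ge0 ?dpgf_ge0// ltW.
  rewrite envB//; have h := lipx _ _ P X0 mX0 n; rewrite FB in h.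
  apply: le_trans (_ : (\prod_(i < n) r (x i)) * (dpgf P X0 s1 * dl n) <= _).
    by rewrite ler_wpM2l// -/(x n); lra.
  rewrite thE exprMn.
  have -> : KD * (dpgf P X0 s1 * ((s1 - q) * KQ)) * (r q ^+ n * du q ^+ n) =
    (r q ^+ n * KD) * (dpgf P X0 s1 * (du q ^+ n * ((s1 - q) * KQ))) by ring.
  by rewrite ler_pM// ?mulr_ge0 ?dpgf_ge0// ler_wpM2l ?dpgf_ge0.
exists KD => // n; rewrite envB// B0 subr0 thE mulrC -[leRHS]mulr1 [X in _ <= X * _]mulrC.
rewrite mulrC ler_pM// ?pgf_ge0 ?pgf_le1 ?iter01//.
by case/andP: (iter01 n s01).
Qed.

Lemma env_le_theta s1 : 0 <= s1 < 1 -> exists2 C, 0 <= C & forall n,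
  env n s1 - B <= C * theta ^+ n.
Proof.
move=> /andP[s10 s11]; have q1 : q < 1 by case/andP: q01.
pose s := Num.max s1 ((1 + q) / 2).
have ss : s1 <= s by rewrite /s le_max lexx.
have s1' : s < 1 by rewrite /s gt_max s11; lra.
have [C C0 h] : exists2 C, 0 <= C & forall n, env n s - B <= C * theta ^+ n.
  apply: env_le_theta_above; rewrite s1' andbT /s lt_max; apply/orP; right; lra.
exists C => // n; apply: le_trans (h n); rewrite lerD2r env_homo//; exact: ltW.
Qed.

End envelope.

Section deficit_sums.
Context {R : realType} {d : measure_display} {T : measurableType d}
  (P : probability T R) (Y : T -> nat).
Hypothesis mY : measurable_fun setT Y.
Implicit Types (a c s : R).

Lemma sum_le_integral_sum (x : nat -> R) (g : nat -> nat -> R) (w : nat -> R) C :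
  (forall i k, 0 <= g i k) -> (forall i, ((x i)%:E <= \int[P]_t (g i (Y t))%:E)%E) ->
  (forall k, 0 <= w k) -> 0 <= C ->
  (forall n k, \sum_(i < n) g i k <= C * w k) -> (\int[P]_t (w (Y t))%:E < +oo)%E ->
  exists S, forall n, \sum_(i < n) x i <= S.
Proof.
move=> g0 xg w0 C0 gw wfin.
have W : (\int[P]_t (w (Y t))%:E)%E \is a fin_num.
  by rewrite ge0_fin_numE// integral_ge0// => t _; rewrite lee_fin.
exists (C * fine (\int[P]_t (w (Y t))%:E)%E) => n.
rewrite -lee_fin EFinM fineK// -sumEFin.
apply: (@le_trans _ _ (\sum_(i < n) \int[P]_t (g i (Y t))%:E)%E); first exact: lee_sum.
rewrite -ge0_integral_sum//; last 2 first.
- by move=> i; exact: (measurable_nat_comp mY (fun k => (g i k)%:E)).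
- by move=> i t _; rewrite lee_fin.
rewrite -ge0_integralZl_EFin//; last 2 first.
- by move=> t _; rewrite lee_fin.
- exact: (measurable_nat_comp mY (fun k => (w k)%:E)).
apply: ge0_le_integral => //.
- by move=> t _; apply: sume_ge0 => i _; rewrite lee_fin.
- exact: (measurable_nat_comp mY (fun k => \sum_(i < n) (g i k)%:E)%E).
- exact: (measurable_nat_comp mY (fun k => C%:E * (w k)%:E)%E).
- by move=> t _; rewrite sumEFin lee_fin.
Qed.

Let inv01 a i : 1 < a -> 0 < a ^- i <= 1.
Proof.
move=> a1; have a0 : 0 < a by lra.
by rewrite invr_gt0 exprn_gt0//= invf_le1 ?exprn_gt0// exprn_ege1// ltW.
Qed.

Lemma gpgf_deficit_sum a : 1 < a -> (a%:E <= \int[P]_t (Y t)%:R%:E)%E ->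
  (\int[P]_t ((Y t)%:R * ln (1 + (Y t)%:R))%:E < +oo)%E ->
  exists S, forall n, \sum_(i < n) (a - gpgf P Y (1 - a ^- i)) <= S.
Proof.
move=> a1 ha hlog; have [C C0 hC] := sum_min1_le_ln a1.
apply: (@sum_le_integral_sum (fun i => a - gpgf P Y (1 - a ^- i)) (fun i k => k%:R * minr 1 (k%:R / a ^+ i))
  (fun k => k%:R * ln (1 + k%:R)) C) => //.
- by move=> i k; rewrite mulr_ge0// le_min ler01/= mulr_ge0//; case/andP: (inv01 i a1) => /ltW.
- move=> i; have /andP[i0 i1] := inv01 i a1.
  have s01 : 0 <= 1 - a ^- i < 1 by lra.
  have s01' : 0 <= 1 - a ^- i <= 1 by lra.
  rewrite EFinB leeBlDr//; apply: le_trans ha _.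
  rewrite /gpgf EFin_nexp//; last exact: nbounded_geom.
  rewrite -ge0_integralD//; last 4 first.
  + by move=> t _; rewrite lee_fin mulr_ge0// le_min ler01/= mulr_ge0// ltW.
  + exact: (measurable_nat_comp mY (fun k => (k%:R * minr 1 (k%:R / a ^+ i))%:E)).
  + by move=> t _; rewrite lee_fin; apply: sumr_ge0 => j _; rewrite exprn_ge0//; lra.
  + exact: (measurable_nat_comp mY (fun k => (\sum_(j < k) (1 - a ^- i) ^+ j)%:E)).
  apply: ge0_le_integral => //.
  + by exact: (measurable_nat_comp mY (fun k => (k%:R)%:E)).
  + exact: (measurable_nat_comp mY (fun k => (k%:R * minr 1 (k%:R / a ^+ i))%:E
      + (\sum_(j < k) (1 - a ^- i) ^+ j)%:E)%E).
  + move=> t _; rewrite -EFinD lee_fin -lerBlDr.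
    by apply: le_trans (geom_sum_deficit _ s01') _; rewrite opprB addrC subrK.
- by move=> k; rewrite mulr_ge0// ln_ge0// lerDl.
- exact: ltW.
- move=> n k; rewrite -mulr_sumr mulrCA ler_wpM2l//; exact: hC.
Qed.

Lemma pgf_deficit_sum a c : 1 < a -> 0 < c <= 1 ->
  (\int[P]_t (ln (1 + (Y t)%:R))%:E < +oo)%E ->
  exists S, forall n, \sum_(i < n) (1 - pgf P Y (1 - c * a ^- i)) <= S.
Proof.
move=> a1 /andP[c0 c1] hlog; have [C C0 hC] := sum_min1_le_ln a1.
apply: (@sum_le_integral_sum (fun i => 1 - pgf P Y (1 - c * a ^- i)) (fun i k => minr 1 (k%:R / a ^+ i))
  (fun k => ln (1 + k%:R)) C) => //.
- by move=> i k; rewrite le_min ler01/= mulr_ge0//; case/andP: (inv01 i a1) => /ltW.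
- move=> i; have /andP[i0 i1] := inv01 i a1.
  have ci : 0 < c * a ^- i <= 1 by rewrite mulr_gt0//= mulr_ile1// ltW.
  set s := 1 - c * a ^- i; have s01 : 0 <= s <= 1 by rewrite /s; lra.
  have bs : nbounded (fun k => s ^+ k).
    by apply: nbounded_exp; rewrite ger0_norm; case/andP: s01.
  rewrite -[X in X - _](nexp_cst P Y) -[pgf _ _ _]/(nexp P Y _) -nexpB//; last exact: nbounded_cst.
  rewrite EFin_nexp//; last by apply: nboundedB => //; exact: nbounded_cst.
  apply: ge0_le_integral => //.
  + by move=> t _; rewrite lee_fin subr_ge0; case/andP: s01 => ? ?; exact: exprn_ile1.
  + exact: (measurable_nat_comp mY (fun k => (1 - s ^+ k)%:E)).
  + exact: (measurable_nat_comp mY (fun k => (minr 1 (k%:R / a ^+ i))%:E)).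
  + move=> t _; rewrite lee_fin le_min; apply/andP; split.
      by rewrite gerBl exprn_ge0//; case/andP: s01.
    have := expn_tangent (Y t) (ler01 : 0 <= 1 :> R) (_ : 0 <= s); rewrite !expr1n.
    case/andP: s01 => -> _ /(_ isT); rewrite /s => h.
    have : (Y t)%:R * (c * a ^- i) <= (Y t)%:R * a ^- i.
      by rewrite ler_wpM2l// ger_pMl.
    lra.
- by move=> k; rewrite ln_ge0// lerDl.
- exact: ltW.
- move=> n k; exact: hC.
Qed.

End deficit_sums.

Section envelope_scales.
Context {R : realType} {d : measure_display} {T : measurableType d}
  (P : probability T R) (X0 : T -> nat).
Hypothesis mX0 : measurable_fun setT X0.
Variables (mu eta : probability nat R) (a : R).
Implicit Types s t x y c C : R.

Local Notation u := (pgf mu id).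
Local Notation r := (pgf eta id).
Local Notation gu := (gpgf mu id).
Local Notation env := (env P X0 mu eta).

Let mid : measurable_fun setT (id : nat -> nat). Proof. by []. Qed.

Hypothesis a1 : 1 < a.
Hypothesis gua : forall s, 0 <= s < 1 -> gu s <= a.

Let inv01 i : 0 < a ^- i <= 1.
Proof.
have a0 : 0 < a by apply: lt_trans a1.
by rewrite invr_gt0 exprn_gt0//= invf_le1 ?exprn_gt0// exprn_ege1// ltW.
Qed.

Let invS i : a * a ^- i.+1 = a ^- i.
Proof. by rewrite exprS invfM mulrA divff ?mul1r// lt0r_neq0// (lt_trans _ a1). Qed.

Lemma iter_pgf_escape k y : 0 <= y -> y <= a ^- k ->
  iter k u (1 - y) <= 1 - y * \prod_(i < k) gu (1 - a ^- i.+1).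
Proof.
elim: k y => [|k ih] y y0 yk; first by rewrite big_ord0 mulr1.
have /andP[k0 k1] := inv01 k.+1.
have [->|yn0] := eqVneq y 0.
  have i01 j : 0 <= iter j u 1 <= 1.
    by elim: j => [|j /andP[j0 j1]]; rewrite ?lexx ?ler01// iterS pgf_ge0// pgf_le1// j0.
  by rewrite mul0r !subr0; case/andP: (i01 k.+1).
have yp : 0 < y by rewrite lt_neqAle eq_sym yn0.
have s01 : 0 <= 1 - y < 1 by lra.
have g0 : 0 <= gu (1 - y) by apply: gpgf_ge0; lra.
have -> : iter k.+1 u (1 - y) = iter k u (1 - y * gu (1 - y)).
  by rewrite iterSr; congr (iter k u _); have := pgf_chord mu mid s01; lra.
apply: le_trans (ih _ _ _) _; first exact: mulr_ge0.
  rewrite -invS mulrC; apply: ler_pM => //; exact: gua.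
rewrite lerD2l lerN2 big_ord_recr /= -mulrA ler_wpM2l// mulrC ler_wpM2r//.
  by apply: prodr_ge0 => i _; apply: gpgf_ge0; have := inv01 i.+1; lra.
by apply: (gpgf_homo mu mid); lra.
Qed.

Lemma prod_gpgf_ge : (a%:E <= \int[mu]_k k%:R%:E)%E ->
  (\int[mu]_k (k%:R * ln (1 + k%:R))%:E < +oo)%E -> 0 < gu 0 ->
  exists2 c, 0 < c & forall k, c * a ^+ k <= \prod_(i < k) gu (1 - a ^- i.+1).
Proof.
move=> ma hlog g0; have a0 : 0 < a by apply: lt_trans a1.
have [S hS] := gpgf_deficit_sum mid a1 ma hlog.
pose e i : R := (a - gu (1 - a ^- i.+1)) / a.
have s01 i : 0 <= 1 - a ^- i.+1 < 1 by have := inv01 i.+1; lra.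
exists (expR (- (S / a / (gu 0 / a)))) => [|k]; first exact: expR_gt0.
have eE i : gu (1 - a ^- i.+1) = a * (1 - e i).
  by rewrite /e; field; rewrite lt0r_neq0.
under eq_bigr do rewrite eE.
rewrite big_split /= prodr_const card_ord mulrC ler_wpM2l ?exprn_ge0 ?(ltW a0)//.
apply: prod_onem_ge; first by rewrite divr_gt0.
- by move=> i; rewrite divr_ge0 ?(ltW a0)// subr_ge0 gua.
- move=> i; rewrite ler_pdivrMr// mulrC -eE.
  by apply: (gpgf_homo mu mid) => //; case/andP: (s01 i).
- move=> n; rewrite -mulr_suml ler_wpM2r ?invr_ge0 ?(ltW a0)//.
  apply: le_trans (hS n.+1); rewrite big_ord_recl /= lerDr expr0 invr1 subrr subr_ge0.
  by apply: gua; rewrite lexx ltr01.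
Qed.

Variables (q theta B : R).
Hypothesis q01 : 0 <= q < 1.
Hypothesis uq : u q = q.
Hypothesis duq : 0 < dpgf mu id q < 1.
Hypothesis theta0 : 0 < theta.
Hypothesis base : B = 0 \/ forall s, 0 <= s <= 1 -> r s = 1.
Hypothesis branch : [/\ theta = r q * dpgf mu id q, pgf P X0 q = B & 0 < dpgf P X0 q] \/
  [/\ theta = r q, B = 0 & 0 < q].

Lemma env_scale_le c : (a%:E <= \int[mu]_k k%:R%:E)%E ->
  (\int[mu]_k (k%:R * ln (1 + k%:R))%:E < +oo)%E -> 0 < gu 0 -> 0 < c <= 1 ->
  exists2 C, 0 <= C & forall k n, (k <= n)%N ->
  env n (1 - c * a ^- k) - B <= C * theta ^+ (n - k).
Proof.
move=> ma hlog g0 /andP[c0 c1]; have [c' c'0 hc'] := prod_gpgf_ge ma hlog g0.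
have it01 k x : 0 <= x <= 1 -> 0 <= iter k u x <= 1.
  by move=> /andP[x0 x1]; elim: k => [|k /andP[ih0 ih1]]; rewrite ?x0// iterS pgf_ge0// pgf_le1// ih0.
have sk k : 0 <= 1 - c * a ^- k <= 1.
  have /andP[k0 k1] := inv01 k.
  by have := ler_pM (ltW c0) (ltW k0) c1 k1; have := mulr_ge0 (ltW c0) (ltW k0); lra.
have esc k : iter k u (1 - c * a ^- k) <= 1 - c * c'.
  have /andP[k0 k1] := inv01 k.
  apply: le_trans (iter_pgf_escape _ _) _; first by rewrite mulr_ge0 ?ltW.
    by rewrite ger_pMl.
  rewrite lerD2l lerN2; have := ler_wpM2l (mulr_ge0 (ltW c0) (ltW k0)) (hc' k).
  apply: le_trans; rewrite le_eqVlt; apply/orP; left; apply/eqP.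
  by field; rewrite expf_neq0// lt0r_neq0// (lt_trans _ a1).
have s1 : 0 <= 1 - c * c' < 1.
  have := esc 0%N; have := it01 0%N _ (sk 0%N); have := mulr_gt0 c0 c'0; lra.
have [C C0 hC] := env_le_theta mX0 q01 uq duq theta0 base branch s1.
exists C => // k n kn; apply: le_trans (hC _); rewrite lerD2r -{1}(subnKC kn).
apply: le_trans (env_iter_le P X0 mu eta _ _ (sk k)) _.
apply: env_homo => //; [by case/andP: (it01 k _ (sk k)) | by lra].
Qed.

Lemma env_scale_ge : (\int[eta]_k (ln (1 + k%:R))%:E < +oo)%E ->
  exists2 c0, 0 < c0 < 1 & forall c, 0 < c <= c0 -> exists2 C, 0 < C &
  forall k n, (k <= n)%N -> C * theta ^+ (n - k) <= env n (1 - c * a ^- k) - B.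
Proof.
move=> hlog; have /andP[q0 q1] := q01; exists ((1 - q) / 2); first by lra.
move=> c /andP[c0 cc]; have c01 : 0 < c <= 1 by lra.
have [S hS] := pgf_deficit_sum mid a1 c01 hlog.
have s01 : q < 1 - c < 1 by lra.
have [c' c'0 hc'] := env_ge_theta mX0 q01 uq duq theta0 base branch s01.
have sk k : 1 - c <= 1 - c * a ^- k <= 1.
  have /andP[k0 k1] := inv01 k.
  by have := ler_pM (ltW c0) (ltW k0) (lexx c) k1; have := mulr_ge0 (ltW c0) (ltW k0); lra.
have sk' k : 0 <= 1 - c * a ^- k <= 1 by have := sk k; lra.
have r0 : 0 < r (1 - c) by apply: pgf_gt0 => //; lra.
exists (expR (- (S / r (1 - c))) * c') => [|k n kn]; first by rewrite mulr_gt0// expR_gt0.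
have ep : expR (- (S / r (1 - c))) <= \prod_(i < k) r (1 - c * a ^- i.+1).
  have -> : \prod_(i < k) r (1 - c * a ^- i.+1) = \prod_(i < k) (1 - (1 - r (1 - c * a ^- i.+1))).
    by apply: eq_bigr => i _; ring.
  apply: (prod_onem_ge (e := fun i => 1 - r (1 - c * a ^- i.+1))) => //.
  - by move=> i; rewrite subr_ge0 pgf_le1.
  - by move=> i; rewrite subKr; have := sk i.+1 => /andP[? ?]; apply: pgf_homo => //; lra.
  - move=> m; apply: le_trans (hS m.+1); rewrite big_ord_recl /= lerDr subr_ge0 pgf_le1//.

have lower j : (\prod_(i < j) r (1 - c * a ^- i.+1)) * (env (n - k) (1 - c) - B) <=
    env (j + (n - k)) (1 - c * a ^- j) - B.
  elim: j => [|j ih]; first by rewrite big_ord0 mul1r add0n expr0 invr1 mulr1.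
  rewrite big_ord_recr /=; set x := 1 - c * a ^- j.+1.
  have x01 : 0 <= x <= 1 by exact: sk'.
  have xs : x < 1 by rewrite /x ltrBlDr ltrDl mulr_gt0//; case/andP: (inv01 j.+1).
  have ux : 1 - c * a ^- j <= u x.
    have x01' : 0 <= x < 1 by case/andP: x01 => ->.
    have := pgf_chord mu mid x01'; have := gua x01'; rewrite -invS => h1.
    have : (1 - x) * gu x <= (1 - x) * a by rewrite ler_wpM2l// subr_ge0 ltW.
    have -> : 1 - x = c * a ^- j.+1 by rewrite /x; ring.
    by rewrite -/x; lra.
  have rx0 : 0 <= r x by rewrite pgf_ge0//; case/andP: x01.
  have e1 : env (j + (n - k)) (1 - c * a ^- j) <= env (j + (n - k)) (u x).
    by apply: env_homo => //; [case/andP: (sk' j) | exact: pgf_le1].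
  have bb : B * (r x - 1) = 0.
    by case: base => [->|->//]; rewrite ?mul0r// subrr mulr0.
  have e2 := ler_wpM2l rx0 (le_trans ih (lerB e1 (lexx B))).
  by move: e2; rewrite mulrA [r x * \prod_(_ < _) _]mulrC => /le_trans; apply; lra.
have := lower k; rewrite subnKC// => /(le_trans _); apply.
have h := hc' (n - k)%N.
have e0 : 0 <= env (n - k) (1 - c) - B.
  by apply: le_trans h; rewrite mulr_ge0 ?exprn_ge0 ?ltW.
rewrite -mulrA; apply: ler_pM; rewrite ?expR_ge0//.
by rewrite mulr_ge0 ?exprn_ge0 ?ltW.
Qed.

End envelope_scales.

(** * Harmonic moments *)

Lemma exists_expn_le {R : realType} (x e : R) : 0 <= x < 1 -> 0 < e -> exists N, x ^+ N <= e.
Proof.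
move=> /andP[x0 x1] e0; have nx : `|x| < 1 by rewrite ger0_norm.
have /cvgr0Pnorm_lt /(_ _ e0)[N _ hN] := cvg_expr nx.
by exists N; have := hN N (leqnn N); rewrite /= ger0_norm ?exprn_ge0// => /ltW.
Qed.

Section harmonic_moments.
Context {R : realType} {d : measure_display} {T : measurableType d}
  (P : probability T R).
Implicit Types (Y : T -> nat) (s r c C : R).

Lemma nexp_sum Y (mY : measurable_fun setT Y) n (A : pred nat) (w : nat -> R) (g : nat -> nat -> R) :
  (forall i, nbounded (g i)) ->
  nbounded (fun k => \sum_(i < n | A i) w i * g i k) /\
  nexp P Y (fun k => \sum_(i < n | A i) w i * g i k) = \sum_(i < n | A i) w i * nexp P Y (g i).
Proof.
move=> bg; elim: n => [|n [ihb ih]].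
  have -> : (fun k => \sum_(i < 0 | A i) w i * g i k) = (fun=> 0).
    by apply/funext => k; rewrite big_ord0.
  by rewrite big_ord0 nexp_cst; split => //; exact: nbounded_cst.
have bw : nbounded (fun k => if A n then w n * g n k else 0).
  by case: (A n); [exact: nboundedZ | exact: nbounded_cst].
have -> : (fun k => \sum_(i < n.+1 | A i) w i * g i k) =
    (fun k => \sum_(i < n | A i) w i * g i k + (if A n then w n * g n k else 0)).
  by apply/funext => k; rewrite big_mkcond big_ord_recr /= -big_mkcond.
split; first exact: nboundedD.
rewrite nexpD// ih [in RHS]big_mkcond big_ord_recr /= -big_mkcond; congr (_ + _).
by case: (A n); rewrite ?nexp_cst// nexpZ.
Qed.

Let hpow r (k : nat) : R := if (0 < k)%N then k%:R `^ (- r) else 0.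

Let hpow_ge0 r k : 0 <= hpow r k.
Proof. by rewrite /hpow; case: ifP => // _; exact: powR_ge0. Qed.

Let nbounded_hpow r : 0 < r -> nbounded (hpow r).
Proof.
move=> r0; exists 1 => k; rewrite ger0_norm// /hpow; case: ifP => // k0.
rewrite powRN invf_le1 ?powR_gt0 ?ltr0n//.
have : 1 `^ r <= k%:R `^ r by apply: ge0_ler_powR; rewrite ?nnegrE ?ler1n//; exact: ltW.
by rewrite powR1.
Qed.

Lemma measurable_gt0 Y : measurable_fun setT Y -> measurable [set t | (0 < Y t)%N].
Proof. by move=> mY; have := mY measurableT [set k | (0 < k)%N] I; rewrite setTI. Qed.

Let harmonic_momentE Y r : measurable_fun setT Y -> 0 < r ->
  harmonic_moment P Y r = (nexp P Y (hpow r))%:E.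
Proof.
move=> mY r0; rewrite EFin_nexp//; last exact: nbounded_hpow.
rewrite /harmonic_moment integral_mkcond; apply: eq_integral => t _.
rewrite patchE /hpow; case: (boolP (0 < Y t)%N) => yt; first by rewrite mem_set.
by rewrite memNset//; exact/negP.
Qed.

Let bexpB s : 0 <= s <= 1 -> nbounded (fun k => s ^+ k - 0 ^+ k).
Proof.
move=> /andP[s0 s1]; apply: nboundedB; apply: nbounded_exp; first by rewrite ger0_norm.
by rewrite normr0.
Qed.

Let nexp_expB Y s : measurable_fun setT Y -> 0 <= s <= 1 ->
  nexp P Y (fun k => s ^+ k - 0 ^+ k) = pgf P Y s - pgf P Y 0.
Proof.
move=> mY /andP[s0 s1]; apply: nexpB => //; apply: nbounded_exp; first by rewrite ger0_norm.
by rewrite normr0.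
Qed.

Variables (Y : nat -> T -> nat) (a theta B : R).
Hypothesis mY : forall n, measurable_fun setT (Y n).
Hypothesis a1 : 1 < a.
Hypothesis theta01 : 0 < theta < 1.

Hypothesis scale_le : exists2 C, 0 <= C & forall k n, (k <= n)%N ->
  pgf P (Y n) (1 - a ^- k / 2) - B <= C * theta ^+ (n - k).
Hypothesis scale_ge : exists2 c, 0 < c <= 1 & exists2 C, 0 < C & forall k n, (k <= n)%N ->
  C * theta ^+ (n - k) <= pgf P (Y n) (1 - c * a ^- k) - B.
Hypothesis deficit : exists2 C, 0 <= C & forall n, B - pgf P (Y n) 0 <= C * theta ^+ n.

Let inv01 i : 0 < a ^- i <= 1.
Proof.
have a0 : 0 < a by apply: lt_trans a1.
by rewrite invr_gt0 exprn_gt0//= invf_le1 ?exprn_gt0// exprn_ege1// ltW.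
Qed.

Let half01 k : 0 <= 1 - a ^- k / 2 <= 1. Proof. by have := inv01 k; lra. Qed.

Let a0 : 0 < a. Proof. exact: lt_trans a1. Qed.
Let theta0 : 0 < theta. Proof. by case/andP: theta01. Qed.

Let theta_le k n : (k <= n)%N -> theta ^+ n <= theta ^+ (n - k).
Proof.
have /andP[t0 t1] := theta01.
by move=> kn; apply: ler_wiXn2l; rewrite ?(ltW t0) ?(ltW t1) ?leq_subr.
Qed.

Let diff_le : exists2 C, 0 <= C & forall k n, (k <= n)%N ->
  pgf P (Y n) (1 - a ^- k / 2) - pgf P (Y n) 0 <= C * theta ^+ (n - k).
Proof.
have [C C0 hC] := scale_le; have [D D0 hD] := deficit.
exists (C + D) => [|k n kn]; first exact: addr_ge0.
have := hC _ _ kn; have := hD n; have := ler_wpM2l D0 (theta_le kn); lra.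
Qed.

Lemma harmonic_moment_le r : 0 < r -> exists2 C, 0 < C & forall n, (0 < n)%N ->
  (harmonic_moment P (Y n) r <= (C * bsc theta a r n)%:E)%E.
Proof.
move=> r0; have [C C0 hC] := diff_le; have [D D0 hD] := scale_sum_le_bsc r a0 theta0.
pose b := a `^ r; have b0 : 0 < b by rewrite powR_gt0 ?a0.
pose K := 1 + expR a * C.
have K1 : 1 <= K by rewrite lerDl mulr_ge0 ?expR_ge0.
exists (K * D) => [|n n0]; first by rewrite mulr_gt0// (lt_le_trans _ K1).
rewrite harmonic_momentE// lee_fin.
have bg i : nbounded (fun k => (1 - a ^- i / 2) ^+ k - 0 ^+ k) by exact: bexpB.
have [bs es] := nexp_sum (mY n) n xpredT (fun i => b ^- i) bg.
apply: (@le_trans _ _ (nexp P (Y n) (fun k => b ^- n +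
    expR a * \sum_(i < n) b ^- i * ((1 - a ^- i / 2) ^+ k - 0 ^+ k)))).
  apply: nexp_le => //; first exact: nbounded_hpow.
    by apply: nboundedD; [exact: nbounded_cst | exact: nboundedZ].
  move=> k; rewrite /hpow; case: ifPn => [k0|]; last first.
    rewrite -leqNgt leqn0 => /eqP->; rewrite addr_ge0 ?invr_ge0 ?exprn_ge0 ?(ltW b0)//.
    by rewrite mulr_ge0 ?expR_ge0// sumr_ge0// => i _; rewrite !expr0 subrr mulr0.
  have e i : (1 - a ^- i / 2) ^+ k - 0 ^+ k = (1 - a ^- i / 2) ^+ k.
    by rewrite [0 ^+ k]expr0n gtn_eqF// subr0.
  under eq_bigr do rewrite e.
  have s0 : 0 <= \sum_(i < n) b ^- i * (1 - a ^- i / 2) ^+ k.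
    apply: sumr_ge0 => i _; rewrite mulr_ge0 ?invr_ge0 ?exprn_ge0 ?(ltW b0)//.
    by case/andP: (half01 i).
  have [kn|kn] := ltP k%:R (a ^+ n).
    apply: le_trans (powRN_le_scale_sum a1 r0 k0 kn) _.
    by rewrite lerDr invr_ge0 exprn_ge0// ltW.
  apply: (@le_trans _ _ (b ^- n)); last by rewrite lerDl mulr_ge0 ?expR_ge0.
  rewrite /b -powRN_exp ?(ltW a0)// !powRN lef_pV2 ?posrE ?powR_gt0 ?exprn_gt0 ?ltr0n//.
  by apply: ge0_ler_powR; rewrite ?nnegrE ?exprn_ge0 ?(ltW a0)// ltW.
rewrite nexpD//; [|exact: nbounded_cst|exact: nboundedZ].
rewrite nexp_cst nexpZ// es -mulrA.
apply: le_trans (ler_wpM2l (le_trans ler01 K1) (hD n n0)); rewrite -/b mulrDr.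
apply: lerD; first by rewrite ler_peMl// invr_ge0 exprn_ge0 ?(ltW b0).
apply: (@le_trans _ _ (expR a * (C * \sum_(k < n) b ^- k * theta ^+ (n - k)))).
  rewrite ler_pM2l ?expR_gt0// mulr_sumr; apply: ler_sum => i _.
  rewrite mulrCA ler_wpM2l ?invr_ge0 ?exprn_ge0 ?(ltW b0)// nexp_expB//.
  by apply: hC; rewrite ltnW.
rewrite mulrA ler_wpM2r//; last by rewrite /K lerDr.
by apply: sumr_ge0 => i _; rewrite mulr_ge0 ?invr_ge0 ?exprn_ge0 ?(ltW b0) ?(ltW theta0).
Qed.

Lemma harmonic_moment_ge r : 0 < r -> exists2 C, 0 < C & exists N, forall n, (N <= n)%N ->
  ((C * bsc theta a r n)%:E <= harmonic_moment P (Y n) r)%E.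
Proof.
move=> r0; have [C C0 hC] := scale_le; have [c c01 [D D0 hD]] := scale_ge.
have /andP[_ t1] := theta01; have /andP[c0 c1] := c01.
pose b := a `^ r; have b0 : 0 < b by rewrite powR_gt0 ?a0.
have [k0 hk0] : exists k0, C * theta ^+ k0 <= D / 2.
  have e0 : 0 < D / (2 * (C + 1)) by rewrite divr_gt0// mulr_gt0//; lra.
  have t01 : 0 <= theta < 1 by rewrite (ltW theta0).
  have [N hN] := exists_expn_le t01 e0; exists N; move: hN.
  have C1 : 0 < 2 * (C + 1) by lra.
  rewrite ler_pdivlMr// => h; have := exprn_ge0 N (ltW theta0); nra.
have [E E0 hE] := scale_sum_le_powRN a1 r0 c01.
have [G G0 hG] := bsc_le_scale_sum r k0 a0 theta0.
exists (D / 2 * G / E) => [|]; first by rewrite divr_gt0// mulr_gt0// divr_gt0.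
exists k0.*2.+1 => n kn; rewrite harmonic_momentE// lee_fin.
rewrite mulrAC ler_pdivrMr// -mulrA [leRHS]mulrC -nexpZ//; last exact: nbounded_hpow.
have ca01 i : 0 <= 1 - c * a ^- i <= 1.
  have /andP[i0 i1] := inv01 i.
  by have := ler_pM (ltW c0) (ltW i0) c1 i1; have := mulr_ge0 (ltW c0) (ltW i0); lra.
have bg i : nbounded (fun k => (1 - c * a ^- i) ^+ k - 0 ^+ k) by exact: bexpB.
have [bs es] := nexp_sum (mY n) n.+1 (fun i => k0 <= i)%N (fun i => b ^- i) bg.
apply: (@le_trans _ _ (nexp P (Y n) (fun k =>
    \sum_(i < n.+1 | (k0 <= i)%N) b ^- i * ((1 - c * a ^- i) ^+ k - 0 ^+ k)))); last first.
  apply: nexp_le => //; first by apply: nboundedZ; exact: nbounded_hpow.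
  move=> k; have [->|k0'] := posnP k.
    rewrite big1 => [|i _]; last by rewrite !expr0 subrr mulr0.
    by rewrite mulr_ge0// ltW.
  rewrite /hpow k0'; apply: le_trans (hE n.+1 k k0'); rewrite -/b.
  have e i : (1 - c * a ^- i) ^+ k - 0 ^+ k = (1 - c * a ^- i) ^+ k.
    by rewrite [0 ^+ k]expr0n gtn_eqF// subr0.
  under eq_bigr do rewrite e.
  rewrite big_mkcond /=; apply: ler_sum => i _; case: ifP => // _.
  rewrite mulr_ge0 ?invr_ge0 ?exprn_ge0 ?(ltW b0)//.
  by case/andP: (ca01 i).
rewrite es; have D20 : 0 <= D / 2 by rewrite divr_ge0 ?ltW.
apply: (@le_trans _ _ (D / 2 * \sum_(k < n.+1 | (k0 <= k)%N) b ^- k * theta ^+ (n - k))).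
  by apply: le_trans (ler_wpM2l D20 (hG n kn)); rewrite le_eqVlt; apply/orP; left; apply/eqP; ring.
rewrite mulr_sumr; apply: ler_sum => i ki.
rewrite mulrCA ler_wpM2l ?invr_ge0 ?exprn_ge0 ?(ltW b0)// nexp_expB//.
have ni : (i <= n)%N by rewrite -ltnS.
have h1 := hD i n ni; have h2 := hC 0%N n (leq0n n); rewrite subn0 in h2.
have h3 : pgf P (Y n) 0 <= pgf P (Y n) (1 - a ^- 0 / 2).
  by apply: pgf_homo => //; case/andP: (half01 0%N).
have h4 : C * theta ^+ n <= D / 2 * theta ^+ (n - i).
  have -> : theta ^+ n = theta ^+ i * theta ^+ (n - i) by rewrite -exprD subnKC.
  rewrite mulrA ler_wpM2r ?exprn_ge0 ?(ltW theta0)//; apply: le_trans hk0.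
  by rewrite ler_wpM2l// ler_wiXn2l// ltW// theta0.
lra.
Qed.

Lemma pgf_diff_le_theta s : 0 <= s < 1 -> exists2 C, 0 <= C & exists N, forall n, (N <= n)%N ->
  pgf P (Y n) s - pgf P (Y n) 0 <= C * theta ^+ n.
Proof.
move=> /andP[s0 s1]; have [C C0 hC] := diff_le.
have [N hN] : exists N, a ^- N <= 1 - s.
  have ai : 0 <= a^-1 < 1 by rewrite invr_ge0 (ltW a0)/= invf_lt1 ?a0.
  have s1' : 0 < 1 - s by rewrite subr_gt0.
  by have [N hN] := exists_expn_le ai s1'; exists N; rewrite -exprVn.
exists (C * theta ^- N) => [|].
  by rewrite mulr_ge0// invr_ge0 exprn_ge0// ltW// theta0.
exists N => n Nn; have := hC N n Nn.
have -> : C * theta ^- N * theta ^+ n = C * theta ^+ (n - N).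
  rewrite -[in LHS](subnK Nn) exprD; field.
  by rewrite expf_neq0// lt0r_neq0// theta0.
apply: le_trans; rewrite lerD2r pgf_homo//; have := inv01 N; lra.
Qed.

End harmonic_moments.

(** * Independence and conditioning *)

Section integration_over_countable_partition.
Context {R : realType} {d : measure_display} {T : measurableType d}
  (P : probability T R).

Lemma measurable_level (Z : T -> nat) (mZ : measurable_fun setT Z) z :
  measurable [set t | Z t = z].
Proof. by have := mZ measurableT [set z] I; rewrite setTI. Qed.

Lemma level_partition (C : set T) (Z : T -> nat) :
  C = \bigcup_z (C `&` [set t | Z t = z]) /\
  trivIset setT (fun z => C `&` [set t | Z t = z]).
Proof.
split; first by apply/seteqP; split=> [t Ct|t [z _ []]//]; exists (Z t).
apply/trivIsetP => i j _ _ /eqP ij; apply/seteqP; split => // t [[_ zi] [_ zj]].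
by apply: ij; rewrite -zi -zj.
Qed.

Lemma integral_level_sum (C : set T) (Z : T -> nat) (f : T -> \bar R) :
  measurable C -> measurable_fun setT Z -> measurable_fun C f ->
  (forall t, 0 <= f t)%E ->
  (\int[P]_(t in C) f t = \sum_(z <oo) \int[P]_(t in C `&` [set t | Z t = z]) f t)%E.
Proof.
move=> mC mZ mf f0; have [eC tC] := level_partition C Z; rewrite {1}eC.
rewrite ge0_integral_bigcup//.
- by move=> z; apply: measurableI => //; exact: measurable_level.
- by rewrite -eC.
Qed.

Lemma integral_level (C : set T) (Z : T -> nat) (h : nat -> \bar R) :
  measurable C -> measurable_fun setT Z -> (forall k, 0 <= h k)%E ->
  (\int[P]_(t in C) h (Z t) = \sum_(z <oo) h z * P (C `&` [set t | Z t = z]))%E.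
Proof.
move=> mC mZ h0; rewrite (integral_level_sum mC mZ)//; last first.
  by apply: measurable_funTS; exact: measurable_nat_comp.
apply: eq_eseriesr => z _; rewrite -integral_cst; last first.
  by apply: measurableI => //; exact: measurable_level.
by apply: eq_integral => t; rewrite inE => -[_ ->].
Qed.

Lemma integral_level_le (Z : T -> nat) (h h' : nat -> \bar R) : measurable_fun setT Z ->
  (forall k, 0 <= h k)%E -> (forall k, h k <= h' k)%E ->
  (\int[P]_t h (Z t) <= \int[P]_t h' (Z t))%E.
Proof.
move=> mZ h0 hh; apply: ge0_le_integral => //; exact: measurable_nat_comp.
Qed.

End integration_over_countable_partition.

Section adapted_events.
Context {R : realType} {d : measure_display} {T : measurableType d}
  (P : probability T R) {I : choiceType} (F : I -> set_system T).
Hypothesis mF : forall i A, F i A -> measurable A.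
Hypothesis indF : mutually_independent P F.
Implicit Types (Q : set I) (E : set T).

(* [E] is an event that behaves as if it were determined by the sources in [Q]. *)
Definition adapted Q E := measurable E /\
  forall (K : {fset I}) (A : I -> set T), (forall i, i \in K -> ~ Q i) ->
    (forall i, i \in K -> F i (A i)) ->
    P (E `&` \bigcap_(i in [set` K]) A i) = (P E * \prod_(i <- K) P (A i))%E.

Lemma adaptedT Q : adapted Q setT.
Proof. by split=> // K A _ hA; rewrite setTI probability_setT mul1e indF. Qed.

Lemma adapted0 Q : adapted Q set0.
Proof. by split=> // K A _ hA; rewrite set0I measure0 mul0e. Qed.

Lemma adapted_sub Q Q' E : Q `<=` Q' -> adapted Q E -> adapted Q' E.
Proof. by move=> QQ [mE hE]; split=> // K A hK; apply: hE => i /hK nQ /QQ. Qed.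

Lemma adapted_prod Q i E A : adapted Q E -> ~ Q i -> F i A -> P (E `&` A) = (P E * P A)%E.
Proof.
move=> [_ hE] nQ FA; have := hE [fset i]%fset (fun=> A).
rewrite big_seq_fset1 set_fset1 bigcap_set1; apply => j; first by rewrite inE => /eqP->.
by rewrite inE => /eqP->.
Qed.

Lemma adaptedI Q i E A : adapted Q E -> ~ Q i -> F i A -> adapted (Q `|` [set i]) (E `&` A).
Proof.
move=> aE nQ FA; have [mE hE] := aE; split; first by apply: measurableI => //; exact: mF FA.
move=> K B hK hB; have iK : i \notin K by apply/negP => /hK; apply; right.
pose B' j := if j == i then A else B j.
have B'E j : j \in K -> B' j = B j.
  by rewrite /B'; case: eqVneq => // -> iK'; rewrite iK' in iK.
have B'i : B' i = A by rewrite /B' eqxx.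
have := hE (i |` K)%fset B'; rewrite big_fsetU1// B'i /= muleA -(adapted_prod aE nQ FA).
rewrite (eq_big_seq (fun j => P (B j))) => [<-|j jK]; last by rewrite B'E.
- congr (P _); rewrite -setIA; congr (_ `&` _); apply/seteqP; split => t /=.
    move=> [At Bt] j; rewrite /= in_fset1U; have [-> _|ji /= jK] := eqVneq j i; first by rewrite B'i.
    by rewrite B'E//; exact: Bt.
  move=> Bt; split; first by have := Bt i (fset1U1 i K); rewrite B'i.
  by move=> j jK; rewrite -B'E//; apply: Bt; rewrite /= in_fset1U jK orbT.
- by move=> j; rewrite in_fset1U => /orP[/eqP->//|/hK nj Qj]; apply: nj; left.
- move=> j; rewrite in_fset1U => /orP[/eqP->|jK]; first by rewrite B'i.
  by rewrite B'E//; exact: hB.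
Qed.

Lemma adapted_levels Q E (Z : T -> nat) :
  (forall z, adapted Q (E `&` [set t | Z t = z])) -> adapted Q E.
Proof.
move=> h; have [eE tE] := level_partition E Z.
have mE : measurable E by rewrite eE; apply: bigcupT_measurable => z; case: (h z).
have PE (B : set T) : measurable B ->
    P (E `&` B) = (\sum_(z <oo) P (E `&` [set t | Z t = z] `&` B))%E.
  move=> mB; rewrite {1}eE setI_bigcupl measure_semi_bigcup//.
  - by move=> z; apply: measurableI => //; case: (h z).
  - by apply: trivIset_setIr.
  - by apply: bigcupT_measurable => z; apply: measurableI => //; case: (h z).
split=> // K A hK hA.
have mA : measurable (\bigcap_(i in [set` K]) A i).
  by apply: fin_bigcap_measurable => // i /= iK; apply: (@mF i); exact: hA.
rewrite PE//; under eq_eseriesr do rewrite (h _).2//.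
have pf : (\prod_(i <- K) P (A i))%E \is a fin_num.
  rewrite big_seq; elim/big_ind: _ => // [x y xf yf|i iK]; first exact: fin_numM.
  by apply: fin_num_measure; apply: (@mF i); exact: hA.
rewrite -(fineK pf) muleC; under eq_eseriesr do rewrite muleC.
rewrite nneseriesZl//; congr (_ * _)%E.
by rewrite -[in RHS](setIT E) PE//; apply: eq_eseriesr => z _; rewrite setIT.
Qed.

End adapted_events.

Section random_walk.
Context {R : realType} {d : measure_display} {T : measurableType d}
  (P : probability T R) (Y : T -> nat).
Hypothesis mY : measurable_fun setT Y.
Implicit Types g : nat -> \bar R.

(* [walk l g] is the mean of [g] at the sum of [l] independent copies of [Y]. *)
Fixpoint walk (l : nat) g : \bar R :=
  if l is l'.+1 then walk l' (fun y => (\int[P]_t g (y + Y t)%N)%E) else g 0%N.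

Lemma walk_ge0 l g : (forall k, 0 <= g k)%E -> (0 <= walk l g)%E.
Proof.
by elim: l g => [|l ih] g g0 //=; apply: ih => k; apply: integral_ge0.
Qed.

Lemma walk_le l g h : (forall k, 0 <= g k)%E -> (forall k, g k <= h k)%E ->
  (walk l g <= walk l h)%E.
Proof.
elim: l g h => [|l ih] g h g0 gh //=; apply: ih => k; first exact: integral_ge0.
exact: (@integral_level_le _ _ _ P Y (fun y => g (k + y)%N) (fun y => h (k + y)%N)).
Qed.

Lemma walk_cst l (c : R) : walk l (fun=> c%:E) = c%:E.
Proof.
elim: l => [//|l ih] /=.
rewrite -[RHS]ih; congr walk; apply/funext => k.
by rewrite integral_cst//= probability_setT mule1.
Qed.

Lemma walk_affine l (c e : R) g : 0 <= c -> 0 <= e -> (forall k, 0 <= g k)%E ->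
  walk l (fun k => c%:E * g k + e%:E)%E = (c%:E * walk l g + e%:E)%E.
Proof.
move=> c0 e0; elim: l g => [|l ih] g g0 //=.
rewrite -ih; last by move=> k; exact: integral_ge0.
congr walk; apply/funext => k; rewrite ge0_integralD//; last 2 first.
- by move=> t _; rewrite mule_ge0.
- exact: (measurable_nat_comp mY (fun y => c%:E * g (k + y)%N)%E).
rewrite ge0_integralZl_EFin//; last exact: (measurable_nat_comp mY (fun y => g (k + y)%N)).
by rewrite integral_cst//= probability_setT mule1.
Qed.

Lemma walkD l g h : (forall k, 0 <= g k)%E -> (forall k, 0 <= h k)%E ->
  walk l (fun k => g k + h k)%E = (walk l g + walk l h)%E.
Proof.
elim: l g h => [|l ih] g h g0 h0 //=.
rewrite -ih; [|by move=> k; exact: integral_ge0..].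
congr walk; apply/funext => k; rewrite ge0_integralD//.
- exact: (measurable_nat_comp mY (fun y => g (k + y)%N)).
- exact: (measurable_nat_comp mY (fun y => h (k + y)%N)).
Qed.

Lemma walk_exp l (b w : R) : 0 <= b -> (\int[P]_t (b ^+ Y t)%:E)%E = w%:E ->
  walk l (fun k => (b ^+ k)%:E) = (w ^+ l)%:E.
Proof.
move=> b0 bw.
have w0 : 0 <= w by rewrite -lee_fin -bw integral_ge0// => t _; rewrite lee_fin exprn_ge0.
suff h (c : R) : 0 <= c -> walk l (fun k => (c * b ^+ k)%:E) = (c * w ^+ l)%:E.
  have := h 1 ler01; rewrite mul1r => <-; congr walk.
  by apply/funext => k; rewrite mul1r.
elim: l c => [|l ih] c c0 /=; first by rewrite !expr0.
rewrite exprS mulrA -ih ?mulr_ge0//; congr walk; apply/funext => k.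
under eq_integral do rewrite exprD mulrA EFinM.
rewrite ge0_integralZl_EFin//.
- by rewrite bw -EFinM mulrAC.
- by move=> t _; rewrite lee_fin exprn_ge0.
- exact: (measurable_nat_comp mY (fun y => (b ^+ y)%:E)).
- by rewrite mulr_ge0// exprn_ge0.
Qed.

End random_walk.

Section branching_process.
Context {R : realType} {d : measure_display} {T : measurableType d}
  (P : probability T R).
Variables (X0 : {RV P >-> nat}) (xis : nat -> nat -> {RV P >-> nat})
  (phis : nat -> {RV P >-> control}) (xi : {RV P >-> nat}) (phi : {RV P >-> control})
  (m : R).
Hypothesis model : cbp_model X0 xis phis xi phi m.

Local Notation X := (popX X0 xis phis).
Local Notation N := (popN X0 xis phis).
Local Notation F := (source_sigma X0 xis phis).
Local Notation I := ((unit + nat + nat * nat)%type).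

Lemma measurable_control_level k (B : set nat) :
  measurable ([set g : control | B (g k)]).
Proof. by apply: sub_sigma_algebra; exists k, B. Qed.

Lemma measurable_control_value (psi : {RV P >-> control}) k :
  measurable_fun setT (fun t => psi t k).
Proof.
move=> _ B _; rewrite setTI.
have := measurable_funPT psi measurableT _ (measurable_control_level k B).
by rewrite setTI.
Qed.

Let mF i A : F i A -> measurable A.
Proof.
case: i => [[u|n]|[n j]] /=; rewrite /sigma_of /preimage_set_system => -[B mB <-];
  exact: measurable_funPT.
Qed.

Let indF : mutually_independent P F := cbp_indep model.

Local Notation adapted := (adapted P F).

Let before n : set I := fun i => match i with
  | inl (inl _) => True | inl (inr k) => (k < n)%N | inr (k, _) => (k < n)%N end.

Let inside n l : set I := fun i => before n i \/
  match i with inl (inr k) => k = n | inr (k, j) => k = n /\ (j < l)%N | _ => False end.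

Let S n l t := (\sum_(j < l) xis n j t)%N.

Let mS n l : measurable_fun setT (S n l).
Proof.
elim: l => [|l ih].
  by rewrite (_ : S n 0 = cst 0%N)//; apply/funext => t; rewrite /S big_ord0.
have -> : S n l.+1 = (fun t => S n l t + xis n l t)%N.
  by apply/funext => t; rewrite /S big_ord_recr.
move=> _ B mB; rewrite setTI.
have -> : (fun t => S n l t + xis n l t)%N @^-1` B =
    \bigcup_z ([set t | S n l t = z] `&` (xis n l @^-1` [set y | B (z + y)%N])).
  apply/seteqP; split => [t /= Bt|t [z _ [/= <-]]//]; by exists (S n l t).
apply: bigcupT_measurable => z; apply: measurableI; first exact: measurable_level.
by have := measurable_funPT (xis n l) measurableT _ (_ : measurable [set y | B (z + y)%N]);
  rewrite setTI; apply.
Qed.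

Let F_xis n j z : F (inr (n, j)) [set t | xis n j t = z].
Proof. by exists [set z] => //; rewrite setTI. Qed.

Let F_phis n k l : F (inl (inr n)) [set t | phis n t k = l].
Proof.
exists [set g : control | g k = l]; last by rewrite setTI.
exact: (measurable_control_level k [set l]).
Qed.

Let P_xis n j z : P [set t | xis n j t = z] = P [set t | xi t = z].
Proof. by have := cbp_xi_law model n j (_ : measurable [set z]); apply. Qed.

Let P_phis n k l : P [set t | phis n t k = l] = P [set t | phi t k = l].
Proof. exact: (cbp_phi_law model n (measurable_control_level k [set l])). Qed.

Let inside_S n l : inside n l.+1 = inside n l `|` [set inr (n, l)].
Proof.
apply/seteqP; split => [[[u|k]|[k j]]|[[u|k]|[k j]]] /=.
- by move=> _; left; left.
- by case=> h; left; [left|right].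
- case=> [h|[-> jl]]; first by left; left.
  move: jl; rewrite ltnS leq_eqVlt => /orP[/eqP->|jl]; first by right.
  by left; right.
- by move=> _; left.
- by case=> [[h|h]|//]; [left|right].
- case=> [[h|[-> jl]]|[-> ->]]; [by left|right|right]; split => //.
  by rewrite ltnS ltnW.
Qed.

Let notin_before n j : ~ before n (inl (inr n)) /\ ~ inside n j (inr (n, j)).
Proof. by split => [/=|]; [rewrite ltnn | case=> [/=|[_]]; rewrite ltnn]. Qed.

Let S_adapted n l E x : adapted (inside n 0) E -> adapted (inside n l) (E `&` [set t | S n l t = x]).
Proof.
move=> aE; elim: l x => [|l ih] x.
  have [->|x0] := eqVneq x 0%N.
    have -> : E `&` [set t | S n 0 t = 0%N] = E => //.
    by rewrite setIidl// => t _; rewrite /S/= big_ord0.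
  rewrite (_ : _ `&` _ = set0); first exact: adapted0.
  by apply/seteqP; split => // t [_]; rewrite /S/= big_ord0 => /esym/eqP; rewrite (negbTE x0).
apply: (adapted_levels mF (Z := xis n l)) => z.
have [zx|xz] := leqP z x.
  have -> : E `&` [set t | S n l.+1 t = x] `&` [set t | xis n l t = z] =
      E `&` [set t | S n l t = (x - z)%N] `&` [set t | xis n l t = z].
    apply/seteqP; split => t [[Et /= h] /= hz]; split => //; split => //=.
      by rewrite -h /S big_ord_recr /= hz addnK.
    by rewrite /S big_ord_recr /= -/(S n l t) h hz subnK.
  rewrite inside_S; apply: adaptedI => //; exact: (notin_before n l).2.
rewrite (_ : _ `&` _ = set0); first exact: adapted0.
apply/seteqP; split => // t [[_ /= h] /= hz]; move: xz.
by rewrite -h /S big_ord_recr /= hz ltnNge leq_addl.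
Qed.

Let sub_before n l : inside n l `<=` before n.+1.
Proof.
move=> [[u|k]|[k j]] //= [|]; first exact: ltnW.
- by move=> ->.
- exact: ltnW.
- by case=> ->.
Qed.

Let E_adapted n k l E : adapted (before n) E ->
  adapted (inside n 0) (E `&` [set t | phis n t k = l]).
Proof.
move=> aE; have := adaptedI mF aE (notin_before n 0).1 (@F_phis n k l).
apply: adapted_sub => -[[u|j]|[j i]] /= [|//]; [by left|by left|by case=> ->; right|by left].
Qed.

Let X_adapted n x : adapted (before n) [set t | X n t = x].
Proof.
elim: n x => [|n ih] x.
  have F0 : F (inl (inl tt)) [set t | X0 t = x] by exists [set x] => //; rewrite setTI.
  have := adaptedI mF (adaptedT indF set0) (_ : ~ set0 (inl (inl tt))) F0.
  by rewrite setTI => /(_ id); apply: adapted_sub => i [//|->].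
apply: (adapted_levels mF (Z := X n)) => k; apply: (adapted_levels mF (Z := N n)) => l.
have -> : [set t | X n.+1 t = x] `&` [set t | X n t = k] `&` [set t | N n t = l] =
    ([set t | X n t = k] `&` [set t | phis n t k = l]) `&` [set t | S n l t = x].
  apply/seteqP; split => t [[/= h1 h2] h3]; rewrite /popN /S in h3 *.
    by split => //=; [rewrite -h2 h3 | rewrite -h1 h2; rewrite h2 in h3; rewrite h3].
  by split => //=; [split => //; rewrite h1 h2 | rewrite h1].
by apply: (adapted_sub (@sub_before n l)); apply: S_adapted; exact: E_adapted.
Qed.

Lemma measurable_popX n : measurable_fun setT (X n).
Proof.
move=> _ B _; rewrite setTI (_ : _ @^-1` _ = \bigcup_(k in B) [set t | X n t = k]).
  by apply: bigcup_measurable => k _; case: (X_adapted n k).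
by apply/seteqP; split => [t Bt|t [k Bk /= ->]//]; exists (X n t).
Qed.

Lemma measurable_popN n : measurable_fun setT (N n).
Proof.
move=> _ B _; rewrite setTI.
have -> : N n @^-1` B = \bigcup_k ([set t | X n t = k] `&` [set t | B (phis n t k)]).
  by apply/seteqP; split => [t Bt|t [k _ [/= <-]]//]; exists (X n t).
apply: bigcupT_measurable => k; apply: measurableI; first by case: (X_adapted n k).
by have := measurable_control_value (phis n) k measurableT (_ : measurable B);
  rewrite setTI; apply.
Qed.

Let mxi : measurable_fun setT xi. Proof. exact: measurable_funPT. Qed.

Let walk_sum n l E (g : nat -> \bar R) : adapted (inside n 0) E -> (forall k, 0 <= g k)%E ->
  (\int[P]_(t in E) g (S n l t) = P E * walk P xi l g)%E.
Proof.
move=> aE; elim: l g => [|l ih] g g0 /=.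
  have mE : measurable E by case: aE.
  rewrite muleC -integral_cst//.
  by apply: eq_integral => t _; rewrite /S big_ord0.
have mE : measurable E by case: aE.
have G0 k : (0 <= \int[P]_t g (k + xi t)%N)%E by exact: integral_ge0.
rewrite -ih// (@integral_level _ _ _ P _ _ (fun k => \int[P]_t g (k + xi t)%N)%E mE (mS n l))//.
rewrite (integral_level_sum P mE (mS n l))//; last first.
  by apply: measurable_funTS; apply: measurable_nat_comp; exact: mS.
apply: eq_eseriesr => y _.
have aEy := S_adapted l y aE; have [mEy _] := aEy.
transitivity (\int[P]_(t in E `&` [set t | S n l t = y]) g (y + xis n l t)%N)%E.
  by apply: eq_integral => t; rewrite inE => -[_ /= <-]; rewrite /S big_ord_recr.
rewrite (@integral_level _ _ _ P _ _ (fun z => g (y + z)%N) mEy)//.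
rewrite (@integral_level _ _ _ P _ _ (fun z => g (y + z)%N) measurableT mxi)//.
have PEf : P (E `&` [set t | S n l t = y]) \is a fin_num by exact: fin_num_measure.
rewrite muleC -(fineK PEf) -nneseriesZl//; last by move=> z _; rewrite mule_ge0.
apply: eq_eseriesr => z _; rewrite (adapted_prod aEy (notin_before n l).2 (F_xis n l z)).
by rewrite fineK// setTI P_xis muleCA.
Qed.

(* Conditioning on generation [n]: first on [X_n], then on the value of the control, and
   then on the sum of the offspring. *)
Lemma integral_step n (g : nat -> nat -> nat -> \bar R) : (forall k l x, 0 <= g k l x)%E ->
  (\int[P]_t g (X n t) (N n t) (X n.+1 t) =
   \int[P]_t (\int[P]_s walk P xi (phi s (X n t)) (g (X n t) (phi s (X n t)))))%E.
Proof.
move=> g0; have mX := measurable_popX n; have mN := measurable_popN n.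
have mX' := measurable_popX n.+1.
have W0 k l : (0 <= walk P xi l (g k l))%E by exact: walk_ge0.
rewrite (@integral_level _ _ _ P _ _ (fun k => \int[P]_s walk P xi (phi s k) (g k (phi s k)))%E
  measurableT mX); last by move=> k; exact: integral_ge0.
have mg : measurable_fun setT (fun t => g (X n t) (N n t) (X n.+1 t)).
  move=> _ B mB; rewrite setTI.
  have -> : (fun t => g (X n t) (N n t) (X n.+1 t)) @^-1` B =
      \bigcup_k \bigcup_l \bigcup_x ([set t | B (g k l x)] `&` ([set t | X n t = k] `&`
        ([set t | N n t = l] `&` [set t | X n.+1 t = x]))).
    apply/seteqP; split => [t Bt|t [k _ [l _ [x _ [Bt [hk [hl hx]]]]]]]; last first.
      by move: hk hl hx => /= -> -> ->.
    by exists (X n t) => //; exists (N n t) => //; exists (X n.+1 t).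
  apply: bigcupT_measurable => k; apply: bigcupT_measurable => l.
  apply: bigcupT_measurable => x; apply: measurableI.
    have [h|h] := pselect (B (g k l x)).
      by rewrite (_ : [set _ | _] = setT)//; apply/seteqP; split.
    by rewrite (_ : [set _ | _] = set0)//; apply/seteqP; split.
  by do ?apply: measurableI; exact: measurable_level.
rewrite (integral_level_sum P measurableT mX)//; apply: eq_eseriesr => k _; rewrite setTI.
have mk : measurable [set t | X n t = k] by exact: measurable_level.
rewrite (integral_level_sum P mk mN)//; last exact: measurable_funTS.
have mphi := measurable_control_value phi k.
rewrite (@integral_level _ _ _ P _ _ (fun l => walk P xi l (g k l)) measurableT mphi)//.
have Pf : P [set t | X n t = k] \is a fin_num by exact: fin_num_measure.
rewrite muleC -(fineK Pf) -nneseriesZl//; last by move=> z _; rewrite mule_ge0.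
apply: eq_eseriesr => l _; rewrite fineK// setTI.
have aE := @E_adapted n k l _ (X_adapted n k).
have eE : [set t | X n t = k] `&` [set t | N n t = l] =
    [set t | X n t = k] `&` [set t | phis n t k = l].
  by apply/seteqP; split => t [/= h1 h2]; split => //; move: h2; rewrite /popN /= h1.
rewrite eE; transitivity (\int[P]_(t in [set t | X n t = k] `&` [set t | phis n t k = l])
    g k l (S n l t))%E.
  apply: eq_integral => t; rewrite inE => -[/= h1 h2].
  by rewrite /popN /S h1 h2.
rewrite walk_sum// (adapted_prod (X_adapted n k) (notin_before n 0).1 (@F_phis n k l)) P_phis.
by rewrite -muleA [(P [set t | phi t k = l] * _)%E]muleC.
Qed.

End branching_process.

Section generating_function_recursion.
Context {R : realType} {d : measure_display} {T : measurableType d}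
  (P : probability T R).
Variables (X0 : {RV P >-> nat}) (xis : nat -> nat -> {RV P >-> nat})
  (phis : nat -> {RV P >-> control}) (xi : {RV P >-> nat}) (phi : {RV P >-> control})
  (m : R).
Hypothesis model : cbp_model X0 xis phis xi phi m.

Local Notation X := (popX X0 xis phis).
Local Notation N := (popN X0 xis phis).
Local Notation f := (pgf P xi).
Local Notation h := (fun k => pgf P (fun t => phi t k)).

Let mxi : measurable_fun setT xi. Proof. exact: measurable_funPT. Qed.
Let mphi k : measurable_fun setT (fun t => phi t k).
Proof. exact: measurable_control_value. Qed.
Let mX := measurable_popX model.
Let mN := measurable_popN model.

Let h01 k s : 0 <= s <= 1 -> 0 <= h k s <= 1.
Proof. by move=> s01; rewrite pgf_ge0 ?pgf_le1//; case/andP: s01. Qed.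

Let nbounded_h s : 0 <= s <= 1 -> nbounded (fun k => h k s).
Proof. by move=> s01; exists 1 => k; rewrite ger0_norm; case/andP: (h01 k s01). Qed.

Let EFin_pgf (Y : T -> nat) s : measurable_fun setT Y -> 0 <= s <= 1 ->
  (pgf P Y s)%:E = (\int[P]_t (s ^+ Y t)%:E)%E.
Proof.
move=> mY /andP[s0 s1]; apply: (@EFin_nexp _ _ _ P Y mY (fun k => s ^+ k)).
by apply: nbounded_exp; rewrite ger0_norm.
Qed.

Lemma pgf_popN n s : 0 <= s <= 1 -> pgf P (N n) s = nexp P (X n) (fun k => h k s).
Proof.
move=> s01; have /andP[s0 s1] := s01; apply: EFin_inj.
rewrite EFin_pgf// EFin_nexp//; last exact: nbounded_h.
rewrite (integral_step model n (g := fun _ l _ => (s ^+ l)%:E)); last first.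
  by move=> *; rewrite lee_fin exprn_ge0.
apply: eq_integral => t _; rewrite EFin_pgf//.
by apply: eq_integral => t' _; rewrite walk_cst.
Qed.

Lemma pgf_popXS n s : 0 <= s <= 1 -> pgf P (X n.+1) s = pgf P (N n) (f s).
Proof.
move=> s01; have /andP[s0 s1] := s01.
have fs01 : 0 <= f s <= 1 by rewrite pgf_ge0// pgf_le1.
rewrite pgf_popN//; apply: EFin_inj.
rewrite EFin_pgf// EFin_nexp//; last exact: nbounded_h.
rewrite (integral_step model n (g := fun _ _ x => (s ^+ x)%:E)); last first.
  by move=> *; rewrite lee_fin exprn_ge0.
apply: eq_integral => t _; rewrite EFin_pgf//.
by apply: eq_integral => t' _; rewrite (@walk_exp _ _ _ P xi mxi _ s (f s))// EFin_pgf.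
Qed.

Variables (tau : R) (lL lU dL dU : probability nat R).
Hypothesis ad0 : AD0 h tau lL lU dL dU.

Let mid : measurable_fun setT (id : nat -> nat). Proof. by []. Qed.

Let pgfZ (l : probability nat R) c n s : 0 <= s <= 1 ->
  nbounded (fun k => c * pgf l id s ^+ k) /\
  nexp P (X n) (fun k => c * pgf l id s ^+ k) = c * pgf P (X n) (pgf l id s).
Proof.
move=> /andP[s0 s1].
have b : nbounded (fun k => pgf l id s ^+ k).
  by apply: nbounded_exp; rewrite ger0_norm ?pgf_le1 ?pgf_ge0// s0.
by split; [exact: nboundedZ | rewrite nexpZ].
Qed.

Lemma pgf_popN_le n s : 0 <= s <= 1 ->
  pgf P (N n) s <= pgf dU id s * pgf P (X n) (pgf lU id s).
Proof.
move=> s01; have [b <-] := pgfZ lU (pgf dU id s) n s01; rewrite pgf_popN//.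
apply: nexp_le => //; first exact: nbounded_h.
by move=> k; apply: (AD0_upper ad0).
Qed.

Lemma pgf_popN_ge n s : 0 <= s <= 1 ->
  pgf dL id s * pgf P (X n) (pgf lL id s) <= pgf P (N n) s.
Proof.
move=> s01; have [b <-] := pgfZ lL (pgf dL id s) n s01; rewrite pgf_popN//.
apply: nexp_le => //; first exact: nbounded_h.
by move=> k; apply: (AD0_lower ad0).
Qed.

Let f01 s : 0 <= s <= 1 -> 0 <= f s <= 1.
Proof. by move=> /andP[s0 s1]; rewrite pgf_ge0// pgf_le1// s0. Qed.

Lemma pgf_popX_le_env (mu eta : probability nat R) :
  (forall s, 0 <= s <= 1 -> pgf mu id s = pgf lU id (f s)) ->
  (forall s, 0 <= s <= 1 -> pgf eta id s = pgf dU id (f s)) ->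
  forall n s, 0 <= s <= 1 -> pgf P (X n) s <= env P X0 mu eta n s.
Proof.
move=> hmu heta; elim=> [//|n ih] s s01; rewrite pgf_popXS//=.
apply: le_trans (pgf_popN_le n (f01 s01)) _; rewrite -hmu// -heta//.
have /andP[s0 s1] := s01.
by rewrite ler_wpM2l ?pgf_ge0// ih// pgf_ge0 ?pgf_le1.
Qed.

Lemma env_le_pgf_popX (mu eta : probability nat R) :
  (forall s, 0 <= s <= 1 -> pgf mu id s = pgf lL id (f s)) ->
  (forall s, 0 <= s <= 1 -> pgf eta id s = pgf dL id (f s)) ->
  forall n s, 0 <= s <= 1 -> env P X0 mu eta n s <= pgf P (X n) s.
Proof.
move=> hmu heta; elim=> [//|n ih] s s01; rewrite pgf_popXS//=.
apply: le_trans (pgf_popN_ge n (f01 s01)); rewrite -hmu// -heta//.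
have /andP[s0 s1] := s01.
by rewrite ler_wpM2l ?pgf_ge0// ih// pgf_ge0 ?pgf_le1.
Qed.

End generating_function_recursion.

Section ratio_deviations.
Context {R : realType} {d : measure_display} {T : measurableType d}
  (P : probability T R).
Variables (X0 : {RV P >-> nat}) (xis : nat -> nat -> {RV P >-> nat})
  (phis : nat -> {RV P >-> control}) (xi : {RV P >-> nat}) (phi : {RV P >-> control})
  (m : R).
Hypothesis model : cbp_model X0 xis phis xi phi m.

Local Notation X := (popX X0 xis phis).
Local Notation N := (popN X0 xis phis).

Let mX := measurable_popX model.
Let mN := measurable_popN model.

Definition off_ratio c eps (l x : nat) : bool := eps < `|(x%:R / l%:R - c : R)|.

Let measurable_pair (Y Z : T -> nat) (A : nat -> nat -> Prop) :
  measurable_fun setT Y -> measurable_fun setT Z -> measurable [set t | A (Y t) (Z t)].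
Proof.
move=> mY mZ.
have -> : [set t | A (Y t) (Z t)] =
    \bigcup_y ([set t | Y t = y] `&` (Z @^-1` [set z | A y z])).
  by apply/seteqP; split => [t At|t [y _ [/= <-]]//]; exists (Y t).
apply: bigcupT_measurable => y; apply: measurableI; first exact: measurable_level.
by have := mZ measurableT [set z | A y z] I; rewrite setTI.
Qed.

Let ratio_deviationE (V D : T -> nat) c eps : measurable_fun setT V -> measurable_fun setT D ->
  ratio_deviation P V D c eps =
  (\int[P]_t ((0 < D t)%N && off_ratio c eps (D t) (V t))%:R%:E)%E.
Proof.
move=> mV mD; rewrite /ratio_deviation -[in LHS](setIT [set _ | _]).
rewrite -integral_indic//; last first.
  exact: (@measurable_pair D V (fun y z => (0 < y)%N /\ eps < `|z%:R / y%:R - c|)).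
apply: eq_integral => t _; congr (_%:E); rewrite indicE; congr ((nat_of_bool _)%:R).
apply/idP/idP; first by rewrite inE => -[-> h]; apply: h.
by rewrite inE => /andP[].
Qed.

Lemma deviation1_le eps n (w : nat -> R) : (forall l, 0 <= w l) ->
  (forall l, (0 < l)%N ->
    (walk P xi l (fun x => (off_ratio m eps l x)%:R%:E) <= (w l)%:E)%E) ->
  (ratio_deviation P (X n.+1) (N n) m eps <=
   \int[P]_t (if (0 < N n t)%N then w (N n t) else 0)%:E)%E.
Proof.
move=> w0 hw; rewrite ratio_deviationE//.
have wc0 l : 0 <= (if (0 < l)%N then w l else 0) by case: ifP.
rewrite (integral_step model n (g := fun _ l x => ((0 < l)%N && off_ratio m eps l x)%:R%:E)); last first.
  by move=> *; rewrite lee_fin.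
rewrite (integral_step model n (g := fun _ l _ => (if (0 < l)%N then w l else 0)%:E)); last first.
  by move=> *; rewrite lee_fin.
have mphi k : measurable_fun setT (fun t => phi t k) by exact: measurable_control_value.
apply: (@integral_level_le _ _ _ P (X n)
  (fun k => \int[P]_s walk P xi (phi s k) (fun x => ((0 < phi s k)%N && off_ratio m eps (phi s k) x)%:R%:E))%E
  (fun k => \int[P]_s walk P xi (phi s k) (fun=> (if (0 < phi s k)%N then w (phi s k) else 0)%:E))%E) => //.
- by move=> k; apply: integral_ge0 => s _; apply: walk_ge0.
- move=> k; apply: (@integral_level_le _ _ _ P (fun s => phi s k)
  (fun l => walk P xi l (fun x => ((0 < l)%N && off_ratio m eps l x)%:R%:E))
  (fun l => walk P xi l (fun=> (if (0 < l)%N then w l else 0)%:E))) => //.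
  + by move=> l; apply: walk_ge0.
  + move=> l; rewrite walk_cst; case: ifP => l0; first exact: hw.
    by rewrite walk_cst.
Qed.

Lemma deviation2_le tau eps n (w : nat -> R) : (forall k, 0 <= w k) ->
  (forall k, (0 < k)%N ->
    (\int[P]_t (off_ratio tau eps k (phi t k))%:R%:E <= (w k)%:E)%E) ->
  (ratio_deviation P (N n) (X n) tau eps <=
   \int[P]_t (if (0 < X n t)%N then w (X n t) else 0)%:E)%E.
Proof.
move=> w0 hw; rewrite ratio_deviationE//.
have wc0 l : 0 <= (if (0 < l)%N then w l else 0) by case: ifP.
rewrite (integral_step model n (g := fun k l _ => ((0 < k)%N && off_ratio tau eps k l)%:R%:E)); last first.
  by move=> *; rewrite lee_fin.
have mphi k : measurable_fun setT (fun t => phi t k) by exact: measurable_control_value.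
apply: (@integral_level_le _ _ _ P (X n)
  (fun k => \int[P]_s walk P xi (phi s k) (fun=> ((0 < k)%N && off_ratio tau eps k (phi s k))%:R%:E))%E
  (fun k => (if (0 < k)%N then w k else 0)%:E)) => //.
- by move=> k; apply: integral_ge0 => s _; apply: walk_ge0.
- move=> k; under eq_integral do rewrite walk_cst.
  by case: ifP => k0; [exact: hw | rewrite integral0].
Qed.

Lemma deviation3_le tau eps n : 0 < m -> 0 < tau -> 0 < eps ->
  (ratio_deviation P (X n.+1) (X n) (m * tau) eps <=
   ratio_deviation P (X n.+1) (N n) m (eps / (2 * (tau + eps / (2 * m)))) +
   ratio_deviation P (N n) (X n) tau (eps / (2 * m)))%E.
Proof.
move=> m0 tau0 eps0; have e2 : 0 < eps / (2 * m) by rewrite divr_gt0// mulr_gt0.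
set c := tau + eps / (2 * m); have c0 : 0 < c by rewrite addr_gt0.
rewrite /ratio_deviation.
set A1 := [set t | (0 < N n t)%N /\ _]; set A2 := [set t | _ /\ eps / (2 * m) < _].
have mA1 : measurable A1.
  exact: (@measurable_pair (N n) (X n.+1) (fun y z => (0 < y)%N /\ eps / (2 * c) < `|z%:R / y%:R - m|)).
have mA2 : measurable A2.
  exact: (@measurable_pair (X n) (N n) (fun y z => (0 < y)%N /\ eps / (2 * m) < `|z%:R / y%:R - tau|)).
apply: le_trans (measureU2 P mA1 mA2); apply: le_measure; rewrite ?inE.
- exact: (@measurable_pair (X n) (X n.+1) (fun y z => (0 < y)%N /\ eps < `|z%:R / y%:R - m * tau|)).
- exact: measurableU.
move=> t [k0 hX]; have [hN|hN] := ltP (eps / (2 * m)) `|(N n t)%:R / (X n t)%:R - tau|; first by right.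
left; rewrite /A1 /=; move: hX hN.
have -> : X n.+1 t = (\sum_(j < N n t) xis n j t)%N by [].
set l := N n t; set k := X n t in k0 *; set x := (\sum_(j < l) _)%N => hX hN.
have kp : 0 < k%:R :> R by rewrite ltr0n.
have hl : `|l%:R - tau * k%:R| <= eps / (2 * m) * k%:R.
  have -> : l%:R - tau * k%:R = (l%:R / k%:R - tau) * k%:R by field; rewrite lt0r_neq0.
  by rewrite normrM (ger0_norm (ltW kp)) ler_pM2r.
have hx : eps * k%:R < `|x%:R - m * tau * k%:R|.
  have -> : x%:R - m * tau * k%:R = (x%:R / k%:R - m * tau) * k%:R by field; rewrite lt0r_neq0.
  by rewrite normrM (ger0_norm (ltW kp)) ltr_pM2r.
have hxl : eps / 2 * k%:R < `|x%:R - m * l%:R|.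
  have : `|x%:R - m * tau * k%:R| <= `|x%:R - m * l%:R| + m * `|l%:R - tau * k%:R|.
    rewrite -(ger0_norm (ltW m0)) -normrM (ger0_norm (ltW m0)).
    apply: le_trans (ler_normD _ _); rewrite le_eqVlt; apply/orP; left; apply/eqP.
    by congr `|_|; ring.
  have := ler_wpM2l (ltW m0) hl.
  have -> : m * (eps / (2 * m) * k%:R) = eps / 2 * k%:R by field; rewrite lt0r_neq0.
  by rewrite mulrAC; lra.
have lck : l%:R <= c * k%:R :> R.
  by have := le_trans (ler_norm _) hl; rewrite /c mulrDl; lra.
have l0 : (0 < l)%N.
  rewrite lt0n; apply/eqP => l0; move: hxl; rewrite /x l0 big_ord0 mulr0 subrr normr0.
  by rewrite ltNge mulr_ge0// ltW// divr_gt0.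
split => //; have lp : 0 < l%:R :> R by rewrite ltr0n.
have -> : x%:R / l%:R - m = (x%:R - m * l%:R) / l%:R by field; rewrite lt0r_neq0.
rewrite normrM normfV (ger0_norm (ltW lp)) ltr_pdivlMr//.
apply: le_lt_trans hxl.
have -> : eps / (2 * c) * l%:R = (eps / 2) * (l%:R / c) by field; rewrite lt0r_neq0.
apply: ler_wpM2l; first by rewrite divr_ge0// ltW.
by rewrite ler_pdivrMr// mulrC.
Qed.

End ratio_deviations.

(** * Conditional deviation probabilities *)

Section moment_bounds.
Context {R : realType} {d : measure_display} {T : measurableType d}
  (P : probability T R).
Implicit Types (c eps p q : R).

Lemma integral_affine (V1 V2 : T -> R) (A L D v1 v2 : R) :
  P.-integrable setT (EFin \o V1) -> P.-integrable setT (EFin \o V2) ->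
  (\int[P]_t (V1 t)%:E = v1%:E)%E -> (\int[P]_t (V2 t)%:E = v2%:E)%E ->
  (\int[P]_t (A + L * V1 t + D * V2 t)%:E)%E = (A + L * v1 + D * v2)%:E.
Proof.
move=> i1 i2 e1 e2.
have j1 : P.-integrable setT (fun t => L%:E * (V1 t)%:E)%E by exact: integrableZl.
have j2 : P.-integrable setT (fun t => D%:E * (V2 t)%:E)%E by exact: integrableZl.
have j0 : P.-integrable setT (fun=> A%:E).
  exact: (@finite_measure_integrable_cst _ _ _ P setT A).
under eq_integral do rewrite 2!EFinD 2!EFinM.
rewrite integralD//; last exact: integrableD.
rewrite integralD// !integralZl// e1 e2 integral_cst//= probability_setT mule1.
by rewrite -?EFinM -?EFinD.
Qed.

Lemma ge0_integrable (V : T -> R) : measurable_fun setT (fun t => (V t)%:E) ->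
  (forall t, 0 <= V t) -> (\int[P]_t (V t)%:E < +oo)%E -> P.-integrable setT (EFin \o V).
Proof.
move=> mV V0 Vfin; apply/integrableP; split => //.
by under eq_integral do rewrite /= ger0_norm//.
Qed.

Variable Y : T -> nat.
Hypothesis mY : measurable_fun setT Y.
Variable m : R.
Hypothesis meanY : (\int[P]_t (Y t)%:R%:E = m%:E)%E.

Let mgY (g : nat -> R) : measurable_fun setT (fun t => (g (Y t))%:E).
Proof. exact: (measurable_nat_comp mY (fun k => (g k)%:E)). Qed.

Let iY : P.-integrable setT (EFin \o (fun t => (Y t)%:R : R)).
Proof.
by apply: ge0_integrable => //; rewrite meanY ltry.
Qed.

Section power.
Variable p : R.
Hypothesis p2 : 2 <= p.
Hypothesis finp : (\int[P]_t (`|(Y t)%:R - m| `^ p)%:E < +oo)%E.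

Let W : R := fine (\int[P]_t (`|(Y t)%:R - m| `^ p)%:E)%E.

Let WE : (\int[P]_t (`|(Y t)%:R - m| `^ p)%:E)%E = W%:E.
Proof.
rewrite /W fineK// ge0_fin_numE//; apply: integral_ge0 => t _.
by rewrite lee_fin powR_ge0.
Qed.

Let W0 : 0 <= W.
Proof. by rewrite fine_ge0// integral_ge0// => t _; rewrite lee_fin powR_ge0. Qed.

Lemma power_step : exists2 C, 0 <= C & forall x,
  (\int[P]_t (`|x + ((Y t)%:R - m)| `^ p)%:E <= (`|x| `^ p + C * (`|x| `^ (p - 2) + 1))%:E)%E.
Proof.
have [C0 C00 hC] := powR_taylor p2; exists (C0 * (1 + W)) => [|x].
  by rewrite mulr_ge0// addr_ge0.
have [L hL] := hC x; pose D := C0 * (`|x| `^ (p - 2) + 1).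
have D0 : 0 <= D by rewrite mulr_ge0// addr_ge0 ?powR_ge0.
have -> : `|x| `^ p + C0 * (1 + W) * (`|x| `^ (p - 2) + 1) =
    (`|x| `^ p - L * m + D) + L * m + D * W by rewrite /D; ring.
have iV : P.-integrable setT (EFin \o (fun t => `|(Y t)%:R - m| `^ p)).
  by apply: ge0_integrable => //; exact: (mgY (fun k => `|k%:R - m| `^ p)).
rewrite -(integral_affine _ _ _ iY iV meanY WE).
apply: ge0_le_integral => //.
- exact: (mgY (fun k => `|x + (k%:R - m)| `^ p)).
- exact: (mgY (fun k => `|x| `^ p - L * m + D + L * k%:R + D * `|k%:R - m| `^ p)).
move=> t _; rewrite lee_fin; apply: le_trans (hL _) _.
set z := (Y t)%:R - m.
have -> : `|x| `^ p - L * m + D + L * (Y t)%:R + D * `|z| `^ p =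
   `|x| `^ p + L * z + D * (1 + `|z| `^ p) by rewrite /z; ring.
rewrite lerD2l /D -mulrA ler_wpM2l//.
have zp := powR_ge0 `|z| p; have xp := powR_ge0 `|x| (p - 2).
have z2 : z ^+ 2 <= 1 + `|z| `^ p.
  rewrite -real_normK ?num_real//; have [z1|z1] := leP `|z| 1.
    by have := exprn_ile1 2 (normr_ge0 z) z1; lra.
  have : `|z| `^ 2%:R <= `|z| `^ p by apply: ler_powR => //; exact: ltW.
  by rewrite powR_mulrn//; lra.
by have := ler_wpM2l xp z2; lra.
Qed.

(* Marcinkiewicz-Zygmund for the walk, by induction on its length. *)
Lemma walk_power_moment : exists2 K, 0 < K & forall l, (0 < l)%N ->
  (walk P Y l (fun x => (`|x%:R - l%:R * m| `^ p)%:E) <= ((K * l%:R) `^ (p / 2))%:E)%E.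
Proof.
have [C C0 hC] := power_step.
have [K [K1 WK CK]] : exists K, [/\ 1 <= K, W <= K & 3 * C <= K].
  by exists (1 + W + 3 * C); move: W0 => /=; split; lra.
have K0 : 0 < K by lra.
have q1 : 1 <= p / 2 by have := p2; lra.
exists K => // -[//|l] _; elim: l => [|l ih].
  rewrite /= mulr1; under eq_integral do rewrite add0n mul1r.
  by rewrite WE lee_fin; apply: le_trans (le1r_powR K1 q1).
move: ih; set l1 := l.+1 => ih; pose S := K * l1%:R.
have S1 : 1 <= S by rewrite /S; have := ler_pM ler01 ler01 K1 (_ : 1 <= l1%:R); rewrite mulr1 ler1n; apply.
have S0 : 0 < S by lra.
have -> : K * l1.+1%:R = S + K by rewrite /S -natr1; ring.
have Sp := powR_ge0 S (p / 2 - 1).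
have CS : 0 <= C / S by rewrite divr_ge0// ltW.
have e0 : 0 <= C * S `^ (p / 2 - 1) + C by rewrite addr_ge0// mulr_ge0.
apply: (@le_trans _ _ (walk P Y l1 (fun x => (1 + C / S)%:E * (`|x%:R - l1%:R * m| `^ p)%:E +
   (C * S `^ (p / 2 - 1) + C)%:E))%E).
  apply: (@walk_le _ _ _ P Y mY l1) => k.
    by apply: integral_ge0 => t _; rewrite lee_fin powR_ge0.
  under eq_integral.
    move=> t _; have -> : (k + Y t)%:R - l1.+1%:R * m = (k%:R - l1%:R * m) + ((Y t)%:R - m).
      by rewrite natrD -natr1; ring.
    over.
  apply: le_trans (hC _) _; rewrite -EFinM -EFinD lee_fin.
  have := ler_wpM2l C0 (powR_interpolate p2 (normr_ge0 (k%:R - l1%:R * m)) S0).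
  lra.
rewrite walk_affine//; last by rewrite addr_ge0.
apply: le_trans (_ : ((1 + C / S) * S `^ (p / 2) + C * S `^ (p / 2 - 1) + C)%:E <= _)%E; last first.
  by rewrite lee_fin moment_growth_step.
have -> : ((1 + C / S) * S `^ (p / 2) + C * S `^ (p / 2 - 1) + C)%:E =
    ((1 + C / S)%:E * (S `^ (p / 2))%:E + (C * S `^ (p / 2 - 1) + C)%:E)%E.
  by rewrite -EFinM -EFinD addrA.
by apply: leeD2r; apply: lee_wpmul2l; rewrite // lee_fin addr_ge0.
Qed.

Lemma off_ratio_power c eps l x : (0 < l)%N -> 0 < eps ->
  (off_ratio c eps l x)%:R <= (eps * l%:R) `^ (- p) * `|x%:R - l%:R * c| `^ p :> R.
Proof.
move=> l0 e0; have lp : 0 < l%:R :> R by rewrite ltr0n.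
have rhs0 : 0 <= (eps * l%:R) `^ (- p) * `|x%:R - l%:R * c| `^ p.
  by rewrite mulr_ge0// powR_ge0.
rewrite /off_ratio; case: (ltP eps) => h //; rewrite powRN mulrC ler_pdivlMr ?powR_gt0 ?mulr_gt0//.
rewrite mul1r; apply: ge0_ler_powR; rewrite ?nnegrE ?mulr_ge0 ?(ltW lp) ?(ltW e0)//; first by have := p2; lra.
have -> : x%:R - l%:R * c = (x%:R / l%:R - c) * l%:R by field; rewrite lt0r_neq0.
by rewrite normrM (ger0_norm (ltW lp)) ler_wpM2r ?(ltW lp) ?(ltW h).
Qed.

Lemma power_ratio eps K l : (0 < l)%N -> 0 < eps -> 0 < K ->
  (eps * l%:R) `^ (- p) * (K * l%:R) `^ (p / 2) = eps `^ (- p) * K `^ (p / 2) * l%:R `^ (- (p / 2)).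
Proof.
move=> l0 e0 K0; have lp : 0 < l%:R :> R by rewrite ltr0n.
rewrite !powRM ?(ltW e0) ?(ltW lp) ?(ltW K0)//.
have -> : l%:R `^ (- (p / 2)) = l%:R `^ (- p) * l%:R `^ (p / 2).
  rewrite -powRD; first by congr (_ `^ _); field.
  by rewrite lt0r_neq0// implybT.
ring.
Qed.

Lemma walk_off_power eps : 0 < eps -> exists2 C, 0 <= C & forall l, (0 < l)%N ->
  (walk P Y l (fun x => (off_ratio m eps l x)%:R%:E) <= (C * l%:R `^ (- (p / 2)))%:E)%E.
Proof.
move=> e0; have [K K0 hK] := walk_power_moment.
exists (eps `^ (- p) * K `^ (p / 2)) => [|l l0]; first by rewrite mulr_ge0 ?powR_ge0.
rewrite -power_ratio//.
apply: (@le_trans _ _ (walk P Y l (fun x => ((eps * l%:R) `^ (- p))%:E *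
    (`|x%:R - l%:R * m| `^ p)%:E + 0%:E))%E).
  apply: (@walk_le _ _ _ P Y mY l) => k; first by rewrite lee_fin.
  by rewrite adde0 -EFinM lee_fin; exact: off_ratio_power.
rewrite walk_affine ?powR_ge0//.
by rewrite adde0 EFinM lee_wpmul2l ?lee_fin ?powR_ge0// hK.
Qed.

End power.
End moment_bounds.

Section exponential_bounds.
Context {R : realType} {d : measure_display} {T : measurableType d}
  (P : probability T R).
Implicit Types (c eps eta : R).

Lemma expR_taylor1 (z : R) : expR z <= 1 + z + z ^+ 2 * expR `|z|.
Proof.
have h1 : expR z - 1 <= z * expR z.
  have := ler_wpM2l (expR_ge0 z) (expR_ge1Dx (- z)).
  by rewrite -expRD subrr expR0; lra.
have [z0|z0] := leP 0 z.
  by rewrite ger0_norm//; have := ler_wpM2l z0 h1; rewrite expr2; lra.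
have h2 : 1 <= expR `|z| by rewrite -expR0 ler_expR.
have h3 : z * (expR z - 1) <= z ^+ 2.
  by rewrite expr2; have := expR_ge1Dx z; nra.
have h4 : expR z - 1 - z <= z * (expR z - 1) by lra.
by have := ler_wpM2l (sqr_ge0 z) h2; lra.
Qed.

Lemma off_ratio_exp c eps eta (l x : nat) : (0 < l)%N -> 0 < eta ->
  (off_ratio c eps l x)%:R <=
  expR (eta * x%:R) * expR (- (eta * (c + eps))) ^+ l +
  expR (- eta * x%:R) * expR (eta * (c - eps)) ^+ l :> R.
Proof.
move=> l0 e0; have lp : 0 < l%:R :> R by rewrite ltr0n.
rewrite -!expRM_natr -!expRD.
set u := _ + _ * l%:R; set v := _ + eta * (c - eps) * l%:R.
have u0 := expR_ge0 u; have v0 := expR_ge0 v.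
rewrite /off_ratio; case: (ltP eps) => h; last by rewrite addr_ge0.
suff [h1|h1] : 0 <= u \/ 0 <= v.
- by have : expR 0 <= expR u by [rewrite ler_expR]; rewrite expR0 => ?; rewrite -[1%:R]addr0 lerD.
- by have : expR 0 <= expR v by [rewrite ler_expR]; rewrite expR0 => ?; rewrite -[1%:R]add0r lerD.
have uE : u = eta * l%:R * ((x%:R / l%:R - c) - eps) by rewrite /u; field; rewrite lt0r_neq0.
have vE : v = eta * l%:R * (- (x%:R / l%:R - c) - eps) by rewrite /v; field; rewrite lt0r_neq0.
rewrite uE vE; have el : 0 <= eta * l%:R by rewrite mulr_ge0 ?ltW.
have [z0|z0] := leP 0 (x%:R / l%:R - c).
  by left; rewrite mulr_ge0// subr_ge0 ltW//; rewrite ger0_norm in h.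
by right; rewrite mulr_ge0// subr_ge0 ltW//; rewrite ltr0_norm in h.
Qed.

Section offspring.
Variable Y : T -> nat.
Hypothesis mY : measurable_fun setT Y.
Variable m : R.
Hypothesis meanY : (\int[P]_t (Y t)%:R%:E = m%:E)%E.

Lemma mgf_le eta0 : 0 < eta0 -> (\int[P]_t (expR (eta0 * (Y t)%:R))%:E < +oo)%E ->
  exists2 K, 0 <= K & forall eta, `|eta| <= eta0 / 2 ->
  (\int[P]_t (expR (eta * (Y t)%:R))%:E <= (1 + eta * m + eta ^+ 2 * K)%:E)%E.
Proof.
move=> e0 fin; pose M := fine (\int[P]_t (expR (eta0 * (Y t)%:R))%:E)%E.
have I0 : (0 <= \int[P]_t (expR (eta0 * (Y t)%:R))%:E)%E.
  by apply: integral_ge0 => t _; rewrite lee_fin expR_ge0.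
have ME : (\int[P]_t (expR (eta0 * (Y t)%:R))%:E)%E = M%:E.
  by rewrite /M fineK// ge0_fin_numE.
have M0 : 0 <= M by rewrite fine_ge0.
exists (8 / eta0 ^+ 2 * M) => [|eta he].
  by rewrite mulr_ge0// divr_ge0// sqr_ge0.
have mgY (g : nat -> R) : measurable_fun setT (fun t => (g (Y t))%:E).
  exact: (measurable_nat_comp mY (fun k => (g k)%:E)).
have iY : P.-integrable setT (EFin \o (fun t => (Y t)%:R : R)).
  by apply: ge0_integrable => //; rewrite meanY ltry.
have iE : P.-integrable setT (EFin \o (fun t => expR (eta0 * (Y t)%:R))).
  apply: ge0_integrable => //; first [exact: (mgY (fun k => expR (eta0 * k%:R))) | move=> t; exact: expR_ge0].
rewrite mulrA -(integral_affine _ _ _ iY iE meanY ME).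
apply: ge0_le_integral => //.
- exact: (mgY (fun k => expR (eta * k%:R))).
- exact: (mgY (fun k => 1 + eta * k%:R + eta ^+ 2 * (8 / eta0 ^+ 2) * expR (eta0 * k%:R))).
move=> t _; rewrite lee_fin; apply: le_trans (expR_taylor1 _) _.
rewrite lerD2l exprMn -[leLHS]mulrA -[leRHS]mulrA; apply: ler_wpM2l; first exact: sqr_ge0.
rewrite normrM normr_nat.
set x := (Y t)%:R; have x0 : 0 <= x :> R by rewrite /x.
have h1 : expR (`|eta| * x) <= expR (eta0 * x / 2).
  by rewrite ler_expR; have := ler_wpM2r x0 he; lra.
have h2 : x ^+ 2 <= 8 / eta0 ^+ 2 * expR (eta0 * x / 2).
  have := @expR_ge1Dxn _ (eta0 * x / 2) 1 _.
  rewrite divr_ge0 ?mulr_ge0 ?(ltW e0)// => /(_ isT) h.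
  have -> : x ^+ 2 = 8 / eta0 ^+ 2 * ((eta0 * x / 2) ^+ 2 / 2).
    by field; rewrite lt0r_neq0.
  rewrite ler_wpM2l ?divr_ge0 ?sqr_ge0//.
  by move: h; rewrite (_ : 2`!%:R = 2)//; lra.
have -> : expR (eta0 * x) = expR (eta0 * x / 2) * expR (eta0 * x / 2).
  by rewrite -expRD; congr expR; field.
by rewrite !mulrA; apply: ler_pM; rewrite ?sqr_ge0 ?expR_ge0.
Qed.

Lemma walk_off_exp eps : 0 < eps ->
  (\forall eta \near (0 : R), (\int[P]_t (expR (eta * (Y t)%:R))%:E < +oo)%E) ->
  exists2 b, 0 < b < 1 & exists2 C, 0 <= C & forall l, (0 < l)%N ->
  (walk P Y l (fun x => (off_ratio m eps l x)%:R%:E) <= (C * b ^+ l)%:E)%E.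
Proof.
move=> eps0 /nbhs_ballP[e /= e0 he].
have e20 : 0 < e / 2 by rewrite divr_gt0.
have fin : (\int[P]_t (expR (e / 2 * (Y t)%:R))%:E < +oo)%E.
  by apply: he; rewrite /ball /= sub0r normrN gtr0_norm//; lra.
have [K K0 hK] := mgf_le e20 fin.
pose eta := Num.min (e / 2 / 2) (eps / (2 * (K + 1))).
have eta0 : 0 < eta by rewrite /eta lt_min !divr_gt0// mulr_gt0//; lra.
have etae : eta <= e / 2 / 2 by rewrite /eta ge_min lexx.
have etaK : eta * K <= eps / 2.
  have : eta <= eps / (2 * (K + 1)) by rewrite /eta ge_min lexx orbT.
  by rewrite ler_pdivlMr; [nra | lra].
pose b := expR (- (eta * (eps / 2))).
have b01 : 0 < b < 1 by rewrite expR_gt0/= expR_lt1 oppr_lt0 mulr_gt0// divr_gt0.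
exists b => //; exists 2 => // l l0.
pose M z := fine (\int[P]_t (expR (z * (Y t)%:R))%:E)%E.
have ME z : `|z| = eta -> (\int[P]_t (expR z ^+ Y t)%:E = (M z)%:E)%E /\
    0 <= M z <= expR (z * m + eta * (eps / 2)).
  move=> hz; have I0 : (0 <= \int[P]_t (expR (z * (Y t)%:R))%:E)%E.
    by apply: integral_ge0 => t _; rewrite lee_fin expR_ge0.
  have hzK := hK z; rewrite hz in hzK; have {}hzK := hzK etae.
  have Mfin : (\int[P]_t (expR (z * (Y t)%:R))%:E)%E \is a fin_num.
    by rewrite (ge0_fin_numE I0); apply: (le_lt_trans hzK); exact: ltry.
  split; first by rewrite /M fineK//; apply: eq_integral => t _; rewrite expRM_natr.
  rewrite fine_ge0//= -lee_fin /M fineK//; apply: le_trans hzK _; rewrite lee_fin.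
  apply: le_trans (expR_ge1Dx _); rewrite -addrA lerD2l lerD2l -real_normK ?num_real// hz expr2.
  by have := ler_wpM2l (ltW eta0) etaK; lra.
have [M1 /andP[M10 M1b]] := ME eta (gtr0_norm eta0).
have [M2 /andP[M20 M2b]] := ME (- eta) (etrans (normrN _) (gtr0_norm eta0)).
pose c1 := expR (- (eta * (m + eps))) ^+ l; pose c2 := expR (eta * (m - eps)) ^+ l.
have c10 : 0 <= c1 by rewrite exprn_ge0 ?expR_ge0.
have c20 : 0 <= c2 by rewrite exprn_ge0 ?expR_ge0.
apply: (@le_trans _ _ (walk P Y l (fun x => (c1%:E * (expR eta ^+ x)%:E + 0%:E) +
    (c2%:E * (expR (- eta) ^+ x)%:E + 0%:E))%E)).
  apply: (@walk_le _ _ _ P Y mY l) => x; first by rewrite lee_fin.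
  rewrite -!EFinM !adde0 -EFinD lee_fin; apply: le_trans (off_ratio_exp _ _ _ l0 eta0) _.
  by rewrite -/c1 -/c2 !expRM_natr mulrC [X in _ + X <= _]mulrC.
have ge1 k : (0 <= (expR eta ^+ k)%:E)%E by rewrite lee_fin exprn_ge0 ?expR_ge0.
have ge2 k : (0 <= (expR (- eta) ^+ k)%:E)%E by rewrite lee_fin exprn_ge0 ?expR_ge0.
rewrite walkD//; last 2 first.
- by move=> k; rewrite adde0 mule_ge0.
- by move=> k; rewrite adde0 mule_ge0.
rewrite !walk_affine// (walk_exp mY l (expR_ge0 _) M1) (walk_exp mY l (expR_ge0 _) M2).
rewrite !adde0 -EFinM -[X in (_ + X <= _)%E]EFinM -EFinD lee_fin.
have -> : 2 * b ^+ l = b ^+ l + b ^+ l by ring.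
have eb : b = expR (- (eta * (m + eps)) + (eta * m + eta * (eps / 2))).
  by congr expR; field.
have eb' : b = expR (eta * (m - eps) + (- eta * m + eta * (eps / 2))).
  by congr expR; field.
apply: lerD; rewrite -exprMn lerXn2r ?nnegrE ?mulr_ge0 ?expR_ge0//.
- by rewrite eb expRD ler_wpM2l ?expR_ge0.
- by rewrite eb' expRD ler_wpM2l ?expR_ge0.
Qed.

End offspring.

Section control.
Variables (phi : {RV P >-> control}) (xi : {RV P >-> nat}) (tau : R).
Hypothesis ade : AD_E phi xi tau.

Let mphi k : measurable_fun setT (fun t => phi t k).
Proof. exact: measurable_control_value. Qed.

Lemma Lambda0 : Lambda phi 0 = 0%E.
Proof.
rewrite /Lambda (_ : scaled_cumulant phi 0 = cst 0%E); first exact: lim_cst.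
apply/funext => k; rewrite /scaled_cumulant.
rewrite (eq_integral (cst 1%E)) => [|t _]; last by rewrite mul0r expR0.
by rewrite integral_cst//= probability_setT mule1 lne1 mule0.
Qed.

Lemma mgf_control_le eta v : cvgn (scaled_cumulant phi eta) -> (Lambda phi eta < v%:E)%E ->
  \forall k \near \oo, (\int[P]_t (expR (eta * (phi t k)%:R))%:E <= (expR (v * k%:R))%:E)%E.
Proof.
move=> cv Lv; have : \forall k \near \oo, (scaled_cumulant phi eta k < v%:E)%E.
  exact: (cv _ (open_ereal_lt' Lv)).
move=> [n1 _ h1]; exists n1.+1 => // k /= nk.
have := h1 k (ltnW nk); rewrite /scaled_cumulant /=.
have k0 : 0 < k%:R :> R by rewrite ltr0n (leq_ltn_trans _ nk).
set M := (\int[P]_t _)%E; have M0 : (0 <= M)%E.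
  by apply: integral_ge0 => t _; rewrite lee_fin expR_ge0.
rewrite lte_pdivrMl// => /ltW; rewrite -EFinM mulrC.
case: M M0 => [r| |]//=; rewrite lee_fin => r0.
case: ifPn => [r1 _|]; first by rewrite lee_fin (le_trans r1) ?expR_ge0.
by rewrite -ltNge !lee_fin => r1 h; rewrite -[r]lnK// ler_expR.
Qed.

Lemma control_off_exp eps : 0 < eps ->
  exists2 b, 0 < b < 1 & exists2 C, 0 <= C & forall k, (0 < k)%N ->
  (\int[P]_t (off_ratio tau eps k (phi t k))%:R%:E <= (C * b ^+ k)%:E)%E.
Proof.
move=> eps0; have [al [be [al0 be0 hL]]] := AD_E_Lambda ade.
pose lam := fine \o Lambda phi.
have lam0 : lam 0 = 0 by rewrite /lam /= Lambda0.
have al0be : al < 0 < be by rewrite al0.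
have [_ _ der0] := hL 0 al0be.
have /is_derive1_caratheodory[g [gE gc g0]] : is_derive (0 : R) 1 lam tau.
  by rewrite -(AD_E_tau ade) derive1E; exact: derivableP.
have e20 : 0 < eps / 2 by rewrite divr_gt0.
move/cvgrPdist_lt : gc => /(_ _ e20); rewrite g0 => /nbhs_ballP[e /= e0 he].
pose eta := Num.min (e / 2) (Num.min (be / 2) (- al / 2)).
have eta0 : 0 < eta by rewrite /eta !lt_min; apply/and3P; split; lra.
have etae : eta <= e / 2 by rewrite /eta ge_min lexx.
have etab : eta <= be / 2 by rewrite /eta !ge_min lexx orbT.
have etaa : eta <= - al / 2 by rewrite /eta !ge_min lexx !orbT.
have gb z : `|z| = eta -> `|tau - g z| < eps / 2.
  by move=> hz; apply: he; rewrite /ball /= sub0r normrN hz; lra.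
have bound z v : al < z < be -> lam z < v ->
    \forall k \near \oo, (\int[P]_t (expR (z * (phi t k)%:R))%:E <= (expR (v * k%:R))%:E)%E.
  move=> hz hv; have [c1 c2 _] := hL z hz; apply: mgf_control_le => //.
  by rewrite -(fineK c2) lte_fin.
have [n1 _ h1] : \forall k \near \oo, (\int[P]_t (expR (eta * (phi t k)%:R))%:E <=
    (expR (eta * (tau + eps / 2) * k%:R))%:E)%E.
  apply: bound; first by lra.
  have := gE eta; rewrite lam0 !subr0 => ->; rewrite mulrC ltr_pM2l//.
  by have := gb eta (gtr0_norm eta0); rewrite ltr_norml; lra.
have [n2 _ h2] : \forall k \near \oo, (\int[P]_t (expR (- eta * (phi t k)%:R))%:E <=
    (expR (- eta * (tau - eps / 2) * k%:R))%:E)%E.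
  apply: bound; first by lra.
  have := gE (- eta); rewrite lam0 !subr0 => ->; rewrite mulrC ltr_nM2l ?oppr_lt0//.
  by have := gb (- eta) (etrans (normrN _) (gtr0_norm eta0)); rewrite ltr_norml; lra.
pose b := expR (- (eta * (eps / 2))).
have b01 : 0 < b < 1 by rewrite expR_gt0/= expR_lt1 oppr_lt0 mulr_gt0.
have b0 : 0 <= b <= 1 by lra.
exists b => //; exists (2 + b ^- (n1 + n2)) => [|k k0].
  by rewrite addr_ge0// invr_ge0 exprn_ge0//; lra.
have off0 (t : T) : 0 <= (off_ratio tau eps k (phi t k))%:R :> R by [].
have moff : measurable_fun setT (fun t => (off_ratio tau eps k (phi t k))%:R%:E : \bar R).
  exact: (measurable_nat_comp (mphi k) (fun x => (off_ratio tau eps k x)%:R%:E)).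
have bk0 : 0 < b ^+ k by rewrite exprn_gt0//; case/andP: b01.
have bn0 : 0 < b ^- (n1 + n2) by rewrite invr_gt0 exprn_gt0//; case/andP: b01.
have [kn|kn] := leqP k (n1 + n2).
  apply: (@le_trans _ _ 1%:E).
    have -> : 1%:E = (\int[P]_t (1 : R)%:E)%E by rewrite integral_cst//= probability_setT mule1.
    apply: ge0_le_integral => //.
    by move=> t _; rewrite lee_fin; case: (off_ratio _ _ _ _); rewrite ?mulr1n ?ler01.
  rewrite lee_fin mulrDl; have : 1 <= b ^- (n1 + n2) * b ^+ k; last by lra.
  rewrite mulrC ler_pdivlMr ?mul1r ?exprn_gt0//; first by apply: ler_wiXn2l => //; lra.
  by case/andP: b01.
have k1 : (n1 <= k)%N by apply: leq_trans (ltnW kn); exact: leq_addr.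
have k2 : (n2 <= k)%N by apply: leq_trans (ltnW kn); exact: leq_addl.
pose c1 := expR (- (eta * (tau + eps))) ^+ k; pose c2 := expR (eta * (tau - eps)) ^+ k.
have c10 : 0 <= c1 by rewrite exprn_ge0 ?expR_ge0.
have c20 : 0 <= c2 by rewrite exprn_ge0 ?expR_ge0.
have mexp z : measurable_fun setT (fun t => (expR (z * (phi t k)%:R))%:E).
  exact: (measurable_nat_comp (mphi k) (fun x => (expR (z * x%:R))%:E)).
apply: (@le_trans _ _ (\int[P]_t (c1%:E * (expR (eta * (phi t k)%:R))%:E +
    c2%:E * (expR (- eta * (phi t k)%:R))%:E))%E).
  apply: ge0_le_integral => //.
    exact: (measurable_nat_comp (mphi k) (fun x => c1%:E * (expR (eta * x%:R))%:E +
      c2%:E * (expR (- eta * x%:R))%:E)%E).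
  move=> t _; rewrite -!EFinM -EFinD lee_fin.
  apply: le_trans (off_ratio_exp _ _ _ k0 eta0) _.
  by rewrite -/c1 -/c2 mulrC [X in _ + X <= _]mulrC.
rewrite ge0_integralD//; last 4 first.
- by move=> t _; rewrite mule_ge0// lee_fin expR_ge0.
- by apply: measurable_funeM.
- by move=> t _; rewrite mule_ge0// lee_fin expR_ge0.
- by apply: measurable_funeM.
rewrite !ge0_integralZl_EFin//.
have b1 : c1 * expR (eta * (tau + eps / 2) * k%:R) = b ^+ k.
  by rewrite /c1 /b -!expRM_natr -expRD; congr expR; field.
have b2 : c2 * expR (- eta * (tau - eps / 2) * k%:R) = b ^+ k.
  by rewrite /c2 /b -!expRM_natr -expRD; congr expR; field.
apply: (@le_trans _ _ (b ^+ k + b ^+ k)%:E).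
  rewrite EFinD -{1}b1 -b2 !EFinM; apply: leeD; apply: lee_wpmul2l; rewrite ?lee_fin//.
  - exact: h1.
  - exact: h2.
by rewrite lee_fin mulrDl; have := mulr_gt0 bn0 bk0; lra.
Qed.

End control.

Section control_power.
Variables (phi : {RV P >-> control}) (tau p : R).
Hypothesis p2 : 2 <= p.

Lemma control_off_power eps : 0 < eps ->
  (ereal_sup [set ((k%:R `^ (- (p / 2)))%:E *
                   \int[P]_t (`|(phi t k)%:R - tau * k%:R| `^ p)%:E)%E |
                 k in [set k : nat | (1 <= k)%N]] < +oo)%E ->
  exists2 C, 0 <= C & forall k, (0 < k)%N ->
  (\int[P]_t (off_ratio tau eps k (phi t k))%:R%:E <= (C * k%:R `^ (- (p / 2)))%:E)%E.
Proof.
move=> e0; set S := ereal_sup _ => hS.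
have mom0 k : (0 <= \int[P]_t (`|(phi t k)%:R - tau * k%:R| `^ p)%:E)%E.
  by apply: integral_ge0 => t _; rewrite lee_fin powR_ge0.
have ubS k : (0 < k)%N -> ((k%:R `^ (- (p / 2)))%:E *
    \int[P]_t (`|(phi t k)%:R - tau * k%:R| `^ p)%:E <= S)%E.
  by move=> k0; apply: ereal_sup_ubound; exists k.
have S0 : (0 <= S)%E.
  by apply: le_trans (ubS 1%N isT); rewrite mule_ge0// lee_fin powR_ge0.
have Sf : S \is a fin_num by rewrite ge0_fin_numE.
exists (eps `^ (- p) * fine S) => [|k k0]; first by rewrite mulr_ge0 ?powR_ge0 ?fine_ge0.
have kp : 0 < k%:R :> R by rewrite ltr0n.
have mphi := measurable_control_value phi k.
apply: (@le_trans _ _ (\int[P]_t (((eps * k%:R) `^ (- p))%:E *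
    (`|(phi t k)%:R - tau * k%:R| `^ p)%:E))%E).
  apply: ge0_le_integral => //.
  - exact: (measurable_nat_comp mphi (fun x => (off_ratio tau eps k x)%:R%:E)).
  - exact: (measurable_nat_comp mphi (fun x => ((eps * k%:R) `^ (- p))%:E *
      (`|x%:R - tau * k%:R| `^ p)%:E)%E).
  - by move=> t _; rewrite -EFinM lee_fin [tau * _]mulrC off_ratio_power.
rewrite ge0_integralZl_EFin ?powR_ge0//; last first.
  exact: (measurable_nat_comp mphi (fun x => (`|x%:R - tau * k%:R| `^ p)%:E)).
have := ubS k k0; rewrite -(fineK Sf).
have -> : (eps * k%:R) `^ (- p) = eps `^ (- p) * k%:R `^ (- (p / 2)) * k%:R `^ (- (p / 2)).
  rewrite powRM ?(ltW e0) ?(ltW kp)// -mulrA -powRD; first by congr (_ * _ `^ _); field.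
  by rewrite lt0r_neq0// implybT.
move=> h; rewrite EFinM -muleA (_ : eps `^ (- p) * fine S * _ =
  eps `^ (- p) * k%:R `^ (- (p / 2)) * fine S); last by ring.
rewrite [leRHS]EFinM.
by apply: lee_wpmul2l => //; rewrite lee_fin mulr_ge0 ?powR_ge0.
Qed.

End control_power.

End exponential_bounds.

(** * Envelopes from the assumptions *)

Section derivative_facts.
Context {R : realType}.

Lemma is_derive_unique_right (F1 F2 : R -> R) (x D1 D2 e : R) : 0 < e ->
  is_derive x 1 F1 D1 -> is_derive x 1 F2 D2 ->
  (forall t, x <= t < x + e -> F1 t = F2 t) -> D1 = D2.
Proof.
move=> e0 /is_derive1_caratheodory[g1 [h1 c1 <-]] /is_derive1_caratheodory[g2 [h2 c2 <-]] F12.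
have r1 : g1 z @[z --> x^'+] --> g1 x by exact: cvg_at_right_filter.
have r2 : g2 z @[z --> x^'+] --> g2 x by exact: cvg_at_right_filter.
apply: (cvg_unique _ r1) => //; apply: cvg_trans r2; apply: near_eq_cvg.
near=> z; have xz : x < z by near: z; exact: nbhs_right_gt.
have ze : z < x + e by near: z; apply: nbhs_right_lt; rewrite ltrDl.
have zx : z - x != 0 by rewrite subr_eq0 gt_eqF.
have Fz : F1 z = F2 z by apply: F12; rewrite (ltW xz).
have Fx : F1 x = F2 x by apply: F12; rewrite lexx ltrDl.
by apply: (mulIf zx); rewrite -h1 -h2 Fz Fx.
Unshelve. all: by end_near. Qed.

Lemma linear_quadratic_zero (c0 c1 K e : R) : 0 < e ->
  (forall t, 0 < t < e -> `|c0 + c1 * t| <= K * t ^+ 2) -> c0 = 0 /\ c1 = 0.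
Proof.
move=> e0 h.
have K0 : 0 <= K.
  have := h (e / 2) ltac:(lra); move=> /(le_trans (normr_ge0 _)).
  by rewrite pmulr_lge0// exprn_gt0//; lra.
have c00 : c0 = 0.
  apply/eqP; apply: contraT => n0; have p0 : 0 < `|c0| by rewrite normr_gt0.
  have D0 : 0 < K + `|c1| + 1 by have := normr_ge0 c1; lra.
  pose t := Num.min (Num.min 1 (e / 2)) (`|c0| / (2 * (K + `|c1| + 1))).
  have t0 : 0 < t by rewrite /t !lt_min ltr01 !divr_gt0// mulr_gt0.
  have t1 : t <= 1 by rewrite /t !ge_min lexx.
  have te : t <= e / 2 by rewrite /t !ge_min lexx orbT.
  have tc : t * (2 * (K + `|c1| + 1)) <= `|c0|.
    by rewrite -ler_pdivlMr ?mulr_gt0// /t !ge_min lexx !orbT.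
  have := h t ltac:(lra); have : `|c0| <= `|c0 + c1 * t| + `|c1| * t.
    have -> : `|c1| * t = `|- (c1 * t)| by rewrite normrN normrM (gtr0_norm t0).
    by apply: le_trans (ler_normD _ _); rewrite addrK.
  have t2 : t ^+ 2 <= t by rewrite expr2 ger_pMr.
  have := ler_wpM2l K0 t2; have := mulr_ge0 K0 (ltW t0).
  have := mulr_ge0 (normr_ge0 c1) (ltW t0); lra.
split => //; rewrite c00 in h.
apply/eqP; apply: contraT => n1; have p1 : 0 < `|c1| by rewrite normr_gt0.
pose t := Num.min (e / 2) (`|c1| / (2 * (K + 1))).
have K1 : 0 < K + 1 by lra.
have t0 : 0 < t by rewrite /t !lt_min !divr_gt0// mulr_gt0.
have te : t <= e / 2 by rewrite /t !ge_min lexx.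
have tc : t * (2 * (K + 1)) <= `|c1|.
  by rewrite -ler_pdivlMr ?mulr_gt0// /t !ge_min lexx !orbT.
have := h t ltac:(lra); rewrite add0r normrM (gtr0_norm t0) expr2 mulrA ler_pM2r//.
have := mulr_ge0 K0 (ltW t0); lra.
Qed.

Lemma mean_of_left_derivative (l : probability nat R) (tau : R) :
  derive1 (pgf l id) s @[s --> 1^'-] --> tau -> (\int[l]_k k%:R%:E)%E = tau%:E.
Proof.
move=> cv; have mid : measurable_fun setT (id : nat -> nat) by [].
have lim : lim (derive1 (pgf l id) s @[s --> 1^'-]) = tau by exact: cvg_lim cv.
have cvd : cvg (derive1 (pgf l id) s @[s --> 1^'-]) by apply/cvg_ex; exists tau.
have le_tau : (\int[l]_k k%:R%:E <= tau%:E)%E.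
  apply: (mean_le_dpgf mid) => s /andP[s0 s1]; rewrite -lim.
  apply: limr_ge => //; near=> t.
  have t1 : t < 1 by near: t; exact: nbhs_left_lt.
  have st : s < t by near: t; exact: nbhs_left_gt.
  rewrite derive1_pgf//; last by rewrite ger0_norm// (le_trans s0)// ltW.
  exact: (dpgf_homo l mid s0 (ltW st) t1).
apply/eqP; rewrite eq_le le_tau/=.
have I0 : (0 <= \int[l]_k k%:R%:E)%E by apply: integral_ge0 => k _; rewrite lee_fin.
have If : (\int[l]_k k%:R%:E)%E \is a fin_num.
  by rewrite ge0_fin_numE//; apply: le_lt_trans le_tau (ltry _).
rewrite -(fineK If) lee_fin -lim; apply: limr_le => //; near=> t.
have t1 : t < 1 by near: t; exact: nbhs_left_lt.
have t0 : 0 < t by near: t; exact: nbhs_left_gt.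
have t01 : 0 <= t < 1 by rewrite ltW.
rewrite derive1_pgf//; last by rewrite ger0_norm// ltW.
by apply: le_trans (dpgf_le_gpgf l mid t01) _; apply: gpgf_le_mean => //; rewrite fineK.
Unshelve. all: by end_near. Qed.

Lemma xlogx_integral (mu : probability nat R) :
  (\sum_(1 <= k <oo) (k%:R * maxr 0 (ln k%:R))%:E * mu [set k] < +oo)%E ->
  (\int[mu]_k (k%:R * ln (1 + k%:R))%:E < +oo)%E.
Proof.
move=> fin; have mid : measurable_fun setT (id : nat -> nat) by [].
pose w (k : nat) : R := k%:R * maxr 0 (ln k%:R).
have w0 k : 0 <= w k by rewrite mulr_ge0// le_max lexx.
have Iw : (\int[mu]_k (w k)%:E < +oo)%E.
  rewrite (@integral_level _ _ _ mu setT id (fun k => (w k)%:E) measurableT mid)//.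
  rewrite (nneseries_split 0 1)//=; last first.
    by move=> k _; apply: mule_ge0 => //; rewrite lee_fin.
  rewrite big_nat1.
  rewrite /w mul0r mul0e add0e; apply: le_lt_trans fin.
  rewrite le_eqVlt; apply/orP; left; apply/eqP; apply: eq_eseriesr => k _.
  by congr (_ * mu _)%E; apply/seteqP; split => [j []|j].
pose c : R := ln 2; have c0 : 0 <= c by rewrite ln_ge0//; lra.
have iw : mu.-integrable setT (EFin \o w).
  by apply: ge0_integrable => //; exact: (measurable_nat_comp mid (fun k => (w k)%:E)).
have WE : (\int[mu]_k (w k)%:E)%E = (fine (\int[mu]_k (w k)%:E))%:E.
  by rewrite fineK// ge0_fin_numE//; apply: integral_ge0 => k _; rewrite lee_fin.
apply: (@le_lt_trans _ _ (\int[mu]_k (c * expR 1 + 0 * w k + (c + 1) * w k)%:E)%E); last first.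
  by rewrite (integral_affine _ _ _ iw iw WE WE) ltry.
apply: ge0_le_integral => //.
- by move=> k _; rewrite lee_fin mulr_ge0// ln_ge0// lerDl.
move=> [|k] _; rewrite lee_fin.
  by rewrite mul0r /w !mul0r !mulr0 !addr0 mulr_ge0 ?expR_ge0.
set x := k.+1%:R; have x1 : 1 <= x :> R by rewrite ler1n.
have x0 : 0 < x by lra.
have lx : 0 <= ln x by rewrite ln_ge0.
have wE : w k.+1 = x * ln x by rewrite /w -/x max_r.
have h1 : ln (1 + x) <= c + ln x.
  by rewrite /c -lnM ?posrE// ler_ln ?posrE; lra.
have h2 : x <= expR 1 + x * ln x.
  have [xe|xe] := leP x (expR 1); first by have := mulr_ge0 (ltW x0) lx; lra.
  have : 1 <= ln x by rewrite -(expRK 1) ler_ln ?posrE ?expR_gt0// ltW.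
  by move=> h; have := ler_wpM2l (ltW x0) h; have := expR_ge0 (1 : R); lra.
rewrite wE; have := ler_wpM2l (ltW x0) h1; have := ler_wpM2l c0 h2; lra.
Qed.

End derivative_facts.

Section envelope_facts.
Context {R : realType} {d : measure_display} {T : measurableType d}
  (P : probability T R).
Variables (X0 xi : T -> nat) (m tau : R).
Hypothesis mX0 : measurable_fun setT X0.
Hypothesis mxi : measurable_fun setT xi.
Hypothesis m0 : 0 < m.
Hypothesis mean_xi : (\int[P]_t (xi t)%:R%:E)%E = m%:E.
Hypothesis tau0 : 0 < tau.

Local Notation f := (pgf P xi).
Local Notation F0 := (pgf P X0).

Variables (l dd : probability nat R) (q theta : R).
Hypothesis l1 : derive1 (pgf l id) s @[s --> 1^'-] --> tau.
Hypothesis theta01 : 0 < theta < 1.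
Hypothesis hS : AD_S_envelope F0 (pgf l id \o f) (pgf dd id \o f) q theta.

Let mid : measurable_fun setT (id : nat -> nat). Proof. by []. Qed.
Let mean_l := mean_of_left_derivative l1.

Record envelope_facts (mu eta : probability nat R) : Prop := {
  ef_mu : forall s, 0 <= s <= 1 -> pgf mu id s = pgf l id (f s);
  ef_eta : forall s, 0 <= s <= 1 -> pgf eta id s = pgf dd id (f s);
  ef_slope : forall s, 0 <= s < 1 -> gpgf mu id s <= m * tau;
  ef_mean : ((m * tau)%:E <= \int[mu]_k k%:R%:E)%E;
  ef_xlogx : (\int[mu]_k (k%:R * ln (1 + k%:R))%:E < +oo)%E;
  ef_log : (\int[eta]_k (ln (1 + k%:R))%:E < +oo)%E;
  ef_slope0 : 0 < gpgf mu id 0;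
  ef_q : 0 <= q < 1;
  ef_fix : pgf mu id q = q;
  ef_dq : 0 < dpgf mu id q < 1;
  ef_branch : forall B, (neutral_branch (pgf dd id \o f) q -> B = F0 q) ->
    (~ neutral_branch (pgf dd id \o f) q -> B = 0) ->
    (B = 0 \/ forall s, 0 <= s <= 1 -> pgf dd id s = 1) /\
    ([/\ theta = pgf eta id q * dpgf mu id q, F0 q = B & 0 < dpgf P X0 q] \/
     [/\ theta = pgf eta id q, B = 0 & 0 < q])
}.

Let f01 s : 0 <= s <= 1 -> 0 <= f s <= 1.
Proof. by move=> /andP[s0 s1]; rewrite pgf_ge0// pgf_le1// s0. Qed.

Let flt1 s : 0 <= s < 1 -> 0 <= f s < 1.
Proof.
move=> s01; have /andP[s0 s1] := s01.
by rewrite pgf_ge0//= (pgf_lt1 _ mean_xi m0 s01).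
Qed.

Let slope_comp mu s : (forall s, 0 <= s <= 1 -> pgf mu id s = pgf l id (f s)) -> 0 <= s < 1 ->
  gpgf mu id s = gpgf P xi s * gpgf l id (f s).
Proof.
move=> hmu s01; have /andP[s0 s1] := s01; have p : 0 < 1 - s by rewrite subr_gt0.
apply: (mulfI (lt0r_neq0 p)); rewrite -(pgf_chord mu mid s01) mulrA -(pgf_chord P mxi s01).
by rewrite -(pgf_chord l mid (flt1 s01)) hmu// s0 ltW.
Qed.

Let slope_le_m s : 0 <= s < 1 -> gpgf P xi s <= m.
Proof. by move=> s01; apply: gpgf_le_mean => //; rewrite mean_xi. Qed.

Let slope_le_tau s : 0 <= s < 1 -> gpgf l id s <= tau.
Proof. by move=> s01; apply: gpgf_le_mean => //; rewrite mean_l. Qed.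

Let mean_ge (mu : probability nat R) : (forall s, 0 <= s <= 1 -> pgf mu id s = pgf l id (f s)) ->
  ((m * tau)%:E <= \int[mu]_k k%:R%:E)%E.
Proof.
move=> hmu; rewrite leNgt; apply/negP => lt.
have {lt}[M [IM Ma]] : exists M, (\int[mu]_k k%:R%:E <= M%:E)%E /\ M < m * tau.
  have I0 : (0 <= \int[mu]_k k%:R%:E)%E by apply: integral_ge0 => k _; rewrite lee_fin.
  have If : (\int[mu]_k k%:R%:E)%E \is a fin_num.
    by rewrite ge0_fin_numE//; apply: lt_trans lt (ltry _).
  by exists (fine (\int[mu]_k k%:R%:E)%E); rewrite fineK// -lte_fin fineK.
have sl s : 0 <= s < 1 -> gpgf mu id s <= M by exact: (gpgf_le_mean mid IM).
clear IM.
have [m0' tau0'] := (m0, tau0).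
have mt0 : 0 < m + tau by rewrite addr_gt0.
pose e := Num.min (Num.min m tau) ((m * tau - M) / (2 * (m + tau))).
have e0 : 0 < e by rewrite /e !lt_min m0 tau0 divr_gt0 ?mulr_gt0// subr_gt0.
have em : e <= m by rewrite /e !ge_min lexx.
have et : e <= tau by rewrite /e !ge_min lexx orbT.
have eM : e * (2 * (m + tau)) <= m * tau - M.
  by rewrite -ler_pdivlMr ?mulr_gt0// /e !ge_min lexx !orbT.
have [s0 /andP[s00 s01] hs0] := gpgf_near_mean mxi mean_xi e0.
have [s1 /andP[s10 s11] hs1] := gpgf_near_mean mid mean_l e0.
pose s := Num.max s0 (1 - (1 - s1) / (m + 1)).
have s1m : 0 < (1 - s1) / (m + 1) by rewrite divr_gt0; lra.
have ss : s0 <= s by rewrite /s le_max lexx.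
have ss' : 1 - (1 - s1) / (m + 1) <= s by rewrite /s le_max lexx orbT.
have slt : s < 1 by rewrite /s gt_max s01; lra.
have sr : 0 <= s < 1 by rewrite (le_trans s00 ss).
have fs1 : s1 <= f s.
  have := pgf_chord P mxi sr; have := slope_le_m sr => h1 h2.
  have sp : 0 <= 1 - s by lra.
  have := ler_wpM2l sp h1; rewrite -h2.
  have : (1 - s) * (m + 1) <= 1 - s1 by rewrite -ler_pdivlMr; lra.
  lra.
have := sl _ sr; rewrite (slope_comp hmu sr).
have g1 := hs0 s ss slt; have /andP[_ fs] := flt1 sr; have g2 := hs1 _ fs1 fs.
have : (m - e) * (tau - e) <= gpgf P xi s * gpgf l id (f s) by apply: ler_pM => //; lra.
have := mulr_ge0 (ltW e0) (ltW e0).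
have := mulr_gt0 e0 mt0; lra.
Qed.

Lemma envelope_factsP : exists mu eta, envelope_facts mu eta.
Proof.
have [mu [hmu xlogx]] := env_XlogX hS; have [eta [heta hlog]] := env_log hS.
have q01 := env_q hS; have /andP[q0 q1] := q01.
have q01' : 0 <= q <= 1 by rewrite q0 ltW.
have fq := flt1 q01; have /andP[fq0 fq1] := fq.
have l_lt1 s : 0 <= s < 1 -> pgf l id s < 1 by exact: (pgf_lt1 mid mean_l tau0).
have duE : derive1 (pgf l id \o f) q = dpgf mu id q.
  have i1 : is_derive q 1 (pgf l id \o f) (dpgf l id (f q) * dpgf P xi q).
    apply: is_derive1_comp; first by apply: is_derive_pgf => //; rewrite ger0_norm.
    by apply: is_derive_pgf => //; rewrite ger0_norm.
  have i2 : is_derive q 1 (pgf mu id) (dpgf mu id q).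
    by apply: is_derive_pgf => //; rewrite ger0_norm.
  rewrite derive1E (derive_val (is_derive := i1)).
  have e0 : 0 < 1 - q by rewrite subr_gt0.
  apply: (is_derive_unique_right e0 i1 i2) => t /andP[qt t1].
  by rewrite hmu// (le_trans q0 qt); lra.
have theta0 : 0 < theta by case/andP: theta01.
have th1 : theta < 1 by case/andP: theta01.
exists mu, eta; split => //.
- move=> s s01; rewrite (slope_comp hmu s01); apply: ler_pM.
  + by apply: gpgf_ge0; case/andP: s01.
  + by apply: gpgf_ge0; case/andP: (flt1 s01).
  + exact: slope_le_m.
  + by apply: slope_le_tau; exact: flt1.
- exact: mean_ge.
- exact: xlogx_integral.
- have h01 : 0 <= (0 : R) < 1 by rewrite lexx ltr01.
  have := pgf_chord mu mid h01; rewrite subr0 mul1r => <-.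
  rewrite subr_gt0 hmu ?lexx ?ler01//; apply: l_lt1; exact: flt1.
- by rewrite hmu//; exact: (env_fixpoint hS).
- by rewrite -duE; exact: (env_attracting hS).
move=> B hB1 hB0; have etaq : pgf eta id q = pgf dd id (f q) by exact: heta.
have [q0'|qp] : q = 0 \/ 0 < q by move: q0; rewrite le_eqVlt => /predU1P[]; [left|right].
  have B0 : B = 0 by apply: hB0 => -[]; rewrite q0' ltxx.
  split; [by left|left]; rewrite B0.
  have [mu1 [mu10 /eqO_exP[K K0 hK]]] := env_init0 hS q0'.
  have : exists2 e, 0 < e & forall t, 0 < t < e ->
      `|F0 0 + (dpgf P X0 0 - mu1) * t| <= (K + (1 - 1 / 2) ^- 2) * t ^+ 2.
    have [e /= e0 he] := hK; exists (Num.min e (1 / 2)) => [|t].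
      by rewrite lt_min e0; lra.
    rewrite lt_min => /and3P[t0 te th].
    have tt : `|F0 t - mu1 * t| <= K * `|t ^+ 2|.
      by apply: he => //=; rewrite sub0r normrN gtr0_norm.
    have rr : 0 <= (1 / 2 : R) < 1 by lra.
    have n0 : `|0 : R| <= 1 / 2 by rewrite normr0; lra.
    have nt : `|t| <= 1 / 2 by rewrite gtr0_norm// ltW.
    have := pgf_quadratic P mX0 rr n0 nt; rewrite subr0.
    rewrite (ger0_norm (sqr_ge0 t)) in tt => q2.
    have -> : F0 0 + (dpgf P X0 0 - mu1) * t =
      (F0 t - mu1 * t) - (F0 t - F0 0 - dpgf P X0 0 * t) by ring.
    by apply: le_trans (ler_normB _ _) _; rewrite mulrDl lerD.
  move=> [e e0 /(linear_quadratic_zero e0)[F00 /eqP]]; rewrite subr_eq0 => /eqP D0.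
  rewrite q0' F00 D0; split => //.
  rewrite (env_theta0 hS q0') -q0' duE q0'; congr (_ * _).
  by rewrite heta// lexx ler01.
have [rq|rq] : pgf dd id (f q) < 1 \/ pgf dd id (f q) = 1.
  by have := pgf_le1 dd mid (f01 q01'); rewrite le_eqVlt => /predU1P[]; [right|left].
  have B0 : B = 0.
    apply: hB0 => -[_ h]; have := h q q01'; rewrite /= => h1; move: rq.
    by rewrite h1 ltxx.
  split; [by left|right]; split => //; rewrite etaq.
  exact: (env_theta1 hS qp rq).
have d1 := pgf_constant1 mid fq rq.
have c1 : constant_one (pgf dd id \o f) by move=> s s01; rewrite /= d1// f01.
have neu : neutral_branch (pgf dd id \o f) q by [].
split; [by right|left]; rewrite etaq rq mul1r; split.
- by rewrite (env_theta2 hS qp c1) duE.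
- by rewrite (hB1 neu).
- have := env_init2 hS qp c1; rewrite derive1_pgf//.
  by rewrite ger0_norm.
Qed.

End envelope_facts.

Section eventual_bounds.
Context {R : realType}.
Implicit Types u : nat -> \bar R.

Lemma limn_esup_le u (C : R) : (\forall n \near \oo, (u n <= C%:E)%E) ->
  (limn_esup u <= C%:E)%E.
Proof.
move=> h; apply: (@le_trans _ _ (ereal_sup [set u x | x in [set n | (u n <= C%:E)%E]])).
  by apply: ereal_inf_lbound; exists [set n | (u n <= C%:E)%E].
by apply: ge_ereal_sup => _ [n hn <-].
Qed.

Lemma limn_esup_lty u (C : R) N : (forall n, (N <= n)%N -> (u n <= C%:E)%E) ->
  (limn_esup u < +oo)%E.
Proof.
by move=> h; apply: le_lt_trans (@limn_esup_le u C _) (ltry _); exists N.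
Qed.

Lemma limn_einf_gt0 u (c : R) N : 0 < c -> (forall n, (N <= n)%N -> (c%:E <= u n)%E) ->
  (0 < limn_einf u)%E.
Proof.
move=> c0 h; apply: (@lt_le_trans _ _ c%:E); first by rewrite lte_fin.
have -> : u = (-%E \o (-%E \o u)) by apply/funext => n /=; rewrite oppeK.
rewrite limn_einfN leeNr; apply: limn_esup_le; exists N => // n /= Nn.
by rewrite EFinN leeN2 h.
Qed.

End eventual_bounds.

Section population_scales.
Context {R : realType} {d : measure_display} {T : measurableType d}
  (P : probability T R).
Variables (X0 : {RV P >-> nat}) (xis : nat -> nat -> {RV P >-> nat})
  (phis : nat -> {RV P >-> control}) (xi : {RV P >-> nat}) (phi : {RV P >-> control})
  (m tau : R) (lL lU dL dU : probability nat R) (qL qU theta : R).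
Hypothesis model : cbp_model X0 xis phis xi phi m.
Hypothesis hAD0 : AD0 (fun k => pgf P (fun t => phi t k)) tau lL lU dL dU.
Hypothesis hADS : AD_S (pgf P xi) (pgf P X0) (m * tau) lL lU dL dU qL qU theta.

Local Notation X := (popX X0 xis phis).
Local Notation N := (popN X0 xis phis).
Local Notation a := (m * tau).
Local Notation F0 := (pgf P X0).

Let mX0 : measurable_fun setT X0. Proof. exact: measurable_funPT. Qed.
Let mxi : measurable_fun setT xi. Proof. exact: measurable_funPT. Qed.
Let mid : measurable_fun setT (id : nat -> nat). Proof. by []. Qed.
Let mX := measurable_popX model.
Let mN := measurable_popN model.
Let a1 : 1 < a := AD_S_a hADS.
Let theta01 : 0 < theta < 1 := AD_S_theta hADS.
Let theta0 : 0 < theta. Proof. by case/andP: theta01. Qed.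
Let tau0 : 0 < tau := AD0_tau_gt0 hAD0.
Let m0 : 0 < m := cbp_mean_gt0 model.

Local Notation facts := (envelope_facts P X0 xi m tau).

(* [B] is the limit of [F_n] on [[0, 1)]: [F0 q] in the neutral branch and [0] otherwise. *)
Let envelopes : exists muL etaL muU etaU B, [/\ facts lL dL qL theta muL etaL,
  facts lU dU qU theta muU etaU,
  (neutral_branch (pgf dL id \o pgf P xi) qL -> B = F0 qL) /\
  (~ neutral_branch (pgf dL id \o pgf P xi) qL -> B = 0) &
  (neutral_branch (pgf dU id \o pgf P xi) qU -> B = F0 qU) /\
  (~ neutral_branch (pgf dU id \o pgf P xi) qU -> B = 0)].
Proof.
have [muL [etaL fL]] := envelope_factsP mX0 mxi m0 (cbp_mean model) tau0 (AD0_lL1 hAD0)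
  theta01 (AD_S_L hADS).
have [muU [etaU fU]] := envelope_factsP mX0 mxi m0 (cbp_mean model) tau0 (AD0_lU1 hAD0)
  theta01 (AD_S_U hADS).
exists muL, etaL, muU, etaU.
have [nL|nL] := pselect (neutral_branch (pgf dL id \o pgf P xi) qL).
  have [_ nU qq] := AD_S_neutral hADS (or_introl nL).
  by exists (F0 qL); split => //; split => // _; rewrite qq.
exists 0; split => //; split => // nU.
by have [] := AD_S_neutral hADS (or_intror nU).
Qed.

Let inv01 i : 0 < a ^- i <= 1.
Proof.
have a0 : 0 < a by apply: lt_trans a1.
by rewrite invr_gt0 exprn_gt0//= invf_le1 ?exprn_gt0// exprn_ege1// ltW.
Qed.

Let scale01 c k : 0 <= c <= 1 -> 1 - c <= 1 - c * a ^- k /\ 0 <= 1 - c * a ^- k <= 1.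
Proof.
move=> /andP[c0 c1]; have /andP[k0 k1] := inv01 k.
have := ler_pM c0 (ltW k0) (lexx c) k1; have := mulr_ge0 c0 (ltW k0).
by rewrite mulr1 => *; split; [|apply/andP; split]; lra.
Qed.

(* The three hypotheses of the section on harmonic moments, for [X_n] and for [N_n]. *)
Let scales (Y : nat -> T -> nat) B := [/\
  exists2 C, 0 <= C & forall k n, (k <= n)%N ->
    pgf P (Y n) (1 - a ^- k / 2) - B <= C * theta ^+ (n - k),
  exists2 c, 0 < c <= 1 & exists2 C, 0 < C & forall k n, (k <= n)%N ->
    C * theta ^+ (n - k) <= pgf P (Y n) (1 - c * a ^- k) - B &
  exists2 C, 0 <= C & forall n, B - pgf P (Y n) 0 <= C * theta ^+ n].

Let popX_scales : exists B, [/\ B = 0 \/ forall s, 0 <= s <= 1 -> pgf dL id s = 1,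
  forall c, 0 < c <= 1 -> exists2 C, 0 <= C & forall k n, (k <= n)%N ->
    pgf P (X n) (1 - c * a ^- k) - B <= C * theta ^+ (n - k),
  exists2 c0, 0 < c0 < 1 & forall c, 0 < c <= c0 -> exists2 C, 0 < C & forall k n, (k <= n)%N ->
    C * theta ^+ (n - k) <= pgf P (X n) (1 - c * a ^- k) - B &
  exists2 C, 0 <= C & forall n, B - pgf P (X n) 0 <= C * theta ^+ n].
Proof.
have [muL [etaL [muU [etaU [B [fL fU [hL1 hL2] [hU1 hU2]]]]]]] := envelopes.
have [bL brL] := ef_branch fL hL1 hL2; have [bU brU] := ef_branch fU hU1 hU2.
have f01 s : 0 <= s <= 1 -> 0 <= pgf P xi s <= 1.
  by move=> /andP[s0 s1]; rewrite pgf_ge0// pgf_le1// s0.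
have bL' : B = 0 \/ forall s, 0 <= s <= 1 -> pgf etaL id s = 1.
  by case: bL => [|h]; [left|right => s s01; rewrite (ef_eta fL)// h ?f01].
have bU' : B = 0 \/ forall s, 0 <= s <= 1 -> pgf etaU id s = 1.
  by case: bU => [|h]; [left|right => s s01; rewrite (ef_eta fU)// h ?f01].
exists B; split => //.
- move=> c c01; have [C C0 hC] := env_scale_le mX0 a1 (ef_slope fU) (ef_q fU) (ef_fix fU)
    (ef_dq fU) theta0 bU' brU (ef_mean fU) (ef_xlogx fU) (ef_slope0 fU) c01.
  exists C => // k n kn; apply: le_trans (hC k n kn); rewrite lerD2r.
  apply: (pgf_popX_le_env model hAD0 (ef_mu fU) (ef_eta fU)).
  by apply: (scale01 k _).2; case/andP: c01 => /ltW ->.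
- have [c0 c01 down] := env_scale_ge mX0 a1 (ef_slope fL) (ef_q fL) (ef_fix fL)
    (ef_dq fL) theta0 bL' brL (ef_log fL).
  exists c0 => // c cc; have [C C0 hC] := down c cc; exists C => // k n kn.
  apply: le_trans (hC k n kn) _; rewrite lerD2r.
  apply: (env_le_pgf_popX model hAD0 (ef_mu fL) (ef_eta fL)).
  have /andP[cp c1] := cc; have /andP[_ c2] := c01.
  by apply: (scale01 k _).2; rewrite (ltW cp) (le_trans c1 (ltW c2)).
- have [C C0 hC] := env0_deficit mX0 (ef_q fL) (ef_fix fL) (ef_dq fL) bL' brL.
  exists C => // n; apply: le_trans (hC n); rewrite lerD2l lerN2.
  by apply: (env_le_pgf_popX model hAD0 (ef_mu fL) (ef_eta fL)); rewrite lexx ler01.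
Qed.

Let pgf_onem_le (l : probability nat R) y : 0 < y <= 1 ->
  pgf l id (1 - y) <= 1 - (1 - pgf l id 0) * y.
Proof.
move=> /andP[y0 y1]; have y01 : 0 <= 1 - y < 1 by rewrite subr_ge0 y1 gtrBl.
have h01 : 0 <= (0 : R) < 1 by rewrite lexx ltr01.
have /andP[z0 z1] := y01.
have := pgf_chord l mid h01; rewrite subr0 mul1r => ->.
have := ler_wpM2l (ltW y0) (gpgf_homo l mid (lexx 0) z0 z1).
have := pgf_chord l mid y01; rewrite subKr; lra.
Qed.

Let pgf_onem_ge (l : probability nat R) y : derive1 (pgf l id) s @[s --> 1^'-] --> tau ->
  0 < y <= 1 -> 1 - tau * y <= pgf l id (1 - y).
Proof.
move=> l1 /andP[y0 y1]; have y01 : 0 <= 1 - y < 1 by rewrite subr_ge0 y1 gtrBl.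
have := pgf_chord l mid y01; rewrite subKr.
have : gpgf l id (1 - y) <= tau.
  by apply: gpgf_le_mean => //; rewrite (mean_of_left_derivative l1).
by move=> /(ler_wpM2l (ltW y0)); lra.
Qed.

Let population_scales : exists B, scales X B /\ scales N B.
Proof.
have [B [bL up [c0 c01 low] [D D0 hD]]] := popX_scales.
have [c00 c0lt] := andP c01; have h001 : 0 <= (0 : R) <= 1 by rewrite lexx ler01.
exists B; split; split.
- have h2 : 0 < (1 / 2 : R) <= 1 by lra.
  have [C C0 hC] := up _ h2; exists C => // k n kn.
  by have := hC k n kn; rewrite mul1r mulrC.
- by exists c0; [rewrite c00 ltW | apply: low; rewrite c00 lexx].
- by exists D.
- have mean_lU := mean_of_left_derivative (AD0_lU1 hAD0).
  pose kap := 1 - pgf lU id 0.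
  have h01 : 0 <= (0 : R) < 1 by rewrite lexx ltr01.
  have kap0 : 0 < kap by rewrite subr_gt0 (pgf_lt1 mid mean_lU tau0).
  have kap1 : kap <= 1 by rewrite gerBl pgf_ge0.
  have kh : 0 < kap / 2 <= 1 by rewrite divr_gt0//= ler_pdivrMr// mul1r (le_trans kap1)// ler1n.
  have kh' : 0 <= kap / 2 <= 1 by case/andP: kh => /ltW -> ->.
  have [C C0 hC] := up _ kh; exists C => // k n kn.
  apply: le_trans (hC k n kn); rewrite lerD2r.
  have /andP[k0 k1] := inv01 k; set y := a ^- k / 2.
  have y01 : 0 < y <= 1 by rewrite divr_gt0//= ler_pdivrMr// mul1r (le_trans k1)// ler1n.
  have y01' : 0 <= 1 - y <= 1 by case/andP: y01 => y0 y1; rewrite subr_ge0 y1 gerBl ltW.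
  apply: le_trans (pgf_popN_le model hAD0 n y01') _.
  have l01 : 0 <= pgf lU id (1 - y) <= 1.
    by have /andP[y0 y1] := y01'; rewrite pgf_ge0// pgf_le1.
  have d1 : pgf dU id (1 - y) <= 1 by exact: pgf_le1.
  apply: le_trans (_ : pgf P (X n) (pgf lU id (1 - y)) <= _).
    by apply: ler_piMl => //; rewrite pgf_ge0//; case/andP: l01.
  apply: pgf_homo => //; [by case/andP: l01 | | by case/andP: (scale01 k kh').2].
  by rewrite [kap / 2 * _]mulrAC -mulrA; exact: pgf_onem_le.
- pose c := Num.min c0 (c0 / tau).
  have cp : 0 < c by rewrite /c lt_min c00 divr_gt0.
  have cc0 : c <= c0 by rewrite /c ge_min lexx.
  have ct : c * tau <= c0 by rewrite -ler_pdivlMr// /c ge_min lexx orbT.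
  have c1 : c < 1 by exact: le_lt_trans cc0 c0lt.
  have c1' : 0 <= c <= 1 by rewrite !ltW.
  exists c; first by rewrite cp ltW.
  have [C C0 hC] : exists2 C, 0 < C & forall k n, (k <= n)%N ->
      C * theta ^+ (n - k) <= pgf P (X n) (1 - (c * tau) * a ^- k) - B.
    by apply: low; rewrite mulr_gt0.
  pose e := pgf dL id (1 - c).
  have e0 : 0 < e by rewrite /e pgf_gt0// subr_gt0 c1 gerBl ltW.
  exists (e * C) => [|k n kn]; first exact: mulr_gt0.
  have [s1 s01] := scale01 k c1'; have /andP[s0 s1'] := s01.
  apply: (@le_trans _ _ (pgf dL id (1 - c * a ^- k) *
      pgf P (X n) (pgf lL id (1 - c * a ^- k)) - B)); last first.
    by rewrite lerD2r; exact: (pgf_popN_ge model hAD0).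
  have ee : e <= pgf dL id (1 - c * a ^- k) by apply: pgf_homo => //; rewrite subr_ge0 ltW.
  have xx : pgf P (X n) (1 - (c * tau) * a ^- k) <= pgf P (X n) (pgf lL id (1 - c * a ^- k)).
    have ct01 : 0 <= c * tau <= 1.
      by rewrite mulr_ge0 ?(ltW cp) ?(ltW tau0)//= (le_trans ct)// ltW.
    apply: pgf_homo => //; [by case/andP: (scale01 k ct01).2 | | exact: pgf_le1].
    have /andP[k0 k1] := inv01 k; rewrite mulrAC mulrC.
    apply: (pgf_onem_ge (AD0_lL1 hAD0)); rewrite mulr_gt0//=.
    by rewrite mulr_ile1// ltW.
  have h1 := le_trans (hC k n kn) (lerB xx (lexx B)).
  have h0 : 0 <= C * theta ^+ (n - k) by rewrite mulr_ge0 ?exprn_ge0 ?ltW.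
  rewrite -mulrA; apply: le_trans (ler_wpM2l (ltW e0) h1) _.
  case: bL => [->|dL1]; first by rewrite !subr0 ler_wpM2r// pgf_ge0// pgf_ge0.
  rewrite dL1// mul1r ler_piMl//; first exact: le_trans h0 h1.
  by rewrite /e pgf_le1// subr_ge0 (ltW c1) gerBl ltW.
- exists D => // n; case: bL => [->|dL1].
    by apply: (@le_trans _ _ 0); rewrite ?sub0r ?oppr_le0 ?pgf_ge0// mulr_ge0 ?exprn_ge0 ?(ltW theta0).
  apply: le_trans (hD n); rewrite lerD2l lerN2.
  apply: le_trans (pgf_popN_ge model hAD0 n h001); rewrite dL1// mul1r.
  by apply: pgf_homo => //; [exact: pgf_ge0 | exact: pgf_le1].
Qed.

Definition population_process (Y : nat -> T -> nat) := Y = X \/ Y = N.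

Let process_scales Y : population_process Y ->
  (forall n, measurable_fun setT (Y n)) /\ exists B, scales Y B.
Proof.
have [B [sX sN]] := population_scales.
by move=> [->|->]; split => //; exists B.
Qed.

Lemma population_harmonic_moment_le Y r : population_process Y -> 0 < r ->
  exists2 C, 0 < C & forall n, (0 < n)%N ->
  (harmonic_moment P (Y n) r <= (C * bsc theta a r n)%:E)%E.
Proof.
move=> /process_scales[mY [B [s1 s2 s3]]] r0.
exact: (harmonic_moment_le mY a1 theta01 s1 s3 r0).
Qed.

Lemma population_harmonic_moment_ge Y r : population_process Y -> 0 < r ->
  exists2 C, 0 < C & exists N, forall n, (N <= n)%N ->
  ((C * bsc theta a r n)%:E <= harmonic_moment P (Y n) r)%E.
Proof.
move=> /process_scales[mY [B [s1 s2 s3]]] r0.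
exact: (harmonic_moment_ge mY a1 theta01 s1 s2 r0).
Qed.

Lemma population_pgf_le Y s : population_process Y -> 0 <= s < 1 ->
  exists2 C, 0 <= C & exists N, forall n, (N <= n)%N ->
  pgf P (Y n) s - pgf P (Y n) 0 <= C * theta ^+ n.
Proof.
move=> /process_scales[mY [B [s1 s2 s3]]] s01.
exact: (pgf_diff_le_theta mY a1 theta01 s1 s3 s01).
Qed.

Let bsc0 r n : (0 < n)%N -> 0 < bsc theta a r n.
Proof. by move=> n0; apply: bsc_gt0 => //; exact: lt_trans a1. Qed.

Lemma harmonic_moment_ratio Y r : population_process Y -> 0 < r ->
  let ratio := fun n : nat =>
    (harmonic_moment P (Y n) r * ((bsc theta a r n)^-1)%:E)%E in
  [/\ (0 < limn_einf ratio)%E, (limn_einf ratio <= limn_esup ratio)%E &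
      (limn_esup ratio < +oo)%E].
Proof.
move=> hY r0 ratio; split; last 2 first.
- exact: limn_einf_sup.
- have [C C0 hC] := population_harmonic_moment_le hY r0.
  apply: (@limn_esup_lty _ _ C 1%N) => n n0; rewrite /ratio muleC.
  by rewrite lee_pdivrMl ?bsc0// -EFinM mulrC; exact: hC.
- have [C C0 [n1 hC]] := population_harmonic_moment_ge hY r0.
  apply: (@limn_einf_gt0 _ _ C n1.+1) => // n nn; rewrite /ratio muleC.
  have n0 : (0 < n)%N by apply: leq_ltn_trans nn.
  by rewrite lee_pdivlMl ?bsc0// -EFinM mulrC; apply: hC; exact: ltnW.
Qed.

Let gt0_weight (Y : T -> nat) (w : nat -> R) :
  (\int[P]_t (if (0 < Y t)%N then w (Y t) else 0)%:E)%E =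
  (\int[P]_(t in [set t | (0 < Y t)%N]) (w (Y t))%:E)%E.
Proof.
rewrite [RHS]integral_mkcond; apply: eq_integral => t _.
rewrite patchE; case: (boolP (0 < Y t)%N) => yt; first by rewrite mem_set.
by rewrite memNset//; exact/negP.
Qed.

Let polynomial_rate Y (J : nat -> \bar R) C q : population_process Y -> 0 < q -> 0 <= C ->
  (forall n, (J n <= \int[P]_t (if (0 < Y n t)%N then C * (Y n t)%:R `^ (- q) else 0)%:E)%E) ->
  exists D, forall n, (0 < n)%N -> (J n <= (D * bsc theta a q n)%:E)%E.
Proof.
move=> hY q0 C0 hJ; have [mY _] := process_scales hY.
have [D D0 hD] := population_harmonic_moment_le hY q0.
exists (C * D) => n n0; apply: le_trans (hJ n) _.
rewrite (gt0_weight (Y n) (fun k => C * k%:R `^ (- q))).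
under eq_integral do rewrite EFinM.
rewrite ge0_integralZl_EFin//; last 2 first.
- exact: measurable_gt0.
- by apply: measurable_funTS; exact: (measurable_nat_comp (mY n) (fun k => (k%:R `^ (- q))%:E)).
by rewrite -mulrA EFinM lee_wpmul2l// ?lee_fin//; exact: hD.
Qed.

Let exponential_rate Y (J : nat -> \bar R) C b : population_process Y -> 0 < b < 1 -> 0 <= C ->
  (forall n, (J n <= \int[P]_t (if (0 < Y n t)%N then C * b ^+ Y n t else 0)%:E)%E) ->
  exists D N, forall n, (N <= n)%N -> (J n <= (D * theta ^+ n)%:E)%E.
Proof.
move=> hY b01 C0 hJ; have [mY _] := process_scales hY.
have b01' : 0 <= b < 1 by lra.
have [D D0 [n1 hD]] := population_pgf_le hY b01'.
exists (C * D), n1 => n nn; apply: le_trans (hJ n) _.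
have bb : nbounded (fun k => b ^+ k) by apply: nbounded_exp; rewrite ger0_norm; lra.
have b0 : nbounded (fun k => 0 ^+ k : R) by apply: nbounded_exp; rewrite normr0.
have -> : (\int[P]_t (if (0 < Y n t)%N then C * b ^+ Y n t else 0)%:E)%E =
    (\int[P]_t (C * (b ^+ Y n t - 0 ^+ Y n t))%:E)%E.
  apply: eq_integral => t _; case: (posnP (Y n t)) => [->|yt].
    by rewrite !expr0 subrr mulr0.
  by rewrite [0 ^+ _]expr0n gtn_eqF// subr0.
rewrite -(@EFin_nexp _ _ _ P (Y n) (mY n) (fun k => C * (b ^+ k - 0 ^+ k))); last first.
  by apply: nboundedZ; exact: nboundedB.
rewrite lee_fin nexpZ//; last exact: nboundedB.
by rewrite nexpB// -mulrA ler_wpM2l//; exact: hD.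
Qed.

Lemma deviation_rates (b : nat -> R) :
  (forall eps, 0 < eps -> exists D1 n1, forall n, (n1 <= n)%N ->
    (ratio_deviation P (X n.+1) (N n) m eps <= (D1 * b n)%:E)%E) ->
  (forall eps, 0 < eps -> exists D2 n2, forall n, (n2 <= n)%N ->
    (ratio_deviation P (N n) (X n) tau eps <= (D2 * b n)%:E)%E) ->
  forall eps j, 0 < eps -> (1 <= j <= 3)%N -> exists D n0, forall n, (n0 <= n)%N ->
    (J X0 xis phis m tau j eps n <= (D * b n)%:E)%E.
Proof.
move=> h1 h2.
have h3 eps : 0 < eps -> exists D n0, forall n, (n0 <= n)%N ->
    (ratio_deviation P (X n.+1) (X n) a eps <= (D * b n)%:E)%E.
  move=> e0; have e2 : 0 < eps / (2 * m) by rewrite divr_gt0// mulr_gt0.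
  have e1 : 0 < eps / (2 * (tau + eps / (2 * m))) by rewrite divr_gt0// mulr_gt0// addr_gt0.
  have [D1 [n1 hD1]] := h1 _ e1; have [D2 [n2 hD2]] := h2 _ e2.
  exists (D1 + D2), (n1 + n2)%N => n nn.
  apply: le_trans (deviation3_le model n m0 tau0 e0) _.
  have -> : ((D1 + D2) * b n)%:E = ((D1 * b n)%:E + (D2 * b n)%:E)%E by rewrite -EFinD mulrDl.
  apply: leeD.
    by apply: hD1; apply: leq_trans nn; exact: leq_addr.
  by apply: hD2; apply: leq_trans nn; exact: leq_addl.
by move=> eps [|[|[|[|j]]]]//= e0 _; [exact: h1|exact: h2|exact: h3].
Qed.

Lemma polynomial_deviation p : 2 <= p ->
  (\int[P]_t (`|(xi t)%:R - m| `^ p)%:E < +oo)%E ->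
  (ereal_sup [set ((k%:R `^ (- (p / 2)))%:E *
                   \int[P]_t (`|(phi t k)%:R - tau * k%:R| `^ p)%:E)%E |
              k in [set k : nat | (1 <= k)%N]] < +oo)%E ->
  forall (eps : R) (j : nat), 0 < eps -> (1 <= j <= 3)%N ->
  (limn_esup (fun n : nat => J X0 xis phis m tau j eps n *
                ((bsc theta a (p / 2) n)^-1)%:E) < +oo)%E.
Proof.
move=> p2 hxi hphi eps j e0 hj; have q0 : 0 < p / 2 by lra.
have [D [n0 hD]] : exists D n0, forall n, (n0 <= n)%N ->
    (J X0 xis phis m tau j eps n <= (D * bsc theta a (p / 2) n)%:E)%E.
  apply: deviation_rates => // {}eps {}e0.
    have [C C0 hC] := walk_off_power mxi (cbp_mean model) p2 hxi e0.
    have hY : population_process N by right.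
    have [D hD] := polynomial_rate hY q0 C0 (fun n => deviation1_le model n
      (fun l => mulr_ge0 C0 (powR_ge0 l%:R (- (p / 2)))) hC).
    by exists D, 1%N.
  have [C C0 hC] := control_off_power p2 e0 hphi.
  have hY : population_process X by left.
  have [D hD] := polynomial_rate hY q0 C0 (fun n => deviation2_le model n
    (fun l => mulr_ge0 C0 (powR_ge0 l%:R (- (p / 2)))) hC).
  by exists D, 1%N.
apply: (@limn_esup_lty _ _ D n0.+1) => n nn; rewrite muleC.
have n1 : (0 < n)%N by apply: leq_ltn_trans nn.
by rewrite lee_pdivrMl ?bsc0// -EFinM mulrC; apply: hD; exact: ltnW.
Qed.

Lemma exponential_deviation : AD_E phi xi tau ->
  forall (eps : R) (j : nat), 0 < eps -> (1 <= j <= 3)%N ->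
  (limn_esup (fun n : nat => (theta ^- n)%:E * J X0 xis phis m tau j eps n) < +oo)%E.
Proof.
move=> ade eps j e0 hj.
have [D [n0 hD]] : exists D n0, forall n, (n0 <= n)%N ->
    (J X0 xis phis m tau j eps n <= (D * theta ^+ n)%:E)%E.
  apply: (deviation_rates (b := fun n => theta ^+ n)) => // {}eps {}e0.
    have [b b01 [C C0 hC]] := walk_off_exp mxi (cbp_mean model) e0 (AD_E_mgf ade).
    have b0 : 0 <= b by lra.
    have hY : population_process N by right.
    exact: (exponential_rate hY b01 C0 (fun n => deviation1_le model n
      (fun l => mulr_ge0 C0 (exprn_ge0 l b0)) hC)).
  have [b b01 [C C0 hC]] := control_off_exp ade e0.
  have b0 : 0 <= b by lra.
  have hY : population_process X by left.
  exact: (exponential_rate hY b01 C0 (fun n => deviation2_le model n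
    (fun l => mulr_ge0 C0 (exprn_ge0 l b0)) hC)).
apply: (@limn_esup_lty _ _ D n0) => n nn.
by rewrite lee_pdivrMl ?exprn_gt0// -EFinM mulrC; exact: hD.
Qed.

End population_scales.

Theorem theorem2p8 (R : realType) (d : measure_display) (T : measurableType d)
    (P : probability T R)
    (X0 : {RV P >-> nat}) (xis : nat -> nat -> {RV P >-> nat})
    (phis : nat -> {RV P >-> control})
    (xi : {RV P >-> nat}) (phi : {RV P >-> control})
    (m tau : R) (lL lU dL dU : probability nat R) (qL qU theta : R)
    (hmodel : cbp_model X0 xis phis xi phi m)
    (hAD0 : AD0 (fun k => pgf P (fun t => phi t k)) tau lL lU dL dU)
    (hADS : AD_S (pgf P xi) (pgf P X0) (m * tau) lL lU dL dU qL qU theta) :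
  (forall Y : nat -> T -> nat,
     Y = popX X0 xis phis \/ Y = popN X0 xis phis ->
     forall r : R, 0 < r ->
     let ratio := fun n : nat =>
       (harmonic_moment P (Y n) r * ((bsc theta (m * tau) r n)^-1)%:E)%E in
     [/\ (0 < limn_einf ratio)%E, (limn_einf ratio <= limn_esup ratio)%E &
         (limn_esup ratio < +oo)%E]) /\
  (forall p : R, 2 <= p ->
     (\int[P]_t (`|(xi t)%:R - m| `^ p)%:E < +oo)%E ->
     (ereal_sup [set ((k%:R `^ (- (p / 2)))%:E *
                      \int[P]_t (`|(phi t k)%:R - tau * k%:R| `^ p)%:E)%E |
                 k in [set k : nat | (1 <= k)%N]] < +oo)%E ->
     forall (eps : R) (j : nat), 0 < eps -> (1 <= j <= 3)%N ->
     (limn_esup (fun n : nat => J X0 xis phis m tau j eps n *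
                   ((bsc theta (m * tau) (p / 2) n)^-1)%:E) < +oo)%E) /\
  (AD_E phi xi tau ->
     forall (eps : R) (j : nat), 0 < eps -> (1 <= j <= 3)%N ->
     (limn_esup (fun n : nat => (theta ^- n)%:E * J X0 xis phis m tau j eps n)
        < +oo)%E).
Proof.
split; [|split].
- by move=> Y hY r r0; exact: (harmonic_moment_ratio hmodel hAD0 hADS hY r0).
- exact: (polynomial_deviation hmodel hAD0 hADS).
- exact: (exponential_deviation hmodel hAD0 hADS).
Qed.
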